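(* Let $p$ be a prime, $\kappa_p(v):=\rho_p\left(\frac12+\frac{v+1}{v-1}\right)$, and let $B_p(v)$ be the Blaschke product associated to the sequence $x_p(n)=\frac{4\pi n-i\log p}{4\pi n+3i\log p}\in\mathcal{U}$, $n\in\mathbb{Z}$. (i) The product $\iota(v)=\kappa_p(v)B_p(v)$ is the inner function $-p^{\frac{v+1}{v-1}}$. (ii) The kernel of $(1-\mathcal{P})\kappa_p\mathcal{P}$, viewed as an operator from $H^2(\mathcal{U})$ to $H^2(\mathcal{U})^\perp$, is the shift invariant subspace $B_pH^2(\mathcal{U})$ of $H^2(\mathcal{U})$ of multiples of $B_p$. (iii) The cokernel of $(1-\mathcal{P})\kappa_p\mathcal{P}$, i.e. the orthogonal complement of its range in $H^2(\mathcal{U})^\perp$, is the image of its kernel by the unitary involution $J:L^2(S^1)\to L^2(S^1)$, $Jf(z):=z^{-1}f(z^{-1})$.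
   Context: $\rho_p(z):=\dfrac{1-p^{z-1}}{1-p^{-z}}$. $\mathcal{U}=\{v\in\mathbb{C}\mid|v|<1\}$ is the open unit disk; the map $v\mapsto\frac12+\frac{v+1}{v-1}$ sends $\mathcal{U}$ conformally onto $\{\Re(z)<\frac12\}$, so $\kappa_p$ is meromorphic in $\mathcal{U}$ and of modulus $1$ on $S^1\setminus\{1\}$. $L^2(S^1)$ is taken with normalized arc length, $\mathcal{P}$ is the orthogonal projection of $L^2(S^1)$ onto the Hardy space $H^2(\mathcal{U})$ (closed span of $z^k$, $k\ge0$), and functions act by multiplication. The Blaschke product associated to a sequence $\alpha_n\in\mathcal{U}\setminus\{0\}$ with $\sum_n(1-|\alpha_n|)<\infty$ is $\prod_n\frac{\alpha_n-v}{1-\bar\alpha_nv}\cdot\frac{|\alpha_n|}{\alpha_n}$. The sequence $x_p(n)$ satisfies this condition. An inner function is an element of $H^\infty(\mathcal{U})$ whose boundary values have modulus $1$ almost everywhere on $S^1$. *)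

(* Defs.v *)
From HB Require Import structures.
From mathcomp Require Import all_boot all_order all_algebra.
From mathcomp Require Export complex.
From mathcomp Require Import all_classical all_reals all_analysis.

Set Implicit Arguments.
Unset Strict Implicit.
Unset Printing Implicit Defensive.

Import Order.TTheory GRing.Theory Num.Theory.
Import numFieldNormedType.Exports.

Local Open Scope classical_set_scope.
Local Open Scope ring_scope.
Local Open Scope complex_scope.

(* The real-valued projections, not the algC-style ones of ssrnum. *)
Local Notation Re := complex.Re.
Local Notation Im := complex.Im.

(* The topology of the complex numbers is that of the numeric field R[i]. *)
Notation Cplx R := (R[i] : numFieldType).

Definition cexp (R : realType) (z : R[i]) : R[i] :=
  (expR (Re z))%:C * (cos (Im z) +i* sin (Im z)).

Definition cpow (R : realType) (p : nat) (z : R[i]) : R[i] :=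
  cexp (z * (ln (p%:R : R))%:C).

Definition cayley (R : realType) (v : R[i]) : R[i] := (v + 1) / (v - 1).

Definition rho (R : realType) (p : nat) (z : R[i]) : R[i] :=
  (1 - cpow p (z - 1)) / (1 - cpow p (- z)).

(* Meromorphic in the disk, with poles at the v = xseq R p n, where the argument
   of rho is 2 i pi n / ln p and the total division returns 0: identities
   between meromorphic functions are to be read away from these points. *)
Definition kappa (R : realType) (p : nat) (v : R[i]) : R[i] :=
  rho p (2^-1 + cayley v).

Definition xseq (R : realType) (p : nat) (n : int) : R[i] :=
  ((4 * pi * n%:~R : R)%:C - 'i%C * (ln p%:R)%:C)
  / ((4 * pi * n%:~R : R)%:C + 3 * 'i%C * (ln p%:R)%:C).

Definition unit_disk (R : realType) : set R[i] := [set v | `|v| < 1].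

Definition blaschke_factor (R : realType) (a v : R[i]) : R[i] :=
  (a - v) / (1 - a^* * v) * (`|a| / a).

(* Blaschke products converge absolutely in the disk, so the symmetric partial
   products (over -N <= n <= N) compute the product over all integers. *)
Definition blaschke_partial (R : realType) (a : int -> R[i]) (v : R[i])
    (N : nat) : R[i] :=
  \prod_(k < N.*2.+1) blaschke_factor (a (k%:Z - N%:Z)) v.

Definition blaschke (R : realType) (a : int -> R[i]) (v : R[i]) : R[i] :=
  lim ((blaschke_partial a v : nat -> Cplx R) @ \oo).

(* Boundary values on the circle are radial limits. *)
Definition radial (R : realType) (F : R[i] -> R[i]) (z : R[i]) (r : R) :
  Cplx R := F (r%:C * z).

Definition boundary (R : realType) (F : R[i] -> R[i]) (z : R[i]) : R[i] :=
  lim (radial F z r @[r --> (1 : R)^'-]).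

(* A function on the circle is represented by a function on the complex numbers
   of which only the values at the points [circle t], 0 <= t <= 1, matter;
   normalized arc length is the image of the Lebesgue measure on [0, 1]. *)
Definition circle (R : realType) (t : R) : R[i] :=
  cos (2 * pi * t) +i* sin (2 * pi * t).

Definition circle_ae (R : realType) (P : R[i] -> Prop) : Prop :=
  {ae (@lebesgue_measure R), forall t, t \in `[0, 1] -> P (circle t)}.

Definition ae_eq_circle (R : realType) (f g : R[i] -> R[i]) : Prop :=
  circle_ae (fun z => f z = g z).

Definition circle_int (R : realType) (f : R[i] -> R[i]) : R[i] :=
  Rintegral (@lebesgue_measure R) `[0, 1] (fun t => Re (f (circle t)))
  +i* Rintegral (@lebesgue_measure R) `[0, 1] (fun t => Im (f (circle t))).

Definition L2 (R : realType) : set (R[i] -> R[i]) := [set f : R[i] -> R[i] |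
  [/\ measurable_fun (`[0, 1] : set R) (fun t : R => Re (f (circle t))),
      measurable_fun (`[0, 1] : set R) (fun t : R => Im (f (circle t))) &
      (\int[@lebesgue_measure R]_(t in `[0%R, 1%R])
         ((Re `|f (circle t)|) ^+ 2)%:E < +oo)%E]].

Definition dotL2 (R : realType) (f g : R[i] -> R[i]) : R[i] :=
  circle_int (fun z => f z * (g z)^*).

Definition normL2 (R : realType) (f : R[i] -> R[i]) : R :=
  Num.sqrt (Re (dotL2 f f)).

Definition closed_in_L2 (R : realType) (M : set (R[i] -> R[i])) : Prop :=
  forall f, L2 f ->
    (forall e : R, 0 < e -> exists2 g, M g & normL2 (f \- g) < e) -> M f.

(* The closed span of the z ^+ k, k >= 0; the span consists of polynomials. *)
Definition H2 (R : realType) : set (R[i] -> R[i]) := [set f : R[i] -> R[i] | L2 f /\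
  forall e : R, 0 < e -> exists q : {poly R[i]},
    normL2 (f \- (fun z => q.[z])) < e].

Definition H2perp (R : realType) : set (R[i] -> R[i]) := [set f : R[i] -> R[i] | L2 f /\
  forall h, H2 h -> dotL2 f h = 0].

(* The orthogonal projection of L2 onto H2, as a choice of representative of
   the class of the projection, which is unique up to a.e. equality. *)
Definition hardy_proj (R : realType) (f : R[i] -> R[i]) : R[i] -> R[i] :=
  xget (fun=> 0) [set g : R[i] -> R[i] | H2 g /\ H2perp (f \- g)].

Definition hankel (R : realType) (k : R[i] -> R[i]) (f : R[i] -> R[i]) :
    R[i] -> R[i] :=
  let g := k \* hardy_proj f in g \- hardy_proj g.

Definition hankel_ker (R : realType) (k : R[i] -> R[i]) : set (R[i] -> R[i]) :=
  [set f : R[i] -> R[i] | H2 f /\ ae_eq_circle (hankel k f) (fun=> 0)].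

Definition hankel_coker (R : realType) (k : R[i] -> R[i]) :
    set (R[i] -> R[i]) :=
  [set g : R[i] -> R[i] | H2perp g /\ forall f, H2 f -> dotL2 g (hankel k f) = 0].

Definition H2_multiples (R : realType) (F : R[i] -> R[i]) :
    set (R[i] -> R[i]) :=
  [set f : R[i] -> R[i] | L2 f /\ exists2 g, H2 g & ae_eq_circle f (boundary F \* g)].

Definition shift_invariant_subspace (R : realType) (M : set (R[i] -> R[i])) :
    Prop :=
  [/\ M `<=` @H2 R,
      M (fun=> 0),
      (forall (c : R[i]) f g, M f -> M g -> M (fun z => c * f z + g z)),
      closed_in_L2 M &
      (forall f, M f -> M (fun z => z * f z))].

Definition J (R : realType) (f : R[i] -> R[i]) : R[i] -> R[i] :=
  fun z => z^-1 * f z^-1.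

(* The image under T of a set of classes modulo a.e. equality. *)
Definition image_ae (R : realType) (T : (R[i] -> R[i]) -> (R[i] -> R[i]))
    (M : set (R[i] -> R[i])) : set (R[i] -> R[i]) :=
  [set g : R[i] -> R[i] | L2 g /\ exists2 f, M f & ae_eq_circle g (T f)].

Definition unitary_involution (R : realType)
    (T : (R[i] -> R[i]) -> (R[i] -> R[i])) : Prop :=
  [/\ (forall f, L2 f -> L2 (T f)),
      (forall f g, L2 f -> L2 g -> ae_eq_circle f g ->
         ae_eq_circle (T f) (T g)),
      (forall (c : R[i]) f g, L2 f -> L2 g ->
         ae_eq_circle (T (fun z => c * f z + g z))
                      (fun z => c * T f z + T g z)),
      (forall f g, L2 f -> L2 g -> dotL2 (T f) (T g) = dotL2 f g) &
      (forall f, L2 f -> ae_eq_circle (T (T f)) f)].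

Definition holomorphic_disk (R : realType) (F : R[i] -> R[i]) : Prop :=
  forall v : R[i], unit_disk v ->
    derivable (F : (Cplx R)^o -> (Cplx R)^o) v 1.

Definition Hinfty (R : realType) (F : R[i] -> R[i]) : Prop :=
  holomorphic_disk F /\
  exists M : R, forall v, unit_disk v -> `|F v| <= M%:C.

Definition inner_function (R : realType) (F : R[i] -> R[i]) : Prop :=
  Hinfty F /\
  circle_ae (fun z => exists2 l : R[i],
    (radial F z r @[r --> (1 : R)^'-] --> (l : Cplx R)) & `|l| = 1).

(* Main.v *)
Require Import Defs.
From HB Require Import structures.
From mathcomp Require Import all_boot all_order all_algebra.
From mathcomp Require Import all_classical all_reals all_analysis.
From mathcomp Require Import measurable_realfun ring lra zify.

(** Write [w = (v + 1) / (v - 1)], which maps the disk to the left half-plane,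
   [S = p ^ w], the singular inner function, and [a = p ^ (-1/2)]. Everything
   rests on two formulas:

     [kappa = (1 - a S) / (1 - a / S)]   and   [B = (a - S) / (1 - a S)].

   The first one is immediate ([kappaE]). The second one says that the Blaschke
   product is a Frostman shift of [S] ([blaschkeE]): with [L = ln p], the factors
   of the zeros of index [n] and [- n] combine into the quotient of the n-th
   factors of Euler's product for sinh, taken at [L (w + 1/2) / 2] and at
   [L (w - 1/2) / 2], and the quotient of the two hyperbolic sines is
   [(a - S) / (1 - a S)]. Euler's product is obtained from the factorization of
   [(1 + x/m)^m - (1 - x/m)^m] over the roots of unity ([cvg_sinhprod]). Then
   [kappa B = - S] is algebra ([kappa_blaschke]). On the circle [w] is
   imaginary, so [S], [B] and [kappa] are unimodular there.

   For the operator, [f] is in the kernel iff [f] and [h = kappa f] are both in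
   H^2 ([hankel_kerE]). Multiplication by [S] and by [B] preserves H^2: [S] is the
   limit of [(1 - L w / m)^-m], whose factors are Moebius maps bounded by 1 on the
   circle with their pole outside the closed disk ([mult_singinner]), and [B] is
   [a - S] times the geometric series of [a S] ([mult_frostman]). Hence a multiple
   [f = B g] has [kappa f = - S g] in H^2. Conversely
   [(1 - a conj S) h = (1 - a S) f] on the circle, so
   [conj S h = (h - f + a S f) / a] is in H^2, and [f = B (- conj S h)]
   ([hankel_ker_multiples]).

   A function [g] orthogonal to H^2 is in the cokernel iff [conj kappa g] is
   orthogonal to H^2 ([hankel_cokerE]). Since [J] exchanges H^2 and its orthogonal
   complement, and [J (kappa f) = conj kappa (J f)], this is the condition for
   [J g] to be in the kernel ([hankel_coker_image]).

   Two facts on L2(S^1) are used throughout. The orthogonal projection to H^2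
   exists; this follows from the completeness of L2 ([riesz_fischer],
   [orthogonal_projection]). And H^2 consists of the functions whose Fourier
   coefficients of negative index vanish ([H2_char]), which amounts to the totality
   of the exponentials [z ^ k] ([zpow_total]): functions orthogonal to all of them
   are stable under multiplication by bounded pointwise limits of trigonometric
   polynomials, among which are the indicators of arcs, so their integrals over
   arcs vanish. *)

Set Implicit Arguments.
Unset Strict Implicit.
Unset Printing Implicit Defensive.
Import Order.TTheory GRing.Theory Num.Theory.
Import numFieldNormedType.Exports.
Local Open Scope classical_set_scope.
Local Open Scope ring_scope.
Local Open Scope complex_scope.
Local Notation Re := complex.Re.
Local Notation Im := complex.Im.
Local Notation "x ^*" := (Num.conj x) : complex_scope.

(** * The modulus of a complex number *)

Section ComplexModulus.
Variable R : realType.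
Implicit Types (z w : R[i]) (x y : R).

Definition cabs (z : R[i]) : R := Re `|z|.

Lemma normC_cabs z : `|z| = (cabs z)%:C.
Proof. by rewrite /cabs normc_def. Qed.

Lemma cabsE z : cabs z = Num.sqrt (Re z ^+ 2 + Im z ^+ 2).
Proof. by rewrite /cabs normc_def. Qed.

Lemma cabs_ge0 z : 0 <= cabs z.
Proof. by rewrite cabsE sqrtr_ge0. Qed.

Lemma sqr_cabs z : cabs z ^+ 2 = Re z ^+ 2 + Im z ^+ 2.
Proof. by rewrite cabsE sqr_sqrtr // addr_ge0 ?sqr_ge0. Qed.

Lemma cabsM z w : cabs (z * w) = cabs z * cabs w.
Proof. by apply: complexI; rewrite -normC_cabs normrM !normC_cabs rmorphM. Qed.

Lemma cabsD z w : cabs (z + w) <= cabs z + cabs w.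
Proof. by rewrite -lecR -normC_cabs rmorphD /= -!normC_cabs ler_normD. Qed.

Lemma cabsN z : cabs (- z) = cabs z.
Proof. by rewrite /cabs normrN. Qed.

Lemma cabsBC z w : cabs (z - w) = cabs (w - z).
Proof. by rewrite -cabsN opprB. Qed.

Lemma cabsV z : cabs z^-1 = (cabs z)^-1.
Proof. by apply: complexI; rewrite -normC_cabs normfV normC_cabs fmorphV. Qed.

Lemma cabsX z n : cabs (z ^+ n) = cabs z ^+ n.
Proof. by apply: complexI; rewrite -normC_cabs normrX normC_cabs rmorphXn. Qed.

Lemma cabs0 : cabs 0 = 0.
Proof. by rewrite /cabs normr0. Qed.

Lemma cabs1 : cabs 1 = 1.
Proof. by rewrite /cabs normr1. Qed.

Lemma cabs_eq0 z : (cabs z == 0) = (z == 0).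
Proof. by apply/eqP/eqP => [h|->]; [apply/eqP; rewrite -normr_eq0 normC_cabs h|exact: cabs0]. Qed.

Lemma cabs_gt0 z : (0 < cabs z) = (z != 0).
Proof. by rewrite lt_def cabs_eq0 cabs_ge0 andbT. Qed.

Lemma cabs_real x : cabs x%:C = `|x|.
Proof. by rewrite cabsE /= expr0n addr0 sqrtr_sqr. Qed.

Lemma cabsJ z : cabs z^* = cabs z.
Proof. by rewrite /cabs norm_conjC. Qed.

Lemma normRe_cabs z : `|Re z| <= cabs z.
Proof. by rewrite cabsE -[X in X <= _]sqrtr_sqr ler_wsqrtr// lerDl sqr_ge0. Qed.

Lemma normIm_cabs z : `|Im z| <= cabs z.
Proof. by rewrite cabsE -[X in X <= _]sqrtr_sqr ler_wsqrtr// lerDr sqr_ge0. Qed.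

Lemma cabs_le_ReIm z : cabs z <= `|Re z| + `|Im z|.
Proof.
rewrite [z in cabs z]complexE; apply: (le_trans (cabsD _ _)).
rewrite cabsM !cabs_real [cabs 'i]cabsE /=.
by rewrite expr0n expr1n add0r sqrtr1 mul1r.
Qed.

Lemma cabs_sum (I : Type) (s : seq I) (P : pred I) (F : I -> R[i]) :
  cabs (\sum_(i <- s | P i) F i) <= \sum_(i <- s | P i) cabs (F i).
Proof.
elim/big_ind2 : _ => //; first by rewrite cabs0.
by move=> a b c d ab cd; apply: (le_trans (cabsD _ _)); exact: lerD.
Qed.

Lemma mulJc z : z * z^* = ((cabs z) ^+ 2)%:C.
Proof. by rewrite rmorphXn /= -normC_cabs sqr_normc. Qed.

Lemma Re_mulc z w : Re (z * w) = Re z * Re w - Im z * Im w.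
Proof. by case: z w => a b [c d]. Qed.

Lemma Im_mulc z w : Im (z * w) = Re z * Im w + Im z * Re w.
Proof. by case: z w => a b [c d]. Qed.

Lemma Re_addc z w : Re (z + w) = Re z + Re w.
Proof. by case: z w => a b [c d]. Qed.

Lemma Im_addc z w : Im (z + w) = Im z + Im w.
Proof. by case: z w => a b [c d]. Qed.

Lemma Re_oppc z : Re (- z) = - Re z. Proof. by case: z. Qed.
Lemma Im_oppc z : Im (- z) = - Im z. Proof. by case: z. Qed.

Lemma Re_conjc z : Re z^* = Re z. Proof. by case: z. Qed.
Lemma Im_conjc z : Im z^* = - Im z. Proof. by case: z. Qed.

Lemma complex_ext z w : Re z = Re w -> Im z = Im w -> z = w.
Proof. by case: z w => a b [c d] /= -> ->. Qed.

(** The order on complex numbers compares only elements with the same imaginary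
   part, so the metric of the field is read off through the real modulus. *)
Lemma cvg_cabsP (T : Type) (F : set_system T) {FF : Filter F} (f : T -> R[i])
    (l : R[i]) :
  (f x @[x --> F] --> (l : Cplx R)) <-> (cabs (f x - l) @[x --> F] --> (0 : R)).
Proof.
have lim := @cvgrPdist_lt (Cplx R) (Cplx R) T F FF (f : T -> Cplx R) l.
split => [/lim H|/cvgrPdist_lt H].
  apply/cvgrPdist_lt => e e0.
  have e0C : 0 < e%:C by rewrite ltcR.
  near=> x; rewrite sub0r normrN ger0_norm ?cabs_ge0 //.
  rewrite -ltcR -normC_cabs distrC; near: x; exact: H.
apply/lim => -[e e']; rewrite ltcE /= => /andP[/eqP -> e0].
near=> x; rewrite distrC normC_cabs ltcR.
have : `|0 - cabs (f x - l)| < e by near: x; exact: H.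
by rewrite sub0r normrN ger0_norm ?cabs_ge0.
Unshelve. all: by end_near. Qed.

Lemma cvg_cabs_le (T : Type) (F : set_system T) {FF : Filter F} (f : T -> R[i])
    (g : T -> R) (l : R[i]) :
  (\forall x \near F, cabs (f x - l) <= g x) -> g x @[x --> F] --> (0 : R) ->
  f x @[x --> F] --> (l : Cplx R).
Proof.
move=> fg g0; apply/cvg_cabsP.
apply: (squeeze_cvgr (f := fun=> 0 : R) (h := g)) => //; last exact: cvg_cst.
by apply: filterS fg => x ->; rewrite cabs_ge0.
Qed.

End ComplexModulus.

(** * The complex exponential *)

Section ComplexExponential.
Variable R : realType.
Implicit Types (z w : R[i]) (x y : R).

Lemma cexpE z : cexp z = (expR (Re z) * cos (Im z)) +i* (expR (Re z) * sin (Im z)).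
Proof. by rewrite /cexp; apply: complex_ext; rewrite ?Re_mulc ?Im_mulc /= !mul0r ?subr0 ?addr0. Qed.

Lemma cexpD z w : cexp (z + w) = cexp z * cexp w.
Proof.
rewrite !cexpE; apply: complex_ext; rewrite ?Re_mulc ?Im_mulc /= Re_addc Im_addc expRD ?cosD ?sinD; ring.
Qed.

Lemma cexp0 : cexp 0 = 1 :> R[i].
Proof. by rewrite cexpE /= expR0 cos0 sin0 !mul1r. Qed.

Lemma cabs_cexp z : cabs (cexp z) = expR (Re z).
Proof.
rewrite cabsE cexpE /= !exprMn -mulrDr cos2Dsin2 mulr1 sqrtr_sqr.
by rewrite ger0_norm // expR_ge0.
Qed.

Lemma cexp_neq0 z : cexp z != 0.
Proof. by rewrite -cabs_gt0 cabs_cexp expR_gt0. Qed.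

Lemma cexpN z : cexp (- z) = (cexp z)^-1.
Proof.
apply: (@mulIf _ (cexp z)); first exact: cexp_neq0.
by rewrite -cexpD addNr cexp0 mulVf // cexp_neq0.
Qed.

Lemma cexpJ z : cexp z^* = (cexp z)^*.
Proof. by rewrite !cexpE Re_conjc Im_conjc cosN sinN mulrN. Qed.

Lemma cexpMn z n : cexp (n%:R * z) = cexp z ^+ n.
Proof.
elim: n => [|n IH]; first by rewrite mul0r cexp0 expr0.
by rewrite exprS -IH -cexpD; congr cexp; rewrite mulrS mulrDl mul1r.
Qed.

(** The real trigonometric bounds below all come from the mean value theorem:
   the sign of the derivative is known from the previous bound. *)
Lemma ge0_of_deriv_ge0 (f df : R -> R) x :
  (forall t, is_derive (t : R) (1 : R) f (df t)) -> f 0 = 0 ->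
  (forall t, 0 <= t <= x -> 0 <= df t) -> 0 <= x -> 0 <= f x.
Proof.
move=> fdf f0 df0; rewrite le_eqVlt => /predU1P[<-|x0]; first by rewrite f0.
have cf : {within `[0, x], continuous f}.
  apply: continuous_subspaceT => t.
  by apply/differentiable_continuous/derivable1_diffP; case: (fdf t).
have [c /[!in_itv] /= /andP[c0 cx]] := MVT x0 (fun t _ => fdf t) cf.
rewrite f0 !subr0 => ->; apply: mulr_ge0; last exact: ltW.
by apply: df0; rewrite (ltW c0) (ltW cx).
Qed.

Lemma sin_le_id x : 0 <= x -> sin x <= x.
Proof.
move=> x0; rewrite -subr_ge0.
apply: (@ge0_of_deriv_ge0 (fun t => t - sin t) (fun t => 1 - cos t)) => //.
by rewrite sin0 subr0.
Qed.

Lemma cos_ge_quad x : 1 - x ^+ 2 / 2 <= cos x.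
Proof.
wlog x0 : x / 0 <= x => [H|].
  have [/H//|/ltW x0] := leP 0 x.
  by rewrite -cosN -sqrrN; apply: H; rewrite oppr_ge0.
rewrite -subr_ge0.
apply: (@ge0_of_deriv_ge0 (fun t => cos t - (1 - t ^+ 2 / 2)) (fun t => t - sin t)) => //.
- move=> t; apply: is_derive_eq; rewrite /GRing.scale /=; by field.
- by rewrite cos0 expr0n mul0r subr0 subrr.
- by move=> t /andP[t0 _]; rewrite subr_ge0 sin_le_id.
Qed.

Lemma sin_ge_cubic x : 0 <= x -> x - x ^+ 3 / 6 <= sin x.
Proof.
move=> x0; rewrite -subr_ge0.
apply: (@ge0_of_deriv_ge0 (fun t => sin t - (t - t ^+ 3 / 6)) (fun t => cos t - (1 - t ^+ 2 / 2))) => //.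
- move=> t; apply: is_derive_eq; rewrite /GRing.scale /=; by field.
- by rewrite sin0 expr0n mul0r !subr0.
- by move=> t _; rewrite subr_ge0 cos_ge_quad.
Qed.

Lemma mulr_cos_le_sin x : 0 <= x <= pi -> x * cos x <= sin x.
Proof.
move=> /andP[x0 xpi]; rewrite -subr_ge0.
apply: (@ge0_of_deriv_ge0 (fun t => sin t - t * cos t) (fun t => t * sin t)) => //.
- move=> t; apply: is_derive_eq; rewrite /GRing.scale /=; ring.
- by rewrite sin0 mul0r subr0.
- move=> t /andP[t0 tx]; rewrite mulr_ge0 // sin_ge0_pi // t0 /=.
  exact: le_trans xpi.
Qed.


Lemma expR_le_quad x : x <= 1 / 2 -> expR x <= 1 + x + 2 * x ^+ 2.
Proof.
move=> x2; have h := expR_ge1Dx (- x).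
have : expR x * (1 - x) <= 1.
  by rewrite -[leRHS](expRxMexpNx_1 x) ler_pM2l ?expR_gt0.
have e0 := expR_gt0 x; nra.
Qed.

(** A second-order Taylor bound, from the real bounds for [expR], [cos] and [sin]. *)
Lemma cabs_cexp_sub1 z : cabs z <= 1 / 2 -> cabs (cexp z - 1 - z) <= 8 * cabs z ^+ 2.
Proof.
case: z => a b zle; apply: (le_trans (cabs_le_ReIm _)).
have /= aa := normRe_cabs (a +i* b); have /= bb := normIm_cabs (a +i* b).
rewrite sqr_cabs /= !mul0r addr0 !subr0.
have {}aa : `|a| <= 1 / 2 := le_trans aa zle.
have {}bb : `|b| <= 1 / 2 := le_trans bb zle.
move: aa; rewrite ler_norml => /andP[a1 a2].
have ea1 := expR_ge1Dx a; have ea2 := expR_le_quad a2.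
have cb1 := cos_le1 b; have cb2 := cos_ge_quad b.
have sb : `|sin b - b| <= b ^+ 2.
  wlog b0 : b bb {zle cb1 cb2} / 0 <= b => [H|].
    have [/H//|/ltW b0] := leP 0 b; first exact.
    have -> : `|sin b - b| = `|sin (- b) - - b|.
      by rewrite sinN -normrN; congr `|_|; ring.
    by rewrite -sqrrN; apply: H; rewrite ?normrN ?oppr_ge0.
  move: bb; rewrite ger0_norm // => bb.
  have s1 := sin_le_id b0; have s2 := sin_ge_cubic b0.
  rewrite ler0_norm ?subr_le0 //; nra.
have e2 : expR a <= 2 by nra.
set E := expR a in e2 ea1 ea2 *; set c := cos b in cb1 cb2 *.
have h1 : `|E * c - 1 - a| <= 2 * a ^+ 2 + b ^+ 2.
  rewrite ler_norml; apply/andP; split; nra.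
have h2 : `|E * sin b - b| <= 2 * b ^+ 2 + 2 * a ^+ 2 + 2 * b ^+ 2.
  have -> : E * sin b - b = E * (sin b - b) + (E - 1) * b by ring.
  apply: (le_trans (ler_normD _ _)); rewrite !normrM.
  have E0 : 0 < E := expR_gt0 a.
  have k1 : `|E| * `|sin b - b| <= 2 * b ^+ 2.
    by rewrite gtr0_norm //; apply: ler_pM => //; exact: ltW.
  have k2 : `|E - 1| <= 2 * `|a|.
    rewrite ler_norml; have := normr_ge0 a; have := ler_norm a.
    have := ler_norm (- a); rewrite normrN; nra.
  have k3 : `|E - 1| * `|b| <= 2 * a ^+ 2 + 2 * b ^+ 2.
    apply: (@le_trans _ _ (2 * `|a| * `|b|)); first by rewrite ler_wpM2r.
    by rewrite -(real_normK (num_real a)) -(real_normK (num_real b)); nra.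
  lra.
apply: (le_trans (lerD h1 h2)); have := sqr_ge0 a; have := sqr_ge0 b; lra.
Qed.

(** The telescoping factorization of [A ^+ n.+1 - B ^+ n.+1]. *)
Lemma cabs_subX (A B : R[i]) (M : R) n : cabs A <= M -> cabs B <= M ->
  cabs (A ^+ n.+1 - B ^+ n.+1) <= n.+1%:R * M ^+ n * cabs (A - B).
Proof.
move=> AM BM; rewrite subrXX cabsM mulrC ler_wpM2r ?cabs_ge0 //.
apply: (le_trans (cabs_sum _ _ _)).
have -> : n.+1%:R * M ^+ n = \sum_(i < n.+1) M ^+ n.
  by rewrite sumr_const card_ord mulr_natl.
apply: ler_sum => i _; rewrite cabsM !cabsX.
have -> : M ^+ n = M ^+ (n.+1.-1 - i) * M ^+ i.
  by rewrite -exprD subnK //= -ltnS.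
have M0 : 0 <= M := le_trans (cabs_ge0 _) AM.
by apply: ler_pM; rewrite ?exprn_ge0 ?cabs_ge0 //; apply: lerXn2r; rewrite ?nnegrE ?cabs_ge0.
Qed.

Lemma cvg_natinv_scale (c : R) : c * n.+1%:R^-1 @[n --> \oo] --> (0 : R).
Proof.
rewrite -[X in _ --> X](mulr0 c); apply: cvgM; [exact: cvg_cst|exact: cvg_harmonic].
Qed.

(** Compare [1 + z/m] with [cexp (z/m)]: they differ by a multiple of 1/m^2 and
   are both bounded by [expR (|z|/m)], so their m-th powers differ by O(1/m). *)
Lemma cabs_pow_sub_cexp z m : 2 * cabs z <= m.+1%:R ->
  cabs ((1 + z / m.+1%:R) ^+ m.+1 - cexp z)
    <= 8 * expR (cabs z) * cabs z ^+ 2 * m.+1%:R^-1.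
Proof.
move=> zm; set k := m.+1%:R : R[i]; set y := z / k.
have m0 : 0 < m.+1%:R :> R by rewrite ltr0n.
have k0 : k != 0 by rewrite pnatr_eq0.
have yE : cabs y = cabs z / m.+1%:R.
  have kE : k = (m.+1%:R : R)%:C by rewrite /k rmorph_nat.
  by rewrite cabsM cabsV kE cabs_real ger0_norm // ler0n.
have -> : cexp z = cexp y ^+ m.+1 by rewrite -cexpMn /y mulrC mulfVK.
have hy : cabs y <= 1 / 2.
  by rewrite yE ler_pdivrMr //; move: zm; lra.
have b1 : cabs (1 + y) <= expR (cabs y).
  apply: le_trans (expR_ge1Dx _); apply: (le_trans (cabsD _ _)).
  by rewrite cabs1.
have b2 : cabs (cexp y) <= expR (cabs y).
  by rewrite cabs_cexp ler_expR (le_trans (ler_norm _)) ?normRe_cabs.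
apply: (le_trans (cabs_subX m b1 b2)).
have d : cabs (1 + y - cexp y) <= 8 * cabs y ^+ 2.
  by rewrite cabsBC opprD addrA cabs_cexp_sub1.
have e : expR (cabs y) ^+ m <= expR (cabs z).
  rewrite -expRM_natl ler_expR yE mulrA ler_pdivrMr // mulrC ler_wpM2l ?cabs_ge0 //.
  by rewrite ler_nat.
apply: (@le_trans _ _ (m.+1%:R * expR (cabs z) * (8 * cabs y ^+ 2))).
  apply: ler_pM => //; rewrite ?cabs_ge0 ?mulr_ge0 ?exprn_ge0 ?expR_ge0 //.
  by rewrite ler_wpM2l.
by rewrite yE le_eqVlt; apply/orP; left; apply/eqP; field; rewrite gt_eqF.
Qed.

Lemma cvg_pow_cexp z : (1 + z / n.+1%:R) ^+ n.+1 @[n --> \oo] --> (cexp z : Cplx R).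
Proof.
apply: (cvg_cabs_le (g := fun n : nat => 8 * expR (cabs z) * cabs z ^+ 2 * n.+1%:R^-1)); last first.
  exact: cvg_natinv_scale.
near=> n; apply: cabs_pow_sub_cexp.
near: n; exists (Num.bound (2 * cabs z)) => // n /= hn.
have := archi_boundP (mulr_ge0 (ler0n R 2) (cabs_ge0 z)).
move=> /ltW /le_trans; apply; rewrite ler_nat; exact: leqW.
Unshelve. all: by end_near. Qed.

End ComplexExponential.

(** * Euler's product for the hyperbolic sine *)

Section EulerProduct.
Variable R : realType.
Implicit Types (x y u z : R[i]).
Local Notation C := R[i].

Lemma prod_pair (G : nat -> C) N :
  \prod_(k < N + N) G k = \prod_(k < N) (G k * G (N + N - k.+1)%N).
Proof.
rewrite big_split_ord /= [X in _ * X](reindex_inj rev_ord_inj) /= -big_split /=.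
by apply: eq_bigr => i _; rewrite addnBA.
Qed.

Lemma cos_lt1 (t : R) : 0 < t < 2 * pi -> cos t < 1.
Proof.
move=> /andP[t0 tpi].
have tE : t = t / 2 + t / 2 by lra.
have s : 0 < sin (t / 2) by apply: sin_gt0_pi; apply/andP; split; lra.
rewrite tE cosD; have := cos2Dsin2 (t / 2); nra.
Qed.

Definition expi_root (m : nat) : C := cexp (0 +i* (2 * pi / m%:R)).

Lemma cexp_im (t : R) : cexp (0 +i* t) = cos t +i* sin t.
Proof. by rewrite cexpE /= expR0 !mul1r. Qed.

Lemma expi_rootX m k : expi_root m ^+ k = cexp (0 +i* (2 * pi * k%:R / m%:R)).
Proof.
rewrite -cexpMn; congr cexp.
have -> : (k%:R : C) = (k%:R : R)%:C by rewrite rmorph_nat.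
by apply: complex_ext; rewrite ?Re_mulc ?Im_mulc /=; ring.
Qed.

Lemma expi_root_order m : expi_root m.+1 ^+ m.+1 = 1.
Proof.
rewrite expi_rootX mulfK ?pnatr_eq0 // cexp_im.
by rewrite (_ : 2 * pi = pi *+ 2) ?mulr_natl // cos2pi sin2pi.
Qed.

Lemma expi_root_prim m : m.+1.-primitive_root (expi_root m.+1).
Proof.
apply/andP; split=> //; apply/forallP => i; apply/eqP; rewrite unity_rootE.
have [->|im] := eqVneq i.+1 m.+1; first by rewrite expi_root_order eqxx.
have {}im : (i.+1 < m.+1)%N by rewrite ltn_neqAle im /= ltn_ord.
apply/negP => /eqP; rewrite expi_rootX cexp_im => -[c1 _].
suff : cos (2 * pi * i.+1%:R / m.+1%:R) < 1 :> R by rewrite c1 ltxx.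
have m0 : 0 < m.+1%:R :> R by rewrite ltr0n.
have p0 := pi_gt0 R.
apply: cos_lt1; apply/andP; split; first by rewrite divr_gt0 // !mulr_gt0 ?ltr0n.
by rewrite ltr_pdivrMr // ltr_pM2l ?mulr_gt0 // ltr_nat.
Qed.

(** Dividing the factorization of ['X^m - 1] by ['X - 1] leaves an identity that
   also makes sense at 1; its value there is what [prod_4sin2] needs. *)
Lemma sum_pow_expi_root m z :
  \sum_(i < m.+1) z ^+ i = \prod_(k < m) (z - expi_root m.+1 ^+ k.+1).
Proof.
have := factor_Xn_sub_1 (expi_root_prim m).
rewrite big_nat_recl // expr0 big_mkord subrX1 => /(mulfI (monic_neq0 (monicXsubC 1))).
move=> /(congr1 (fun p => p.[z])); rewrite horner_prod horner_sum => h.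
transitivity (\sum_(i < m.+1) ('X^i : {poly C}).[z]); first by apply: eq_bigr => i _; rewrite hornerXn.
rewrite -h.
by apply: eq_bigr => i _; rewrite !hornerE.
Qed.

(** The factors of [X^(2N+1) - Y^(2N+1)] at conjugate roots of unity are
   combined in pairs; at [1 + u] and [1 - u] a pair gives
   4 (sin^2 + u^2 cos^2) of half the angle. *)
Definition pair_factor (m k : nat) (X Y : C) : C :=
  X ^+ 2 + Y ^+ 2 - 2 * (cos (2 * pi * k%:R / m%:R) : R)%:C * X * Y.

Lemma pair_factorE m k X Y : (k <= m.+1)%N ->
  (X - expi_root m.+1 ^+ k * Y) * (X - expi_root m.+1 ^+ (m.+1 - k) * Y) = pair_factor m.+1 k X Y.
Proof.
move=> km; set t := 2 * pi * k%:R / m.+1%:R : R.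
have r1 : expi_root m.+1 ^+ k = cos t +i* sin t by rewrite expi_rootX cexp_im.
have r2 : expi_root m.+1 ^+ (m.+1 - k) = cos t +i* (- sin t).
  apply: (@mulfI _ (expi_root m.+1 ^+ k)); first by rewrite expf_neq0 ?cexp_neq0.
  rewrite -exprD subnKC // expi_root_order r1; have := cos2Dsin2 t => h.
  by apply: complex_ext; rewrite ?Re_mulc ?Im_mulc /= -?h; ring.
rewrite r1 r2 /pair_factor -/t.
have -> : cos t +i* sin t = (cos t)%:C + 'i%C * (sin t)%:C by apply: complexE.
have -> : cos t +i* (- sin t) = (cos t)%:C - 'i%C * (sin t)%:C.
  by apply: complex_ext; rewrite ?Re_addc ?Im_addc ?Re_oppc ?Im_oppc ?Re_mulc ?Im_mulc /=; ring.
have h : (cos t)%:C ^+ 2 + (sin t)%:C ^+ 2 = 1 :> C.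
  by rewrite -!rmorphXn -rmorphD /= cos2Dsin2.
have i2 := sqr_i R.
transitivity (X ^+ 2 - 2 * (cos t)%:C * X * Y
  + ((cos t)%:C ^+ 2 - 'i%C ^+ 2 * (sin t)%:C ^+ 2) * Y ^+ 2); first by ring.
by rewrite i2 mulN1r opprK h; ring.
Qed.

Lemma sum_pow_pair_factor N z : \sum_(i < N.*2.+1) z ^+ i = \prod_(k < N) pair_factor N.*2.+1 k.+1 z 1.
Proof.
rewrite sum_pow_expi_root -addnn (prod_pair (fun k => z - expi_root (N + N).+1 ^+ k.+1)).
apply: eq_bigr => k _; have kN := ltn_ord k.
rewrite -pair_factorE ?mulr1 //; last by rewrite ltnS (leq_trans (ltnW kN)) ?leq_addr.
congr (_ * (_ - _ ^+ _)).
by rewrite subnS prednK ?subSS // subn_gt0 (leq_trans kN) ?leq_addr.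
Qed.

Lemma pair_factor_homog m k X Y : Y != 0 -> pair_factor m k X Y = Y ^+ 2 * pair_factor m k (X / Y) 1.
Proof. by move=> Y0; rewrite /pair_factor; field. Qed.

(** Homogenize [sum_pow_pair_factor]: for [Y != 0] take [z = X / Y]. *)
Lemma subX_pair_factor N X Y :
  X ^+ N.*2.+1 - Y ^+ N.*2.+1 = (X - Y) * \prod_(k < N) pair_factor N.*2.+1 k.+1 X Y.
Proof.
have [->|Y0] := eqVneq Y 0.
  under eq_bigr do rewrite /pair_factor expr0n /= mulr0 subr0 addr0.
  by rewrite prodr_const card_ord expr0n !subr0 -exprM mul2n exprS.
under eq_bigr do rewrite pair_factor_homog //.
rewrite big_split /= prodr_const card_ord -sum_pow_pair_factor -exprM mul2n.
have -> : X - Y = Y * (X / Y - 1) by field.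
rewrite mulrACA -subrX1 -exprS expr_div_n mulrBr mulr1 mulrCA divff ?mulr1 //.
exact: expf_neq0.
Qed.

Definition halfangle N k : R := pi * k.+1%:R / N.*2.+1%:R.

Lemma pair_factor_half N k u : pair_factor N.*2.+1 k.+1 (1 + u) (1 - u)
  = 4 * (((sin (halfangle N k)) ^+ 2)%:C + u ^+ 2 * ((cos (halfangle N k)) ^+ 2)%:C).
Proof.
rewrite /pair_factor; set h := halfangle N k.
have -> : 2 * pi * k.+1%:R / N.*2.+1%:R = h + h :> R.
  by rewrite /h /halfangle -mulrDl; congr (_ / _); ring.
rewrite cosD -!expr2.
have -> : (cos h ^+ 2 - sin h ^+ 2)%:C = (cos h ^+ 2)%:C - (sin h ^+ 2)%:C :> C.
  by rewrite rmorphB.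
have e : (cos h ^+ 2)%:C + (sin h ^+ 2)%:C = 1 :> C by rewrite -rmorphD /= cos2Dsin2.
have -> : (cos h ^+ 2)%:C = 1 - (sin h ^+ 2)%:C :> C by rewrite -e addrK.
ring.
Qed.

Lemma prod_4sin2 N : \prod_(k < N) (4 * ((sin (halfangle N k)) ^+ 2)%:C) = N.*2.+1%:R :> C.
Proof.
transitivity (\prod_(k < N) pair_factor N.*2.+1 k.+1 1 1 : C).
  apply: eq_bigr => k _; have := pair_factor_half N k 0.
  by rewrite addr0 subr0 expr0n /= mul0r addr0.
rewrite -sum_pow_pair_factor (eq_bigr (fun=> 1)) => [|i _]; last by rewrite expr1n.
by rewrite sumr_const card_ord.
Qed.


(** The ratio [t cos t / sin t] at the half angle: it tends to 1 as the angle
   tends to 0, with a quadratic error. *)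
Definition cotratio N k : R :=
  halfangle N k * cos (halfangle N k) / sin (halfangle N k).

Lemma halfangle_bound N k : (k < N)%N -> 0 < halfangle N k < pi / 2.
Proof.
move=> kN; have m0 : 0 < N.*2.+1%:R :> R by rewrite ltr0n.
have p0 := pi_gt0 R.
apply/andP; split; first by rewrite /halfangle divr_gt0 // mulr_gt0 // ltr0n.
rewrite /halfangle ltr_pdivrMr // -mulrA ltr_pM2l // ltr_pdivlMl //.
by rewrite -natrM ltr_nat mul2n ltnS leq_double.
Qed.

Lemma sin_halfangle N k : (k < N)%N -> 0 < sin (halfangle N k).
Proof.
move=> /halfangle_bound /andP[h0 h1]; have p0 := pi_gt0 R.
by apply: sin_gt0_pi; rewrite h0 /=; lra.
Qed.

Lemma cotratio_bound N k : (k < N)%N ->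
  1 - halfangle N k ^+ 2 <= cotratio N k ^+ 2 <= 1.
Proof.
move=> kN; have /andP[h0 h1] := halfangle_bound kN; have s0 := sin_halfangle kN.
have p0 := pi_gt0 R; rewrite /cotratio.
set h := halfangle N k in h0 h1 s0 *.
have c0 : 0 <= cos h by apply: cos_ge0_pihalf; apply/andP; split; lra.
have hc : h * cos h <= sin h by apply: mulr_cos_le_sin; apply/andP; split; lra.
have sh : sin h <= h by apply: sin_le_id; exact: ltW.
have ch : cos h <= h * cos h / sin h.
  by rewrite ler_pdivlMr // mulrC ler_wpM2r.
have r1 : h * cos h / sin h <= 1 by rewrite ler_pdivrMr // mul1r.
have := cos2Dsin2 h.
by move=> e; apply/andP; split; nra.
Qed.

(** The finite form of Euler's product. Factoring [4 sin^2] out of each pair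
   leaves [1 + u^2 cot^2], and the constants multiply to [m] by [prod_4sin2]. *)
Lemma subX_cot N u : ((1 + u) ^+ N.*2.+1 - (1 - u) ^+ N.*2.+1) / 2 =
  N.*2.+1%:R * u * \prod_(k < N)
    (1 + (N.*2.+1%:R * u) ^+ 2 * ((cotratio N k / (pi * k.+1%:R)) ^+ 2)%:C).
Proof.
have E (k : 'I_N) : pair_factor N.*2.+1 k.+1 (1 + u) (1 - u) =
    (4 * ((sin (halfangle N k)) ^+ 2)%:C)
    * (1 + (N.*2.+1%:R * u) ^+ 2 * ((cotratio N k / (pi * k.+1%:R)) ^+ 2)%:C).
  have e : cos (halfangle N k) = sin (halfangle N k) * N.*2.+1%:R
      * (cotratio N k / (pi * k.+1%:R)).
    have m0 : (N.*2.+1%:R : R) != 0 by rewrite pnatr_eq0.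
    have k0 : (k.+1%:R : R) != 0 by rewrite pnatr_eq0.
    have p0 : (pi : R) != 0 by rewrite gt_eqF ?pi_gt0.
    have s0 : sin (halfangle N k) != 0 by rewrite gt_eqF // sin_halfangle.
    rewrite /cotratio; move: (sin _) (cos _) s0 => s c s0; rewrite /halfangle.
    move: N.*2.+1%:R k.+1%:R m0 k0 => m k' m0 k0.
    move: pi p0 => q q0; by field; rewrite s0 m0 k0 q0.
  rewrite pair_factor_half -mulrA; congr (4 * _); rewrite mulrDr mulr1; congr (_ + _).
  have e2 (s m q : R) : ((s * m * q) ^+ 2)%:C = (s ^+ 2)%:C * m%:C ^+ 2 * (q ^+ 2)%:C :> C.
    by rewrite -rmorphXn -!rmorphM /= !exprMn.
  by rewrite e e2 rmorph_nat; ring.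
rewrite subX_pair_factor (eq_bigr _ (fun k _ => E k)) big_split /= prod_4sin2.
by field.
Qed.

(** Replace the factors one at a time; the untouched ones are bounded by [M]. *)
Lemma cabs_prod_sub (A B : nat -> C) (M : nat -> R) N :
  (forall k, (k < N)%N -> [/\ cabs (A k) <= M k, cabs (B k) <= M k & 1 <= M k]) ->
  cabs (\prod_(k < N) A k - \prod_(k < N) B k)
    <= (\sum_(k < N) cabs (A k - B k)) * \prod_(k < N) M k.
Proof.
elim: N => [|N IH] H; first by rewrite !big_ord0 subrr cabs0 mul0r.
have [AM BM M1] := H N (ltnSn N).
have H' k : (k < N)%N -> [/\ cabs (A k) <= M k, cabs (B k) <= M k & 1 <= M k].
  by move=> kN; apply: H; exact: ltnW.
have P1 : 1 <= \prod_(k < N) M k.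
  elim/big_ind : _ => // [x y x1 y1|i _]; first by nra.
  by case: (H' i (ltn_ord i)).
have PB : cabs (\prod_(k < N) B k) <= \prod_(k < N) M k.
  rewrite (@big_morph _ _ (@cabs R) 1 *%R 1 *%R) ?cabs1 //; last exact: cabsM.
  apply: ler_prod => i _; rewrite cabs_ge0 /=.
  by case: (H' i (ltn_ord i)).
rewrite !big_ord_recr /=.
have -> : \prod_(i < N) A i * A N - \prod_(i < N) B i * B N =
  (\prod_(i < N) A i - \prod_(i < N) B i) * A N + \prod_(i < N) B i * (A N - B N) by ring.
apply: (le_trans (cabsD _ _)); rewrite !cabsM mulrDl.
set S := \sum_(_ < N) _ in IH *; set Q := \prod_(_ < N) M _ in IH P1 PB *.
apply: lerD.
  by rewrite mulrA; apply: ler_pM; rewrite ?cabs_ge0 //; exact: IH.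
have d0 := cabs_ge0 (A N - B N); move: (cabs (A N - B N)) d0 => d d0.
have k1 := ler_wpM2r d0 PB.
have k2 : Q * d * 1 <= Q * d * M N by rewrite ler_wpM2l // mulr_ge0 //; lra.
lra.
Qed.

(** Compare with the telescoping sum of [2 / k - 2 / (k + 1)]. *)
Lemma sum_inv_sqr N : \sum_(k < N) (k.+1%:R ^- 2 : R) <= 2.
Proof.
suff : \sum_(k < N) (k.+1%:R ^- 2 : R) <= 2 - 2 / N.+1%:R.
  by move=> /le_trans; apply; rewrite gerBl divr_ge0 ?ler0n.
elim: N => [|N IH]; first by rewrite big_ord0 divr1 subrr.
rewrite big_ord_recr /=; apply: (le_trans (lerD IH (lexx _))).
have m0 : 0 < N.+1%:R :> R by rewrite ltr0n.
have m1 : 1 <= N.+1%:R :> R by rewrite ler1n.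
rewrite -[N.+2%:R]natr1; set x := N.+1%:R in m0 m1 *.
rewrite -subr_ge0.
have -> : 2 - 2 / (x + 1) - (2 - 2 / x + x ^- 2) = (x - 1) / (x ^+ 2 * (x + 1)).
  by field; rewrite !gt_eqF //; lra.
by rewrite divr_ge0 ?subr_ge0 // mulr_ge0 ?sqr_ge0 //; lra.
Qed.

(** The partial products of Euler's product for [sinhc]. *)
Definition sinhprod (x : C) N : C :=
  x * \prod_(k < N) (1 + x ^+ 2 * ((pi * k.+1%:R) ^- 2 : R)%:C).

Lemma pi_sqr_ge2 : 2 <= pi ^+ 2 :> R.
Proof. have := pi_ge2 R; nra. Qed.

Lemma prod_expR_bound (x : R) N : 0 <= x ->
  \prod_(k < N) (1 + x * (pi * k.+1%:R) ^- 2) <= expR x.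
Proof.
move=> x0; apply: (@le_trans _ _ (\prod_(k < N) expR (x * (pi * k.+1%:R) ^- 2))).
  apply: ler_prod => k _; rewrite expR_ge1Dx andbT addr_ge0 // mulr_ge0 //.
  by rewrite invr_ge0 sqr_ge0.
rewrite -expR_sum ler_expR -mulr_sumr -[leRHS]mulr1 ler_wpM2l //.
under eq_bigr do rewrite exprMn invfM.
have p0 := pi_sqr_ge2.
rewrite -mulr_sumr ler_pdivrMl ?mulr1 ?(le_trans (sum_inv_sqr _)) //; lra.
Qed.

(** Euler's product for sinh: the finite product for [(1+x/m)^m - (1-x/m)^m]
   differs from the partial product factor by factor by at most |x|^2/m^2, so
   the sum of the N differences is O(1/N). *)
Lemma cabs_sinhprod_sub x N :
  cabs (((1 + x / N.*2.+1%:R) ^+ N.*2.+1 - (1 - x / N.*2.+1%:R) ^+ N.*2.+1) / 2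
     - sinhprod x N) <= cabs x ^+ 3 * expR (cabs x ^+ 2) * N.+1%:R^-1.
Proof.
have mx : N.*2.+1%:R * (x / N.*2.+1%:R) = x by rewrite mulrC divfK // pnatr_eq0.
rewrite subX_cot mx /sinhprod -mulrBr cabsM.
set A := fun k => 1 + x ^+ 2 * ((cotratio N k / (pi * k.+1%:R)) ^+ 2)%:C.
set B := fun k => 1 + x ^+ 2 * ((pi * k.+1%:R) ^- 2 : R)%:C.
set M := fun k => 1 + cabs x ^+ 2 * (pi * k.+1%:R) ^- 2.
have H k : (k < N)%N -> [/\ cabs (A k) <= M k, cabs (B k) <= M k & 1 <= M k].
  move=> /cotratio_bound /andP[_ c1]; rewrite /A /B /M.
  have g0 : 0 <= (pi * k.+1%:R) ^- 2 :> R by rewrite invr_ge0 sqr_ge0.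
  split.
  - apply: (le_trans (cabsD _ _)); rewrite cabs1 lerD2l cabsM cabsX cabs_real.
    rewrite ler_wpM2l ?sqr_ge0 // ger0_norm ?sqr_ge0 // expr_div_n.
    by rewrite -[leRHS]mul1r ler_wpM2r.
  - apply: (le_trans (cabsD _ _)); rewrite cabs1 lerD2l cabsM cabsX cabs_real.
    by rewrite ger0_norm.
  - by rewrite lerDl mulr_ge0 ?sqr_ge0.
have -> : cabs x ^+ 3 * expR (cabs x ^+ 2) * N.+1%:R^-1
  = cabs x * (expR (cabs x ^+ 2) * (cabs x ^+ 2 * N.+1%:R^-1)) by ring.
rewrite ler_wpM2l ?cabs_ge0 //.
apply: (le_trans (cabs_prod_sub H)).
have m0 : 0 < N.*2.+1%:R :> R by rewrite ltr0n.
rewrite mulrC; apply: ler_pM.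
- by apply: prodr_ge0 => k _; apply: addr_ge0 => //; apply: mulr_ge0; rewrite ?invr_ge0 sqr_ge0.
- by apply: sumr_ge0 => k _; exact: cabs_ge0.
- by apply: prod_expR_bound; exact: sqr_ge0.
have : forall k, (k < N)%N -> cabs (A k - B k) <= cabs x ^+ 2 * N.*2.+1%:R ^- 2.
  move=> k kN; have /andP[c1 c2] := cotratio_bound kN.
  have -> : A k - B k = x ^+ 2 * (((cotratio N k) ^+ 2 - 1) / (pi * k.+1%:R) ^+ 2)%:C.
    rewrite /A /B opprD addrACA subrr add0r -mulrBr -rmorphB /=; congr (_ * _%:C).
    by rewrite expr_div_n mulrBl mul1r.
  rewrite cabsM cabsX cabs_real ler_wpM2l ?sqr_ge0 // ler0_norm; last first.
    by rewrite pmulr_lle0 ?subr_le0 // invr_gt0 exprn_gt0 // mulr_gt0 ?pi_gt0 ?ltr0n.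
  rewrite -mulNr opprB ler_pdivrMr; last by rewrite exprn_gt0 // mulr_gt0 ?pi_gt0 ?ltr0n.
  have -> : N.*2.+1%:R ^- 2 * (pi * k.+1%:R) ^+ 2 = halfangle N k ^+ 2 :> R.
    by rewrite /halfangle expr_div_n mulrC.
  lra.
move=> H2; apply: (@le_trans _ _ (\sum_(k < N) cabs x ^+ 2 * N.*2.+1%:R ^- 2)).
  by apply: ler_sum => k _; exact: H2.
rewrite sumr_const card_ord -[X in X <= _]mulr_natr -mulrA ler_wpM2l ?sqr_ge0 //.
rewrite -[leRHS]mul1r ler_pdivlMr ?ltr0n // -mulrA ler_pdivrMl ?exprn_gt0 // mulr1.
by rewrite -natrM -natrX ler_nat; nia.
Qed.

Definition sinhc (x : C) : C := (cexp x - cexp (- x)) / 2.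

Lemma cvg_sinhprod x : sinhprod x N @[N --> \oo] --> (sinhc x : Cplx R).
Proof.
set K := 8 * expR (cabs x) * cabs x ^+ 2.
set K' := cabs x ^+ 3 * expR (cabs x ^+ 2).
apply: (cvg_cabs_le (g := fun n : nat => (K + K') * n.+1%:R^-1)); last first.
  exact: cvg_natinv_scale.
near=> N.
have xN : 2 * cabs x <= N.*2.+1%:R.
  near: N; exists (Num.bound (2 * cabs x)) => // n /= hn.
  have := archi_boundP (mulr_ge0 (ler0n R 2) (cabs_ge0 x)).
  move=> /ltW /le_trans; apply; rewrite ler_nat; apply: (leq_trans hn); rewrite -addnn; lia.
have h1 := cabs_pow_sub_cexp xN.
have h2 : cabs ((1 - x / N.*2.+1%:R) ^+ N.*2.+1 - cexp (- x)) <= K * N.*2.+1%:R^-1.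
  by rewrite -mulNr /K -(cabsN x); apply: cabs_pow_sub_cexp; rewrite cabsN.
have h3 := cabs_sinhprod_sub x N.
set P := (1 + _) ^+ _ in h1 h3; set Q := (1 - _) ^+ _ in h2 h3.
have -> : sinhprod x N - sinhc x = - ((P - Q) / 2 - sinhprod x N)
   + ((P - cexp x) - (Q - cexp (- x))) / 2 by rewrite /sinhc; field.
apply: (le_trans (cabsD _ _)); rewrite cabsN [leRHS]mulrDl [leRHS]addrC; apply: lerD => //.
have c2 : cabs 2^-1 = 2^-1 :> R.
  rewrite cabsV (_ : (2 : C) = (2 : R)%:C); last by rewrite rmorph_nat.
  by rewrite cabs_real ger0_norm.
rewrite cabsM c2 ler_pdivrMr //.
apply: (le_trans (cabsD _ _)); rewrite cabsN; apply: (le_trans (lerD h1 h2)).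
rewrite -/K -mulr2n -[leLHS]mulr_natr ler_wpM2r //.
rewrite ler_wpM2l //; last by rewrite lef_pV2 ?posrE ?ltr0n // ler_nat -addnn; lia.
by rewrite /K; apply: mulr_ge0; rewrite ?sqr_ge0 // mulr_ge0 ?expR_ge0.
Unshelve. all: by end_near. Qed.

End EulerProduct.

(** * The Blaschke product as a Frostman shift of a singular inner function *)

Section CayleyTransform.
Variable R : realType.
Implicit Types (v w z : R[i]).

Lemma unit_diskP v : unit_disk v <-> cabs v < 1.
Proof.
rewrite /unit_disk /= normC_cabs.
by rewrite (_ : 1 = (1 : R)%:C) // ltcR.
Qed.

Lemma unit_disk_neq1 v : cabs v < 1 -> v - 1 != 0.
Proof.
by move=> v1; apply/eqP => /subr0_eq e; rewrite e cabs1 ltxx in v1.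
Qed.

(** The Cayley transform maps the disk to the left half-plane and the circle to
   the imaginary axis; at 1 the total division gives it the value 0. *)
Lemma Re_cayley v : v != 1 ->
  Re (cayley v) * cabs (v - 1) ^+ 2 = cabs v ^+ 2 - 1.
Proof.
move=> v1; have d0 : v - 1 != 0 by rewrite subr_eq0.
have -> : Re (cayley v) * cabs (v - 1) ^+ 2 = Re (cayley v * (cabs (v - 1) ^+ 2)%:C).
  by rewrite Re_mulc /= mulr0 subr0.
rewrite -mulJc /cayley mulrA mulfVK // sqr_cabs Re_mulc Re_conjc Im_conjc.
by rewrite !Re_addc !Im_addc !Re_oppc !Im_oppc /=; ring.
Qed.

Lemma Re_cayley_lt0 v : cabs v < 1 -> Re (cayley v) < 0.
Proof.
move=> v1; have d0 := unit_disk_neq1 v1.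
have := Re_cayley (v := v); rewrite -subr_eq0 => /(_ d0) e.
have h : 0 < cabs (v - 1) ^+ 2 by rewrite exprn_gt0 // cabs_gt0.
by rewrite -(pmulr_llt0 _ h) e subr_lt0 expr_lt1 ?cabs_ge0.
Qed.

Lemma Re_cayley_circle z : cabs z = 1 -> Re (cayley z) = 0.
Proof.
have [->|n1] := eqVneq z 1; first by rewrite /cayley subrr invr0 mulr0.
move=> z1; have := Re_cayley n1; rewrite z1 expr1n subrr => /eqP.
by rewrite mulf_eq0 expf_eq0 /= cabs_eq0 subr_eq0 (negbTE n1) orbF => /eqP.
Qed.

End CayleyTransform.

Section Blaschke.
Variables (R : realType) (p : nat).
Hypothesis p_gt1 : (1 < p)%N.
Implicit Types (v w z : R[i]).
Local Notation C := R[i].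
Local Notation L := (ln (p%:R : R)).

Lemma lnp_gt0 : 0 < L.
Proof. by rewrite ln_gt0 // ltr1n. Qed.

Lemma cpowE z : cpow p z = cexp (z * L%:C).
Proof. by []. Qed.

(** The singular inner function whose Frostman shift is the Blaschke product. *)
Definition singinner v : C := cpow p (cayley v).

(** The number [p ^ (-1/2)], the value that the singular inner function takes at
   the zeros of the Blaschke product. *)
Definition invsqrtp : R := expR (- (L / 2)).

Definition frostman v : C :=
  (invsqrtp%:C - singinner v) / (1 - invsqrtp%:C * singinner v).

Lemma invsqrtp_bound : 0 < invsqrtp < 1.
Proof. by rewrite expR_gt0 /= expR_lt1 oppr_lt0 divr_gt0 // lnp_gt0. Qed.

Lemma cexp_invsqrtp : invsqrtp%:C = cexp (- (L / 2)%:C).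
Proof. by rewrite cexpE /= oppr0 cos0 sin0 mulr1 mulr0. Qed.

Lemma cabs_singinner v : cabs (singinner v) = expR (Re (cayley v) * L).
Proof. by rewrite cabs_cexp Re_mulc /= mulr0 subr0. Qed.

Lemma cabs_singinner_le1 v : Re (cayley v) <= 0 -> cabs (singinner v) <= 1.
Proof.
by move=> h; rewrite cabs_singinner expR_le1 pmulr_lle0 ?lnp_gt0.
Qed.

Lemma singinner_neq0 v : singinner v != 0.
Proof. exact: cexp_neq0. Qed.

Lemma frostman_den_neq0 v : Re (cayley v) <= 0 -> 1 - invsqrtp%:C * singinner v != 0.
Proof.
move=> /cabs_singinner_le1 h; rewrite subr_eq0; apply/eqP => e.
have /andP[a0 a1] := invsqrtp_bound.
have := congr1 (@cabs R) e; rewrite cabs1 cabsM cabs_real gtr0_norm // => e1.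
have : invsqrtp * cabs (singinner v) <= invsqrtp by rewrite ler_piMr // ltW.
by rewrite -e1 leNgt a1.
Qed.

Lemma xseqE n : xseq R p n =
  ((4 * pi * n%:~R : R)%:C - 'i%C * L%:C) / ((4 * pi * n%:~R : R)%:C + 3 * 'i%C * L%:C).
Proof. by []. Qed.

Lemma xden_neq0 (t l : R) (c : R) : c != 0 -> l != 0 -> t%:C + c%:C * 'i%C * l%:C != 0 :> C.
Proof.
move=> c0 l0; rewrite eq_complex /= negb_and; apply/orP; right.
by rewrite !(mul0r, mulr0, add0r, addr0, mulr1, subr0, sub0r) mulf_neq0.
Qed.

Lemma xseq_in_disk n : cabs (xseq R p n) < 1.
Proof.
have l0 := lnp_gt0; rewrite xseqE.
set t : R := 4 * pi * n%:~R.
have three : (3 : C) = (3 : R)%:C by rewrite rmorph_nat.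
have d0 : t%:C + 3 * 'i%C * L%:C != 0 :> C.
  by rewrite three xden_neq0 ?pnatr_eq0 ?gt_eqF.
rewrite cabsM cabsV ltr_pdivrMr ?cabs_gt0 // mul1r.
rewrite -(ltr_pXn2r (_ : 0 < 2)%N) ?nnegrE ?cabs_ge0 // !sqr_cabs three.
rewrite !(Re_addc, Im_addc, Re_oppc, Im_oppc, Re_mulc, Im_mulc) /=; nra.
Qed.

Lemma xseqN n : xseq R p (- n) = (xseq R p n)^*.
Proof.
rewrite /xseq rmorphN mulrN; set t : R := 4 * pi * n%:~R.
rewrite rmorphM fmorphV /=.
have three : (3 : C) = (3 : R)%:C by rewrite rmorph_nat.
have -> : ((- t)%:C - 'i%C * L%:C) = - (t%:C - 'i%C * L%:C)^*.
  by rewrite ?three; apply: complex_ext; rewrite !(Re_addc, Im_addc, Re_oppc, Im_oppc, Re_mulc, Im_mulc, Re_conjc, Im_conjc) /=; ring.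
have -> : ((- t)%:C + 3 * 'i%C * L%:C) = - (t%:C + 3 * 'i%C * L%:C)^*.
  by rewrite ?three; apply: complex_ext; rewrite !(Re_addc, Im_addc, Re_oppc, Im_oppc, Re_mulc, Im_mulc, Re_conjc, Im_conjc) /=; ring.
by rewrite invrN mulrNN.
Qed.

(** The unimodular normalizations of two conjugate factors cancel. *)
Lemma blaschke_factor_pair (al v : C) : al != 0 ->
  blaschke_factor al v * blaschke_factor al^* v =
  ((al - v) * (al^* - v)) / ((1 - al^* * v) * (1 - al * v)).
Proof.
move=> al0; have alJ : al^* != 0 by rewrite conjC_eq0.
rewrite /blaschke_factor conjCK norm_conjC.
have n2 := normCK al.
transitivity (((al - v) * (al^* - v)) * ((1 - al^* * v)^-1 * (1 - al * v)^-1) *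
   (`|al| ^+ 2 / (al * al^*))); first by rewrite invfM; ring.
by rewrite n2 divff ?mulf_neq0 // mulr1 invfM.
Qed.

(** In the half-plane variable [w = cayley v], the Blaschke factors of a pair
   of conjugate zeros become the factors of Euler's product for sinh at
   [L (w + 1/2) / 2] over those at [L (w - 1/2) / 2]. *)
Definition argnum v : C := (cayley v + 2^-1) * (L / 2)%:C.
Definition argden v : C := (cayley v - 2^-1) * (L / 2)%:C.

Lemma one_sub_neq0 (al v : C) : cabs al < 1 -> cabs v < 1 -> 1 - al * v != 0.
Proof.
move=> a1 v1; rewrite subr_eq0; apply/eqP => /(congr1 (@cabs R)).
rewrite cabs1 cabsM => e; have := cabs_ge0 al; have := cabs_ge0 v; nra.
Qed.

Lemma blaschke_pair_sinh v k : cabs v < 1 ->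
  blaschke_factor (xseq R p k.+1%:Z) v * blaschke_factor (xseq R p (- k.+1%:Z)) v =
  (1 + argnum v ^+ 2 * ((pi * k.+1%:R) ^- 2 : R)%:C)
  / (1 + argden v ^+ 2 * ((pi * k.+1%:R) ^- 2 : R)%:C).
Proof.
move=> v1; have l0 := lnp_gt0.
have three : (3 : C) = (3 : R)%:C by rewrite rmorph_nat.
have lC : L%:C != 0 :> C by apply/eqP => /(@complexI R) e; rewrite e ltxx in l0.
have v10 := unit_disk_neq1 v1.
have xd := xseq_in_disk k.+1%:Z.
have xJ := xseqN k.+1%:Z.
have e1 := one_sub_neq0 xd v1.
have e2 : 1 - (xseq R p k.+1%:Z)^* * v != 0 by apply: one_sub_neq0 => //; rewrite cabsJ.
have x0 : xseq R p k.+1%:Z != 0.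
  rewrite xseqE mulf_neq0 ?invr_eq0 //; last by rewrite three xden_neq0 ?pnatr_eq0 ?gt_eqF.
  have := @xden_neq0 (4 * pi * k.+1%:~R) L (-1); rewrite rmorphN rmorph1 mulN1r mulNr.
  by apply; rewrite ?oppr_eq0 ?oner_neq0 // gt_eqF.
rewrite xJ blaschke_factor_pair // -xJ; rewrite -xJ in e2.
have t0 : (4 * pi * k.+1%:R : R) != 0 by rewrite !mulf_neq0 ?pnatr_eq0 ?gt_eqF ?pi_gt0.
set t := (4 * pi * k.+1%:R : R)%:C; have tC : t != 0 by apply/eqP => /(@complexI R) e; rewrite e eqxx in t0.
set m := 'i%C * L%:C.
have m2 : L%:C ^+ 2 = - m ^+ 2 by rewrite /m exprMn sqr_i mulN1r opprK.
have kE : ((pi * k.+1%:R) ^- 2 : R)%:C = 16 / t ^+ 2.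
  have -> : (pi * k.+1%:R) ^- 2 = 16 / (4 * pi * k.+1%:R) ^+ 2 :> R.
    move: pi k.+1%:R t0 => q k1 t0; move: (t0); rewrite !mulf_eq0 !negb_or.
    by move=> /andP[/andP[_ q0] k0]; field; rewrite q0 k0.
  by rewrite rmorphM fmorphV rmorphXn rmorph_nat.
have d1 : t + 3 * m != 0 by rewrite /m mulrA three xden_neq0 ?pnatr_eq0 // gt_eqF.
have d2 : - t + 3 * m != 0.
  by rewrite /m /t -rmorphN mulrA three xden_neq0 ?pnatr_eq0 // gt_eqF.
have al : xseq R p k.+1%:Z = (t - m) / (t + 3 * m) by rewrite xseqE /m mulrA.
have al' : xseq R p (- k.+1%:Z) = (- t - m) / (- t + 3 * m).
  have tN : 4 * pi * (- k.+1%:Z)%:~R = - (4 * pi * k.+1%:R) :> R by rewrite mulrNz mulrN.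
  by rewrite xseqE tN /m /t -rmorphN mulrA.
rewrite al in e1 *; rewrite al' in e2 *.
clearbody t m.
set P1 := t - m - t * v - 3 * m * v; set P2 := - t - m + t * v - 3 * m * v.
set Q1 := t + 3 * m - t * v + m * v; set Q2 := - t + 3 * m + t * v + m * v.
have eP1 : (t - m) / (t + 3 * m) - v = P1 / (t + 3 * m) by rewrite /P1; field.
have eP2 : (- t - m) / (- t + 3 * m) - v = P2 / (- t + 3 * m) by rewrite /P2; field.
have eQ1 : 1 - (t - m) / (t + 3 * m) * v = Q1 / (t + 3 * m) by rewrite /Q1; field.
have eQ2 : 1 - (- t - m) / (- t + 3 * m) * v = Q2 / (- t + 3 * m) by rewrite /Q2; field.
rewrite eQ1 in e1 *; rewrite eQ2 in e2 *; rewrite eP1 eP2.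
have q1 : Q1 != 0 by apply: contraNneq e1 => ->; rewrite mul0r.
have q2 : Q2 != 0 by apply: contraNneq e2 => ->; rewrite mul0r.
have half : (L / 2)%:C = L%:C / 2 by rewrite rmorphM fmorphV rmorph_nat.
have D0 : - (t * (v - 1)) ^+ 2 != 0 by rewrite oppr_eq0 expf_neq0 // mulf_neq0.
have -> : 1 + argnum v ^+ 2 * ((pi * k.+1%:R) ^- 2 : R)%:C = P1 * P2 / - (t * (v - 1)) ^+ 2.
  rewrite kE /argnum /cayley half exprMn expr_div_n m2 /P1 /P2; field.
  by rewrite v10 tC.
have -> : 1 + argden v ^+ 2 * ((pi * k.+1%:R) ^- 2 : R)%:C = Q1 * Q2 / - (t * (v - 1)) ^+ 2.
  rewrite kE /argden /cayley half exprMn expr_div_n m2 /Q1 /Q2; field.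
  by rewrite v10 tC.
move: (- (t * _) ^+ 2) D0 => D D0; clearbody P1 P2 Q1 Q2.
by field; rewrite q1 q2 D0 d1 d2.
Qed.

Lemma blaschke_mid_sinh v : cabs v < 1 ->
  blaschke_factor (xseq R p 0) v = argnum v / argden v.
Proof.
move=> v1; have l0 := lnp_gt0.
have lC : L%:C != 0 :> C by apply/eqP => /(@complexI R) e; rewrite e ltxx in l0.
have v10 := unit_disk_neq1 v1.
have m0 : 'i%C * L%:C != 0 :> C.
  by rewrite mulf_neq0 // eq_complex /= oner_eq0 andbF.
have x0 : xseq R p 0 = - 3^-1.
  by rewrite xseqE mulr0 sub0r add0r -mulrA; move: (_ * _) m0 => m m0; field.
have three : (3 : C) = (3 : R)%:C by rewrite rmorph_nat.
have d : 3 + v != 0.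
  apply/eqP => /eqP; rewrite addr_eq0 => /eqP e; move: v1.
  rewrite -cabsN -e three cabs_real ger0_norm //; lra.
have d' : cayley v - 2^-1 = (v + 3) / (2 * (v - 1)) by rewrite /cayley; field.
have hl : (L / 2)%:C != 0 :> C.
  by apply/eqP => /(@complexI R) e; move: l0; lra.
have nx : `|- 3^-1 : C| = 3^-1.
  by rewrite normrN normfV normr_nat.
have xJ : (- 3^-1 : C)^* = - 3^-1 by rewrite rmorphN fmorphV rmorph_nat.
rewrite /argnum /argden /blaschke_factor x0 xJ nx d' /cayley.
move: (_%:C) hl => h h0; field.
by rewrite v10 h0 addrC d.
Qed.

(** A symmetric product over the integers is grouped into pairs [n], [- n], which
   is how the convergence of the partial Blaschke products becomes that of
   Euler's products. *)
Lemma prod_int_pairs (f : int -> C) N : \prod_(k < N.*2.+1) f (k%:Z - N%:Z)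
  = f 0 * \prod_(k < N) (f k.+1%:Z * f (- k.+1%:Z)).
Proof.
elim: N => [|N IH]; first by rewrite big_ord_recl !big_ord0.
rewrite [in RHS]big_ord_recr /= mulrA -IH doubleS [in LHS]big_ord_recl [in LHS]big_ord_recr /=.
rewrite (eq_bigr (fun k : 'I_(N.*2.+1) => f (k%:Z - N%:Z))); last first.
  by move=> i _; congr f; rewrite /bump /=; lia.
rewrite mulrCA; congr (_ * _); rewrite mulrC.
by congr (f _ * f _); rewrite /bump /=; lia.
Qed.

Lemma blaschke_partial_sinh v N : cabs v < 1 ->
  blaschke_partial (xseq R p) v N = sinhprod (argnum v) N / sinhprod (argden v) N.
Proof.
move=> v1; rewrite /blaschke_partial.
rewrite (prod_int_pairs (fun n => blaschke_factor (xseq R p n) v)).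
rewrite (blaschke_mid_sinh v1) (eq_bigr _ (fun (k : 'I_N) _ => blaschke_pair_sinh k v1)).
by rewrite big_split /= prodfV /sinhprod mulf_div.
Qed.

Lemma sinhc_neq0 z : Re z < 0 -> sinhc z != 0.
Proof.
move=> z0; rewrite mulf_neq0 ?invr_eq0 // subr_eq0; apply/eqP => /(congr1 (@cabs R)).
by rewrite !cabs_cexp => /expR_inj; rewrite Re_oppc; lra.
Qed.

Lemma argden_Re v : Re (cayley v) <= 0 -> Re (argden v) < 0.
Proof.
move=> v0; have l0 := lnp_gt0.
rewrite /argden Re_mulc /= mulr0 subr0 Re_addc Re_oppc.
rewrite (_ : 2^-1 = (2^-1 : R)%:C) /=; last by rewrite fmorphV rmorph_nat.
by rewrite pmulr_llt0 ?divr_gt0 //; lra.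
Qed.

(** With [y] and [y'] the two arguments, [exp (y + y')] is the singular inner
   function and [exp (y' - y)] is [p ^ (-1/2)]. *)
Lemma sinhc_ratio v : Re (cayley v) <= 0 ->
  sinhc (argnum v) / sinhc (argden v) = frostman v.
Proof.
move=> v0; have l0 := lnp_gt0.
have half : (L / 2)%:C = L%:C / 2 by rewrite rmorphM fmorphV rmorph_nat.
have eS : singinner v = cexp (argnum v) * cexp (argden v).
  by rewrite /singinner cpowE -cexpD; congr cexp; rewrite /argnum /argden half; field.
have ea : invsqrtp%:C = cexp (argden v) / cexp (argnum v).
  rewrite cexp_invsqrtp -cexpN -cexpD; congr cexp.
  by rewrite /argnum /argden half; field.
have dD : sinhc (argden v) != 0.
  by apply: sinhc_neq0; exact: argden_Re.
move: dD; rewrite /frostman eS ea /sinhc !cexpN.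
have := cexp_neq0 (argnum v); have := cexp_neq0 (argden v).
move: (cexp (argden v)) (cexp (argnum v)) => e f e0 f0.
have -> : (e - e^-1) / 2 = (e * e - 1) / (2 * e) by field.
move=> h; have {}h : e * e - 1 != 0 by apply: contraNneq h => ->; rewrite mul0r.
have -> : 1 - e / f * (f * e) = - (e * e - 1) by field.
move: (e * e - 1) (erefl (e * e - 1)) h => g gE g0; field.
by rewrite e0 f0 g0.
Qed.

(** The Blaschke product is a Frostman shift of the singular inner function:
   both are quotients of the same two hyperbolic sines. *)
Lemma cvg_blaschke v : cabs v < 1 ->
  blaschke_partial (xseq R p) v N @[N --> \oo] --> (frostman v : Cplx R).
Proof.
move=> v1; have v0 := Re_cayley_lt0 v1; rewrite -sinhc_ratio ?ltW //.
under eq_cvg do rewrite blaschke_partial_sinh //.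
apply: (@cvgM (Cplx R) _ _ _ (fun N => sinhprod (argnum v) N : Cplx R)); first exact: cvg_sinhprod.
apply: (@cvgV (Cplx R)); last exact: cvg_sinhprod.
by apply: sinhc_neq0; apply: argden_Re; exact: ltW.
Qed.

Lemma blaschkeE v : cabs v < 1 -> blaschke (xseq R p) v = frostman v.
Proof.
move=> v1; rewrite /blaschke; apply: (@cvg_lim (Cplx R)); last exact: cvg_blaschke.
exact: norm_hausdorff.
Qed.

End Blaschke.

(** * Boundary values and the factorization of kappa *)

Section BoundaryValues.
Variable R : realType.
Implicit Types (v w z : R[i]).
Local Notation C := R[i].

Lemma near0_cabs_le (e : R) : 0 < e ->
  \forall h \near (0 : Cplx R)^', cabs (h : R[i]) <= e.
Proof.
move=> e0; apply: (@cvg_within (Cplx R)).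
apply/nbhs_ballP; exists e%:C => /=; first by rewrite ltcR.
move=> h; rewrite -ball_normE /= sub0r normrN normC_cabs ltcR; exact: ltW.
Qed.

Lemma derivable_cexp z : derivable (@cexp R : (Cplx R)^o -> (Cplx R)^o) z 1.
Proof.
apply/cvg_ex; exists (cexp z).
apply: (@cvg_cabs_le R (Cplx R) _ _ _ (fun h => expR (Re z) * 8 * cabs (h : R[i]))).
  near=> h.
  have h0 : (h : C) != 0 by near: h; exact: nbhs_dnbhs_neq.
  have h2 : cabs (h : C) <= 1 / 2 by near: h; apply: near0_cabs_le; lra.
  rewrite /= -[_ *: _]/(_ * _) -[h%:A]/(h * 1) mulr1 [h + z]addrC cexpD.
  have -> : h^-1 * (cexp z * cexp h - cexp z) - cexp z = cexp z * ((cexp h - 1 - h) / h).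
    by field.
  rewrite cabsM cabs_cexp -mulrA ler_wpM2l ?expR_ge0 // cabsM cabsV.
  rewrite ler_pdivrMr ?cabs_gt0 // -mulrA -expr2; exact: cabs_cexp_sub1.
rewrite -[X in _ --> X](mulr0 (expR (Re z) * 8)); apply: cvgM; first exact: cvg_cst.
apply/cvgrPdist_le => e e0; near=> h.
rewrite sub0r normrN ger0_norm ?cabs_ge0 //; near: h; exact: near0_cabs_le.
Unshelve. all: by end_near. Qed.

Lemma derivable_cayley v : v != 1 -> derivable (@cayley R : (Cplx R)^o -> (Cplx R)^o) v 1.
Proof.
move=> v1; apply: (@derivableM (Cplx R) (Cplx R)^o).
  by apply: derivableD => //; exact: derivable_cst.
by apply: (@derivableV (Cplx R) (Cplx R)^o); rewrite ?subr_eq0 //; apply: derivableB.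
Qed.

Lemma derivable_singinner p v : v != 1 ->
  derivable (@singinner R p : (Cplx R)^o -> (Cplx R)^o) v 1.
Proof.
move=> v1; set f := fun v : C => cayley v * (ln p%:R)%:C.
apply/derivable1_diffP.
apply: (@differentiable_comp (Cplx R) (Cplx R)^o (Cplx R)^o (Cplx R)^o f (@cexp R)).
  apply/derivable1_diffP; apply: (@derivableM (Cplx R) (Cplx R)^o) => //.
  exact: derivable_cayley.
apply/derivable1_diffP; exact: derivable_cexp.
Qed.

Lemma cvg_singinner p v : v != 1 ->
  singinner p u @[u --> (v : Cplx R)] --> (singinner p v : Cplx R).
Proof.
by move=> v1; have /derivable1_diffP := derivable_singinner (p := p) v1; exact: differentiable_continuous.
Qed.

Lemma cvg_radius z : (r%:C * z : Cplx R) @[r --> (1 : R)^'-] --> (z : Cplx R).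
Proof.
apply: (@cvg_cabs_le R R _ _ _ (fun r => `|r - 1| * cabs z)).
  near=> r; rewrite -[X in _ - X]mul1r -mulrBl cabsM.
  by rewrite (_ : r%:C - 1 = (r - 1)%:C) ?cabs_real // rmorphB.
rewrite -[X in _ --> X](mul0r (cabs z)); apply: cvgM; last exact: cvg_cst.
rewrite -(normr0 R) -(subrr (1 : R)); apply: cvg_norm; apply: cvgB; last exact: cvg_cst.
exact: cvg_at_left_filter.
Unshelve. all: by end_near. Qed.

Lemma cvg_radial_singinner p z : z != 1 ->
  (singinner p (r%:C * z) : Cplx R) @[r --> (1 : R)^'-] --> (singinner p z : Cplx R).
Proof.
move=> z1; apply: (@cvg_comp R (Cplx R) (Cplx R) (fun r => r%:C * z) (singinner p) _ _ _
  (cvg_radius (z := z))); exact: cvg_singinner.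
Qed.


Lemma cabs_circle (t : R) : cabs (circle t) = 1.
Proof. by rewrite cabsE /= cos2Dsin2 sqrtr1. Qed.

Lemma circle_neq1 (t : R) : 0 < t < 1 -> circle t != 1.
Proof.
move=> /andP[t0 t1]; apply/eqP => -[c1 _].
suff : cos (2 * pi * t) < 1 :> R by rewrite c1 ltxx.
have p0 := pi_gt0 R; apply: cos_lt1; rewrite !mulr_gt0 //=; nra.
Qed.

Local Notation mu := (@lebesgue_measure R).

Lemma ae_neq (x : R) : {ae mu, forall t : R, t <> x}.
Proof.
exists [set x]; split => //; first exact: lebesgue_measure_set1.
by move=> t /= /contrapT.
Qed.

Lemma circle_ae_neq1 (P : C -> Prop) :
  (forall z, cabs z = 1 -> z != 1 -> P z) -> circle_ae P.
Proof.
move=> H; have := ae_neq 0; have := ae_neq 1.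
apply: filterS2; first exact: (ae_filter_ringOfSetsType mu).
move=> t t1 t0; rewrite in_itv /= => /andP[h0 h1].
apply: H; first exact: cabs_circle.
apply: circle_neq1; rewrite !lt_neqAle h0 h1 !andbT; apply/andP; split; apply/eqP => //.
exact/nesym.
Qed.

(** A full turn is the only way in which the complex exponential fails to be
   injective on the imaginary axis. *)
Lemma cexp_eq1 z : cexp z = 1 -> exists n : int, z = 0 +i* (2 * pi * n%:~R).
Proof.
move=> z1; have re0 : Re z = 0.
  by apply: expR_inj; rewrite -cabs_cexp z1 cabs1 expR0.
have p0 : 0 < 2 * pi :> R by rewrite mulr_gt0 ?pi_gt0.
set n := Num.floor (Im z / (2 * pi)); exists n.
have /andP[f0 f1] := real_floor_itv (num_real (Im z / (2 * pi))).
rewrite -/n in f0 f1.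
set s := Im z - 2 * pi * n%:~R.
have s0 : 0 <= s by rewrite subr_ge0 mulrC -ler_pdivlMr.
have s1 : s < 2 * pi.
  move: f1; rewrite ltr_pdivrMr // intrD /s; move: (2 * pi) => q; lra.
have cs : cos s = 1.
  have T k : 2 * pi * k%:R = (pi *+ 2) *+ k :> R by rewrite mulr_natr mulr_natl.
  have -> : cos s = cos (Im z).
    rewrite /s; case: n {f0 f1 s s0 s1} => m.
      by rewrite T -(periodicn (@cosD2pi R) m) subrK.
    by rewrite NegzE mulrNz mulrN opprK T periodicn //; exact: cosD2pi.
  by move: z1; rewrite cexpE re0 expR0 mul1r => -[].
have [s2|s2] := leP s 0.
  have sE : s = 0 by apply/le_anti; rewrite s2 s0.
  apply: complex_ext => //=; move: sE; rewrite /s; lra.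
suff : cos s < 1 by rewrite cs ltxx.
by apply: cos_lt1; rewrite s2 s1.
Qed.

End BoundaryValues.

Section InnerFunction.
Variables (R : realType) (p : nat).
Hypothesis p_gt1 : (1 < p)%N.
Implicit Types (v w z : R[i]).
Local Notation C := R[i].
Local Notation L := (ln (p%:R : R)).
Local Notation S := (@singinner R p).
Local Notation a := ((invsqrtp R p)%:C).

Lemma cabs_singinner_circle z : cabs z = 1 -> cabs (S z) = 1.
Proof.
by move=> z1; rewrite cabs_singinner (Re_cayley_circle z1) mul0r expR0.
Qed.

Lemma singinner_inner : inner_function (fun v : C => - S v).
Proof.
split; first split.
- move=> v /unit_diskP v1; have vn1 : v != 1 by rewrite -subr_eq0 unit_disk_neq1.
  exact: (@derivableN (Cplx R) (Cplx R)^o (Cplx R)^o S v 1 (derivable_singinner vn1)).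
- exists 1 => v /unit_diskP v1; rewrite normrN normC_cabs lecR.
  by apply: cabs_singinner_le1 => //; apply/ltW/Re_cayley_lt0.
- apply: circle_ae_neq1 => z z1 n1; exists (- S z).
    by apply: (@cvgN (Cplx R) (Cplx R)); exact: cvg_radial_singinner.
  by rewrite normrN normC_cabs cabs_singinner_circle.
Qed.

(** In the disk the product is the Frostman shift, which is continuous up to the
   circle except at 1. *)
Lemma boundary_blaschke z : cabs z = 1 -> z != 1 ->
  boundary (blaschke (xseq R p)) z = frostman p z.
Proof.
move=> z1 n1; rewrite /boundary; apply: (@cvg_lim (Cplx R)); first exact: norm_hausdorff.
have h : (frostman p (r%:C * z) : Cplx R) @[r --> (1 : R)^'-] --> (frostman p z : Cplx R).
  have cS := cvg_radial_singinner (p := p) n1.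
  have ca (c : C) : (c : Cplx R) @[r --> (1 : R)^'-] --> (c : Cplx R) by exact: cvg_cst.
  have FF : Filter ((1 : R)^'-) by typeclasses eauto.
  have num := @cvgB (Cplx R) (Cplx R) R _ FF _ _ _ _ (ca a) cS.
  have aS := @cvgM (Cplx R) R _ FF _ _ _ _ (ca a) cS.
  have den := @cvgB (Cplx R) (Cplx R) R _ FF _ _ _ _ (ca 1) aS.
  have d0 : 1 - a * S z != 0 by apply: frostman_den_neq0; rewrite ?(Re_cayley_circle z1).
  exact: (@cvgM (Cplx R) R _ FF _ _ _ _ num (@cvgV (Cplx R) R _ FF _ _ d0 den)).
apply: cvg_trans h; apply: near_eq_cvg; near=> r.
rewrite /radial blaschkeE // cabsM z1 mulr1 cabs_real gtr0_norm; near: r.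
  exact: nbhs_left_lt.
exact: nbhs_left_gt.
Unshelve. all: by end_near. Qed.

(** [kappa] is a rational function of the singular inner function [S]: both its
   numerator and its denominator are affine in [S] and [1 / S]. *)
Lemma kappaE v : kappa p v = (1 - a * S v) / (1 - a / S v).
Proof.
have half : 2^-1 * L%:C = (L / 2)%:C by rewrite rmorphM fmorphV rmorph_nat mulrC.
rewrite /kappa /rho /singinner cexp_invsqrtp !cpowE -cexpN -!cexpD.
congr ((1 - cexp _) / (1 - cexp _)); rewrite -half; first by field.
by ring.
Qed.

(** Away from the poles of [kappa], which are the points where the singular inner
   function equals [p ^ (-1/2)], the identity is algebra. *)
Lemma kappa_blaschke v : cabs v < 1 -> (forall n, v <> xseq R p n) ->
  kappa p v * blaschke (xseq R p) v = - S v.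
Proof.
move=> v1 vx; rewrite blaschkeE // kappaE /frostman.
have s0 := singinner_neq0 p v.
have d := frostman_den_neq0 p_gt1 (ltW (Re_cayley_lt0 v1)).
have sa : S v - a != 0.
  apply/eqP => /subr0_eq sa.
  have : cexp ((cayley v + 2^-1) * L%:C) = 1.
    have half : 2^-1 * L%:C = (L / 2)%:C by rewrite rmorphM fmorphV rmorph_nat mulrC.
    rewrite mulrDl cexpD half -[cexp (_%:C)]invrK -cexpN -cexp_invsqrtp.
    by rewrite -cpowE -/(singinner p v) sa divff // -sa.
  move=> /cexp_eq1[n nE]; apply: (vx n).
  have l0 := lnp_gt0 R p_gt1.
  have lC : L%:C != 0 :> C by apply/eqP => /(@complexI R) e; rewrite e ltxx in l0.
  have v10 := unit_disk_neq1 v1.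
  have three : (3 : C) = (3 : R)%:C by rewrite rmorph_nat.
  have d0 : (4 * pi * n%:~R : R)%:C + 3 * 'i%C * L%:C != 0.
    by rewrite three xden_neq0 ?pnatr_eq0 ?gt_eqF.
  rewrite xseqE; apply: (@mulIf _ _ d0); rewrite mulfVK //.
  have tE : (4 * pi * n%:~R : R)%:C = - (2 * 'i%C) * ((cayley v + 2^-1) * L%:C).
    rewrite nE; apply: complex_ext; rewrite !(Re_mulc, Im_mulc, Re_oppc, Im_oppc) /=; ring.
  rewrite tE /cayley; move: ('i%C) => j; field.
  by rewrite v10.
have -> : 1 - a / S v = (S v - a) / S v by field.
by field; rewrite s0 sa d.
Qed.

(** On the circle [1 / S = conj S], so numerator and denominator of the Frostman
   shift have the same modulus. *)
Lemma cabs_frostman_circle z : cabs z = 1 -> cabs (frostman p z) = 1.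
Proof.
move=> z1; have s1 := cabs_singinner_circle z1.
have d := @frostman_den_neq0 R p p_gt1 z.
rewrite /frostman cabsM cabsV.
have -> : a - S z = - S z * (1 - a * S z)^*.
  rewrite rmorphB rmorph1 rmorphM /=.
  have := mulJc (S z); rewrite s1 expr1n => e.
  have -> : a^* = a by exact: conjc_real.
  rewrite mulrBr mulr1 mulrCA mulNr e; rewrite (_ : 1%:C = 1) //; ring.
rewrite cabsM cabsN s1 mul1r cabsJ divff // cabs_eq0; apply: d.
by rewrite (Re_cayley_circle z1).
Qed.

(** On the circle both the Blaschke product and the singular inner function are
   unimodular, so the factorization reads [kappa = - S / B = - S * conj B]. *)
Lemma kappa_circle z : cabs z = 1 ->
  kappa p z * frostman p z = - S z.
Proof.
move=> z1; have s0 := singinner_neq0 p z.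
have h : Re (cayley z) <= 0 by rewrite (Re_cayley_circle z1).
have d := frostman_den_neq0 p_gt1 h.
have b0 : a - S z != 0.
  have := cabs_frostman_circle z1; rewrite /frostman => e.
  by apply: contra_eqN e => /eqP ->; rewrite mul0r cabs0 eq_sym oner_eq0.
rewrite kappaE /frostman.
have -> : 1 - a / S z = - ((a - S z) / S z) by field.
by field; rewrite s0 b0 d.
Qed.

End InnerFunction.

(** * Measurable and integrable functions on the circle *)

Section SquareIntegrable.
Variable R : realType.
Local Notation C := R[i].
Local Notation mu := (@lebesgue_measure R).
Local Notation I01 := (`[0%R, 1%R]%classic : set R).
Implicit Types (f g h : C -> C) (c : C).

Lemma measurable_I01 : measurable (I01 : set (measurableTypeR R)). Proof. exact: measurable_itv. Qed.
Hint Resolve measurable_I01 : core.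

Lemma lebesgue_I01 : mu I01 = 1%E.
Proof. by rewrite lebesgue_measure_itv /= lte_fin ltr01 oppr0 adde0. Qed.

Lemma circle_ae_mono (P Q : C -> Prop) : (forall z, cabs z = 1 -> P z -> Q z) ->
  circle_ae P -> circle_ae Q.
Proof.
move=> PQ; rewrite /circle_ae; apply: filterS; first exact: (ae_filter_ringOfSetsType mu).
by move=> t H It; apply: PQ; [exact: cabs_circle|exact: H].
Qed.

Lemma circle_ae_mono2 (P Q S : C -> Prop) : (forall z, cabs z = 1 -> P z -> Q z -> S z) ->
  circle_ae P -> circle_ae Q -> circle_ae S.
Proof.
move=> PQS; rewrite /circle_ae; apply: filterS2; first exact: (ae_filter_ringOfSetsType mu).
by move=> t HP HQ It; apply: PQS; [exact: cabs_circle|exact: HP|exact: HQ].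
Qed.

Definition measurable_circle f := measurable_fun I01 (fun t => Re (f (circle t))) /\
  measurable_fun I01 (fun t => Im (f (circle t))).

Lemma measurable_circle_cst c : measurable_circle (fun=> c).
Proof. by split; exact: measurable_cst. Qed.

Lemma measurable_cos2pi : measurable_fun I01 (fun t : R => cos (2 * pi * t)).
Proof.
apply: measurable_funTS; apply: continuous_measurable_fun => x.
apply: (@continuous_comp R R R (fun t => 2 * pi * t) cos); last exact: continuous_cos.
by apply: cvgM; [exact: cvg_cst|exact: cvg_id].
Qed.

Lemma measurable_sin2pi : measurable_fun I01 (fun t : R => sin (2 * pi * t)).
Proof.
apply: measurable_funTS; apply: continuous_measurable_fun => x.
apply: (@continuous_comp R R R (fun t => 2 * pi * t) sin); last exact: continuous_sin.
by apply: cvgM; [exact: cvg_cst|exact: cvg_id].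
Qed.

Lemma measurable_circle_id : measurable_circle id.
Proof. by split; [exact: measurable_cos2pi|exact: measurable_sin2pi]. Qed.

Lemma measurable_circleD f g : measurable_circle f -> measurable_circle g -> measurable_circle (fun z => f z + g z).
Proof.
move=> [f1 f2] [g1 g2]; split.
  under [X in measurable_fun _ X]eq_fun do rewrite /= Re_addc; exact: measurable_funD.
under [X in measurable_fun _ X]eq_fun do rewrite /= Im_addc; exact: measurable_funD.
Qed.

Lemma measurable_circleN f : measurable_circle f -> measurable_circle (fun z => - f z).
Proof.
move=> [f1 f2]; split.
  under [X in measurable_fun _ X]eq_fun do rewrite /= Re_oppc; exact: measurable_funN.
under [X in measurable_fun _ X]eq_fun do rewrite /= Im_oppc; exact: measurable_funN.
Qed.

Lemma measurable_circleB f g : measurable_circle f -> measurable_circle g -> measurable_circle (fun z => f z - g z).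
Proof. by move=> mf mg; apply: measurable_circleD => //; exact: measurable_circleN. Qed.

Lemma measurable_circleM f g : measurable_circle f -> measurable_circle g -> measurable_circle (fun z => f z * g z).
Proof.
move=> [f1 f2] [g1 g2]; split.
  under [X in measurable_fun _ X]eq_fun do rewrite /= Re_mulc.
  by apply: measurable_funB; exact: measurable_funM.
under [X in measurable_fun _ X]eq_fun do rewrite /= Im_mulc.
by apply: measurable_funD; exact: measurable_funM.
Qed.

Lemma measurable_circleJ f : measurable_circle f -> measurable_circle (fun z => (f z)^*).
Proof.
move=> [f1 f2]; split.
  by under [X in measurable_fun _ X]eq_fun do rewrite /= Re_conjc.
under [X in measurable_fun _ X]eq_fun do rewrite /= Im_conjc; exact: measurable_funN.
Qed.

Lemma measurable_sqnorm f : measurable_circle f ->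
  measurable_fun I01 (fun t => cabs (f (circle t)) ^+ 2).
Proof.
move=> [f1 f2]; under [X in measurable_fun _ X]eq_fun do rewrite sqr_cabs.
by apply: measurable_funD; exact: measurable_funX.
Qed.

Lemma measurable_circleV f : measurable_circle f -> measurable_circle (fun z => (f z)^-1).
Proof.
move=> mf; have ms := measurable_sqnorm mf.
(* The inverse on nonnegative reals is the power of exponent -1. *)
have mi : measurable_fun I01 (fun t => (cabs (f (circle t)) ^+ 2)^-1).
  under [X in measurable_fun _ X]eq_fun do rewrite -powR_inv1 ?sqr_ge0 //.
  apply: (measurableT_comp (f := fun x : R => x `^ (-1)) _ ms); exact: measurable_powR.
have e z : (f z)^-1 = ((cabs (f z) ^+ 2)^-1)%:C * (f z)^*.
  have [->|z0] := eqVneq (f z) 0; first by rewrite invr0 rmorph0 mulr0.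
  apply: (@mulfI _ (f z)) => //; rewrite mulrCA mulJc divff // fmorphV mulVf //.
  by apply/eqP => /(@complexI R) /eqP; rewrite expf_eq0 /= cabs_eq0 (negbTE z0).
under [fun _ => _]eq_fun do rewrite e.
apply: measurable_circleM; last exact: measurable_circleJ.
by split => //=; exact: measurable_cst.
Qed.

Lemma measurable_circle_cexp f : measurable_circle f -> measurable_circle (fun z => cexp (f z)).
Proof.
move=> [f1 f2].
have me : measurable_fun I01 (fun t => expR (Re (f (circle t)))).
  exact: (measurableT_comp (@measurable_expR R) f1).
have mc : measurable_fun I01 (fun t => cos (Im (f (circle t)))).
  apply: (measurableT_comp (f := cos) _ f2).
  by apply: continuous_measurable_fun; exact: continuous_cos.
have ms : measurable_fun I01 (fun t => sin (Im (f (circle t)))).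
  apply: (measurableT_comp (f := sin) _ f2).
  by apply: continuous_measurable_fun; exact: continuous_sin.
split.
  under [X in measurable_fun _ X]eq_fun do rewrite cexpE /=; exact: measurable_funM.
under [X in measurable_fun _ X]eq_fun do rewrite cexpE /=; exact: measurable_funM.
Qed.

Lemma measurable_circleX f n : measurable_circle f -> measurable_circle (fun z => f z ^+ n).
Proof.
move=> mf; elim: n => [|n IH]; first exact: measurable_circle_cst.
by under [fun _ => _]eq_fun do rewrite exprS; exact: measurable_circleM.
Qed.

Lemma measurable_circle_singinner p : measurable_circle (@singinner R p).
Proof.
apply: measurable_circle_cexp; apply: measurable_circleM; last exact: measurable_circle_cst.
apply: measurable_circleM; first by apply: measurable_circleD; [exact: measurable_circle_id|exact: measurable_circle_cst].
apply: measurable_circleV; apply: measurable_circleB; [exact: measurable_circle_id|exact: measurable_circle_cst].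
Qed.

Lemma measurable_circle_frostman p : measurable_circle (@frostman R p).
Proof.
have ms := measurable_circle_singinner p.
apply: measurable_circleM; first by apply: measurable_circleB => //; exact: measurable_circle_cst.
apply: measurable_circleV; apply: measurable_circleB; first exact: measurable_circle_cst.
by apply: measurable_circleM => //; exact: measurable_circle_cst.
Qed.

Lemma measurable_circle_kappa p : measurable_circle (@kappa R p).
Proof.
have ms := measurable_circle_singinner p.
have -> : @kappa R p = (fun v => (1 - (invsqrtp R p)%:C * singinner p v)
    / (1 - (invsqrtp R p)%:C / singinner p v)) by apply/funext => v; exact: kappaE.
apply: measurable_circleM.
  by apply: measurable_circleB; [exact: measurable_circle_cst|apply: measurable_circleM => //; exact: measurable_circle_cst].
apply: measurable_circleV; apply: measurable_circleB; first exact: measurable_circle_cst.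
by apply: measurable_circleM; [exact: measurable_circle_cst|exact: measurable_circleV].
Qed.

Definition integrable01 (h : R -> R) := mu.-integrable I01 (EFin \o h).
Definition sqnorm f := fun t : R => cabs (f (circle t)) ^+ 2.

Lemma integrable01_ge0P (h : R -> R) : measurable_fun I01 h -> (forall t, 0 <= h t) ->
  integrable01 h <-> (\int[mu]_(t in I01) (h t)%:E < +oo)%E.
Proof.
move=> mh h0; split => [/integrableP[_]|H].
  by under eq_integral do rewrite /= ger0_norm //.
apply/integrableP; split; first exact/measurable_EFinP.
by under eq_integral do rewrite /= ger0_norm //.
Qed.

Lemma L2P f : L2 f <-> measurable_circle f /\ integrable01 (sqnorm f).
Proof.
split=> [[m1 m2 i]|[[m1 m2] i]].
  have mf : measurable_circle f by [].
  split => //; apply/(integrable01_ge0P (measurable_sqnorm mf)) => // t; exact: sqr_ge0.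
split => //.
by apply/(integrable01_ge0P (measurable_sqnorm (conj m1 m2))) => // t; exact: sqr_ge0.
Qed.

Lemma integrable01_le (h k : R -> R) : measurable_fun I01 h -> (forall t, I01 t -> `|h t| <= k t) ->
  integrable01 k -> integrable01 h.
Proof.
move=> mh hk; apply: le_integrable => //; first exact/measurable_EFinP.
by move=> t It /=; rewrite lee_fin (le_trans (hk t It)) // ler_norm.
Qed.

Lemma integrable01D (h k : R -> R) : integrable01 h -> integrable01 k -> integrable01 (fun t => h t + k t).
Proof. by move=> ih ik; have := integrableD measurable_I01 ih ik; apply: eq_integrable. Qed.

Lemma integrable01Z (x : R) (h : R -> R) : integrable01 h -> integrable01 (fun t => x * h t).
Proof. by move=> ih; have := integrableZl measurable_I01 x ih; apply: eq_integrable. Qed.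

Lemma integrable01_cst (x : R) : integrable01 (fun=> x).
Proof.
have fin : (mu I01 < +oo)%E by rewrite lebesgue_I01 ltry.
apply: measurable_bounded_integrable => //.
by exists `|x|; split; [exact: num_real|move=> y xy t _ /=; exact: ltW].
Qed.

Definition circle_integrable f := integrable01 (fun t => Re (f (circle t))) /\ integrable01 (fun t => Im (f (circle t))).

Lemma circle_integrable_le f (k : R -> R) : measurable_circle f -> (forall t, I01 t -> cabs (f (circle t)) <= k t) ->
  integrable01 k -> circle_integrable f.
Proof.
move=> [m1 m2] fk ik; split; apply: (integrable01_le _ _ ik) => // t It;
  apply: le_trans (fk t It); [exact: normRe_cabs|exact: normIm_cabs].
Qed.

Lemma circle_intD f g : circle_integrable f -> circle_integrable g ->
  circle_int (fun z => f z + g z) = circle_int f + circle_int g.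
Proof.
move=> [f1 f2] [g1 g2]; rewrite /circle_int.
under eq_Rintegral do rewrite Re_addc.
under [X in _ +i* X]eq_Rintegral do rewrite Im_addc.
by rewrite !RintegralD.
Qed.

Lemma circle_intZ c f : circle_integrable f -> circle_int (fun z => c * f z) = c * circle_int f.
Proof.
move=> [f1 f2]; rewrite /circle_int.
under eq_Rintegral do rewrite Re_mulc.
under [X in _ +i* X]eq_Rintegral do rewrite Im_mulc.
have z1 x := integrable01Z x f1; have z2 x := integrable01Z x f2.
rewrite (RintegralB measurable_I01 (z1 _) (z2 _)) (RintegralD measurable_I01 (z2 _) (z1 _)).
rewrite !(RintegralZl _ measurable_I01 f1) !(RintegralZl _ measurable_I01 f2).
by apply: complex_ext; rewrite ?Re_mulc ?Im_mulc /=; ring.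
Qed.

Lemma circle_intJ f : circle_integrable f -> circle_int (fun z => (f z)^*) = (circle_int f)^*.
Proof.
move=> [f1 f2]; rewrite /circle_int.
under eq_Rintegral do rewrite Re_conjc.
under [X in _ +i* X]eq_Rintegral do rewrite Im_conjc -mulN1r.
by rewrite RintegralZl // mulN1r.
Qed.

End SquareIntegrable.

(** * The inner product of L2 *)

Section InnerProduct.
Variable R : realType.
Local Notation C := R[i].
Local Notation mu := (@lebesgue_measure R).
Local Notation I01 := (`[0%R, 1%R]%classic : set R).
Implicit Types (f g h : C -> C) (c : C).

Definition energy f : R := Rintegral mu I01 (sqnorm f).

Lemma cabs2D (x y : C) : cabs (x + y) ^+ 2 <= 2 * cabs x ^+ 2 + 2 * cabs y ^+ 2.
Proof.
have := cabsD x y; have := cabs_ge0 x; have := cabs_ge0 y; have := cabs_ge0 (x + y).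
have := sqr_ge0 (cabs x - cabs y); nra.
Qed.

Lemma L2D f g : L2 f -> L2 g -> L2 (fun z => f z + g z).
Proof.
move=> /L2P[mf fi] /L2P[mg gi]; apply/L2P.
have m := measurable_circleD mf mg; split=> //.
apply: (integrable01_le (measurable_sqnorm m) _ (integrable01D (integrable01Z 2 fi) (integrable01Z 2 gi))) => t _.
by rewrite ger0_norm ?sqr_ge0 // cabs2D.
Qed.

Lemma L2_mulb (phi : C -> C) (M : R) f : measurable_circle phi ->
  (forall z, cabs z = 1 -> cabs (phi z) <= M) -> L2 f -> L2 (fun z => phi z * f z).
Proof.
move=> mp pM /L2P[mf fi]; apply/L2P; have m := measurable_circleM mp mf; split=> //.
apply: (integrable01_le (measurable_sqnorm m) _ (integrable01Z (M ^+ 2) fi)) => t _.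
rewrite ger0_norm ?sqr_ge0 // cabsM exprMn ler_wpM2r ?sqr_ge0 //.
have := pM _ (cabs_circle t); have := cabs_ge0 (phi (circle t)); nra.
Qed.

Lemma L2Z c f : L2 f -> L2 (fun z => c * f z).
Proof. by apply: (L2_mulb (M := cabs c)) => //; exact: measurable_circle_cst. Qed.

Lemma L2N f : L2 f -> L2 (fun z => - f z).
Proof.
move=> fL; have -> : (fun z => - f z) = (fun z => -1 * f z) by apply/funext => z; rewrite mulN1r.
exact: L2Z.
Qed.

Lemma L2B f g : L2 f -> L2 g -> L2 (fun z => f z - g z).
Proof. by move=> fL /L2N; exact: L2D. Qed.

Lemma L2_measurable f : L2 f -> measurable_circle f. Proof. by move=> /L2P[]. Qed.

Lemma L2_bounded f (M : R) : measurable_circle f -> (forall z, cabs z = 1 -> cabs (f z) <= M) -> L2 f.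
Proof.
move=> mf fM; have L1 : L2 (fun=> 1 : C).
  apply/L2P; split; first exact: measurable_circle_cst.
  rewrite /sqnorm (_ : (fun _ : R => cabs (1 : C) ^+ 2) = fun=> 1); first exact: integrable01_cst.
  by apply/funext => t; rewrite cabs1 expr1n.
have := L2_mulb mf fM L1; rewrite (_ : (fun z => f z * 1) = f) //.
by apply/funext => z; rewrite mulr1.
Qed.

Lemma L2_0 : L2 (fun=> 0 : C).
Proof. by apply: (L2_bounded (M := 0)); [exact: measurable_circle_cst|move=> z _; rewrite cabs0]. Qed.

Lemma integrable_sqnorm f : L2 f -> integrable01 (sqnorm f). Proof. by move=> /L2P[]. Qed.

Lemma energy_ge0 f : 0 <= energy f.
Proof. by apply: Rintegral_ge0 => t _; exact: sqr_ge0. Qed.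

Lemma circle_integrable_dot f g : L2 f -> L2 g -> circle_integrable (fun z => f z * (g z)^*).
Proof.
move=> fL gL; apply: (circle_integrable_le _ _ (integrable01D (integrable_sqnorm fL) (integrable_sqnorm gL))).
  by apply: measurable_circleM; [exact: L2_measurable|apply: measurable_circleJ; exact: L2_measurable].
move=> t _; rewrite cabsM cabsJ /sqnorm.
have := sqr_ge0 (cabs (f (circle t)) - cabs (g (circle t))).
have := cabs_ge0 (f (circle t)); have := cabs_ge0 (g (circle t)); nra.
Qed.

Lemma dotDl f g h : L2 f -> L2 g -> L2 h ->
  dotL2 (fun z => f z + g z) h = dotL2 f h + dotL2 g h.
Proof.
move=> fL gL hL; rewrite /dotL2 -circle_intD; [|exact: circle_integrable_dot..].
by congr circle_int; apply/funext => z; rewrite mulrDl.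
Qed.

Lemma dotZl c f h : L2 f -> L2 h -> dotL2 (fun z => c * f z) h = c * dotL2 f h.
Proof.
move=> fL hL; rewrite /dotL2 -circle_intZ; last exact: circle_integrable_dot.
by congr circle_int; apply/funext => z; rewrite mulrA.
Qed.

Lemma dotC f g : L2 f -> L2 g -> dotL2 g f = (dotL2 f g)^*.
Proof.
move=> fL gL; rewrite /dotL2 -circle_intJ; last exact: circle_integrable_dot.
by congr circle_int; apply/funext => z; rewrite rmorphM /= conjCK mulrC.
Qed.

Lemma dotNl f h : L2 f -> L2 h -> dotL2 (fun z => - f z) h = - dotL2 f h.
Proof.
move=> fL hL; rewrite -mulN1r -dotZl //.
by congr dotL2; apply/funext => z; rewrite mulN1r.
Qed.

Lemma dotBl f g h : L2 f -> L2 g -> L2 h ->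
  dotL2 (fun z => f z - g z) h = dotL2 f h - dotL2 g h.
Proof. by move=> fL gL hL; rewrite dotDl ?dotNl //; exact: L2N. Qed.

Lemma dotDr f g h : L2 f -> L2 g -> L2 h ->
  dotL2 h (fun z => f z + g z) = dotL2 h f + dotL2 h g.
Proof.
move=> fL gL hL; rewrite dotC ?dotDl ?rmorphD //=; [|exact: L2D].
by rewrite -!dotC.
Qed.

Lemma dotZr c f h : L2 f -> L2 h -> dotL2 h (fun z => c * f z) = c^* * dotL2 h f.
Proof.
by move=> fL hL; rewrite dotC ?dotZl ?rmorphM /= -?dotC //; exact: L2Z.
Qed.

Lemma dotNr f h : L2 f -> L2 h -> dotL2 h (fun z => - f z) = - dotL2 h f.
Proof.
by move=> fL hL; rewrite dotC ?dotNl ?rmorphN /= -?dotC //; exact: L2N.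
Qed.

Lemma dotff f : dotL2 f f = (energy f)%:C.
Proof.
rewrite /dotL2 /circle_int; apply: complex_ext => /=.
  by apply: eq_Rintegral => t _; rewrite mulJc.
under eq_Rintegral do rewrite mulJc /=.
by rewrite Rintegral_cst ?mul0r //; exact: (@measurable_I01 R).
Qed.

Lemma normL2E f : normL2 f = Num.sqrt (energy f).
Proof. by rewrite /normL2 dotff. Qed.

Lemma normL2_lt f (e : R) : 0 < e -> normL2 f < e <-> energy f < e ^+ 2.
Proof.
move=> e0; rewrite normL2E -(ltr_pXn2r (_ : 0 < 2)%N) ?nnegrE ?sqrtr_ge0 ?(ltW e0) //.
by rewrite sqr_sqrtr // energy_ge0.
Qed.

Lemma energyDdot f g : L2 f -> L2 g ->
  energy (fun z => f z + g z) = energy f + energy g + 2 * Re (dotL2 f g).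
Proof.
move=> fL gL; apply: complexI; rewrite -dotff dotDl ?dotDr //; last exact: L2D.
rewrite !dotff (dotC fL gL) !rmorphD rmorphM rmorph_nat /=.
have -> : (dotL2 f g)^* = 2 * (Re (dotL2 f g))%:C - dotL2 f g.
  rewrite -addcJ; have -> : conjc (dotL2 f g) = (dotL2 f g)^* by []; ring.
by ring.
Qed.

Lemma energyZ c f : L2 f -> energy (fun z => c * f z) = cabs c ^+ 2 * energy f.
Proof.
move=> fL; apply: complexI; rewrite -dotff dotZl ?dotZr //; last exact: L2Z.
by rewrite dotff mulrA mulJc -rmorphM.
Qed.

Lemma energyN f : energy (fun z => - f z) = energy f.
Proof. by rewrite /energy /sqnorm; apply: eq_Rintegral => t _; rewrite cabsN. Qed.

Lemma energyBC f g : energy (fun z => f z - g z) = energy (fun z => g z - f z).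
Proof. by rewrite -energyN; congr energy; apply/funext => z; rewrite opprB. Qed.

Lemma parallelogram f g : L2 f -> L2 g ->
  energy (fun z => f z + g z) + energy (fun z => f z - g z) = 2 * (energy f + energy g).
Proof.
move=> fL gL; rewrite energyDdot // energyDdot //; last exact: L2N.
by rewrite energyN dotNr // Re_oppc; ring.
Qed.

Lemma energyD_le f g : L2 f -> L2 g ->
  energy (fun z => f z + g z) <= 2 * energy f + 2 * energy g.
Proof.
by move=> fL gL; have := parallelogram fL gL; have := energy_ge0 (fun z => f z - g z); lra.
Qed.

(** A weighted form of the Cauchy-Schwarz inequality: it makes the inner product
   continuous in each argument. *)
Lemma Re_dot_le f g (s : R) : L2 f -> L2 g -> 0 < s ->
  2 * `|Re (dotL2 f g)| <= s * energy f + s^-1 * energy g.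
Proof.
move=> fL gL s0.
have h (e : R) : e ^+ 2 = 1 -> 0 <= s * energy f + s^-1 * energy g + 2 * (e * Re (dotL2 f g)).
  move=> e2; have := energy_ge0 (fun z => (e * s)%:C * f z + g z).
  rewrite energyDdot ?energyZ ?dotZl ?cabs_real //; [|exact: L2Z].
  rewrite real_normK ?num_real // exprMn e2 mul1r Re_mulc /= mul0r subr0 => H.
  rewrite -(pmulr_rge0 _ s0); move: H.
  have -> : s * (s * energy f + s^-1 * energy g + 2 * (e * Re (dotL2 f g)))
    = s ^+ 2 * energy f + energy g + 2 * (e * s * Re (dotL2 f g)).
    by field; rewrite gt_eqF.
  by [].
have h1 := h 1 (expr1n _ 2); have h2 := h (-1) (sqrr_sign R 1).
by have [r0|r0] := ger0P (Re (dotL2 f g)); lra.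
Qed.

Lemma dot_le f g (s : R) : L2 f -> L2 g -> 0 < s ->
  cabs (dotL2 f g) <= s * energy f + s^-1 * energy g.
Proof.
move=> fL gL s0; apply: (le_trans (cabs_le_ReIm _)).
have h1 := Re_dot_le fL gL s0.
have h2 := Re_dot_le (L2Z (- 'i%C) fL) gL s0.
move: h2; rewrite dotZl // energyZ // cabsN.
have -> : cabs 'i = 1 :> R by rewrite cabsE /= expr0n add0r expr1n sqrtr1.
rewrite expr1n mul1r Re_mulc /= !oppr0 mul0r sub0r mulN1r opprK; lra.
Qed.

Lemma ae_I_mono (P Q : R -> Prop) : (forall t, t \in `[0, 1] -> P t -> Q t) ->
  {ae mu, forall t, t \in `[0, 1] -> P t} -> {ae mu, forall t, t \in `[0, 1] -> Q t}.
Proof.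
move=> PQ; apply: filterS; first exact: (ae_filter_ringOfSetsType mu).
by move=> t H It; apply: PQ => //; exact: H.
Qed.

Lemma ae_eq_rint (F G : R -> R) : measurable_fun I01 F -> measurable_fun I01 G ->
  {ae mu, forall t, t \in `[0, 1] -> F t = G t} ->
  Rintegral mu I01 F = Rintegral mu I01 G.
Proof.
move=> mF mG FG; rewrite /Rintegral; congr fine; apply: ae_eq_integral; first exact: (@measurable_I01 R).
- exact/measurable_EFinP.
- exact/measurable_EFinP.
- by move: FG; apply: ae_I_mono => t It /= ->.
Qed.

Lemma ae_eq_circle_int f g : measurable_circle f -> measurable_circle g -> ae_eq_circle f g ->
  circle_int f = circle_int g.
Proof.
move=> [f1 f2] [g1 g2] fg; rewrite /circle_int; congr (_ +i* _).
  by apply: ae_eq_rint => //; move: fg; apply: ae_I_mono => t It /= ->.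
by apply: ae_eq_rint => //; move: fg; apply: ae_I_mono => t It /= ->.
Qed.

Lemma ae_dotr f g h : measurable_circle f -> measurable_circle g -> measurable_circle h -> ae_eq_circle f g ->
  dotL2 h f = dotL2 h g.
Proof.
move=> mf mg mh fg; apply: ae_eq_circle_int.
- by apply: measurable_circleM => //; exact: measurable_circleJ.
- by apply: measurable_circleM => //; exact: measurable_circleJ.
- by apply: circle_ae_mono fg => z _ ->.
Qed.

Lemma ae_energy f g : measurable_circle f -> measurable_circle g -> ae_eq_circle f g -> energy f = energy g.
Proof.
move=> mf mg fg; apply: ae_eq_rint; [exact: measurable_sqnorm..|].
by move: fg; apply: ae_I_mono => t It; rewrite /sqnorm => ->.
Qed.

Lemma energy_eq0 f : L2 f -> energy f = 0 -> ae_eq_circle f (fun=> 0).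
Proof.
move=> fL e0; have [mf fi] := (L2P f).1 fL.
have i0 : (\int[mu]_(t in I01) `|(sqnorm f t)%:E| = 0)%E.
  have -> : (\int[mu]_(t in I01) `|(sqnorm f t)%:E| = \int[mu]_(t in I01) (sqnorm f t)%:E)%E.
    by apply: eq_integral => t _; rewrite /= ger0_norm // sqr_ge0.
  move: e0; rewrite /energy /Rintegral => e0.
  by have fn := integrable_fin_num (@measurable_I01 R) fi; rewrite -[LHS]fineK ?e0.
have mE : measurable_fun I01 (EFin \o sqnorm f).
  by apply/measurable_EFinP; exact: measurable_sqnorm.
have /(ae_eq_integral_abs mu (@measurable_I01 R) mE) : (\int[mu]_(t in I01) `|(EFin \o sqnorm f) t| = 0)%E by [].
apply: ae_I_mono => t It /(congr1 fine) /= /eqP.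
by rewrite expf_eq0 /= cabs_eq0 => /eqP.
Qed.

End InnerProduct.

(** * Completeness of L2 *)

Section Completeness.
Variable R : realType.
Local Notation C := R[i].
Local Notation mu := (@lebesgue_measure R).
Local Notation I01 := (`[0%R, 1%R]%classic : set R).
Implicit Types (f g h : C -> C) (c : C).

(** The intervals of center [a n] and radius [2 M / 2^n] are nested. *)
Lemma geom_cauchy_real (a : nat -> R) (M : R) : 0 <= M ->
  (forall n, `|a n.+1 - a n| <= M / 2 ^+ n) ->
  exists l, forall n, `|l - a n| <= 2 * M / 2 ^+ n.
Proof.
move=> M0 H; set b := fun n => a n + 2 * M / 2 ^+ n; set c := fun n => a n - 2 * M / 2 ^+ n.
have step n : c n <= c n.+1 /\ b n.+1 <= b n.
  have := H n; rewrite ler_norml /b /c exprS => /andP[h1 h2].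
  have e : 2 * M / (2 * 2 ^+ n) = M / 2 ^+ n by field; rewrite expf_neq0.
  have e' : 2 * M / 2 ^+ n = M / 2 ^+ n + M / 2 ^+ n by ring.
  by rewrite e e'; split; lra.
have cmono m n : (m <= n)%N -> c m <= c n.
  move=> /subnK <-; elim: (n - m)%N => // k IH.
  by rewrite addSn; apply: (le_trans IH); exact: (step _).1.
have bmono m n : (m <= n)%N -> b n <= b m.
  move=> /subnK <-; elim: (n - m)%N => // k IH.
  by rewrite addSn; apply: le_trans IH; exact: (step _).2.
have cb n : c n <= b n.
  by rewrite /c /b lerD2l ge0_cp // divr_ge0 ?mulr_ge0 ?exprn_ge0.
have cbmn m n : c m <= b n.
  apply: (le_trans (cmono m (maxn m n) (leq_maxl _ _))).
  by apply: (le_trans (cb _)); apply: bmono; exact: leq_maxr.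
have hs : has_sup (range c).
  split; first by exists (c 0%N); exists 0%N.
  by exists (b 0%N) => _ [m _ <-]; exact: cbmn.
exists (sup (range c)) => n.
have h1 : c n <= sup (range c) by apply: ub_le_sup; [case: hs|exists n].
have h2 : sup (range c) <= b n.
  by apply: ge_sup; [case: hs|move=> _ [m _ <-]; exact: cbmn].
by rewrite ler_norml; move: h1 h2; rewrite /c /b => h1 h2; apply/andP; split; lra.
Qed.

Lemma geom_cauchy (a : nat -> C) (M : R) : 0 <= M ->
  (forall n, cabs (a n.+1 - a n) <= M / 2 ^+ n) ->
  exists l, forall n, cabs (l - a n) <= 4 * M / 2 ^+ n.
Proof.
move=> M0 H.
have [|x hx] := geom_cauchy_real (a := fun n => Re (a n)) M0.
  by move=> n; apply: le_trans (H n); rewrite -Re_oppc -Re_addc normRe_cabs.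
have [|y hy] := geom_cauchy_real (a := fun n => Im (a n)) M0.
  by move=> n; apply: le_trans (H n); rewrite -Im_oppc -Im_addc normIm_cabs.
exists (x +i* y) => n; apply: (le_trans (cabs_le_ReIm _)).
rewrite Re_addc Im_addc Re_oppc Im_oppc /=.
by apply: (le_trans (lerD (hx n) (hy n))); rewrite -!mulrDl; lra.
Qed.

Lemma cvg_geom_half (M : R) : M / 2 ^+ n @[n --> \oo] --> (0 : R).
Proof.
have := cvg_geometric M (z := 2^-1 : R); rewrite ger0_norm // invf_lt1 ?ltr1n //.
move=> /(_ isT); rewrite /geometric /=.
by under eq_cvg do rewrite exprVn.
Qed.

Lemma cvg_le_geom (x : nat -> R) (l K : R) : (forall n, `|x n - l| <= K / 2 ^+ n) ->
  x n @[n --> \oo] --> l.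
Proof.
move=> H; apply/cvgrPdist_le => e e0.
have /cvgrPdist_le/(_ e e0) := cvg_geom_half K; apply: filterS => n.
rewrite sub0r normrN distrC; apply: le_trans.
exact: le_trans (H n) (ler_norm _).
Qed.

Lemma sum_geom_half (K : R) n : 0 <= K -> \sum_(0 <= i < n) (K / 2 ^+ i) <= 2 * K.
Proof.
move=> K0; suff : \sum_(0 <= i < n) (K / 2 ^+ i) <= 2 * K - 2 * K / 2 ^+ n.
  move=> /le_trans; apply; rewrite gerBl divr_ge0 ?mulr_ge0 ?exprn_ge0 //.
elim: n => [|n IH]; first by rewrite big_geq // expr0 divr1 subrr.
rewrite big_nat_recr //= exprS; apply: (le_trans (lerD IH (lexx _))).
rewrite le_eqVlt; apply/orP; left; apply/eqP; field.
by rewrite expf_neq0.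
Qed.

Section RieszFischer.
Variables (u : nat -> C -> C) (K : R).
Hypothesis uL : forall n, L2 (u n).
Hypothesis uK : forall n, energy (fun z => u n.+1 z - u n z) <= K / 8 ^+ n.

Let d n z := u n.+1 z - u n z.
Let dL n : L2 (d n). Proof. exact: L2B. Qed.
Let w n z : \bar R := (4 ^+ n * cabs (d n z) ^+ 2)%:E.
Let G z : \bar R := (\sum_(0 <= n <oo) w n z)%E.

Let w_ge0 n z : (0 <= w n z)%E.
Proof. by rewrite /w lee_fin; apply: mulr_ge0; [exact: exprn_ge0|exact: sqr_ge0]. Qed.

Let K0 : 0 <= K.
Proof. by have := uK 0; rewrite expr0 divr1; apply: le_trans; exact: energy_ge0. Qed.

Let mw n : measurable_fun I01 (fun t => w n (circle t)).
Proof.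
apply/measurable_EFinP; apply: measurable_funM; first exact: measurable_cst.
by apply: measurable_sqnorm; exact: L2_measurable.
Qed.

Let mG : measurable_fun I01 (fun t => G (circle t)).
Proof.
by apply: (ge0_emeasurable_sum (h := fun n t => w n (circle t)) (P := xpredT)).
Qed.

Let G_ge0 z : (0 <= G z)%E.
Proof. by apply: nneseries_ge0 => n _ _; exact: w_ge0. Qed.

Let intG : (\int[mu]_(t in I01) G (circle t) <= (2 * K)%:E)%E.
Proof.
rewrite /G integral_nneseries //.
apply: lime_le; first by apply: is_cvg_nneseries => n _ _; apply: integral_ge0 => t _; exact: w_ge0.
near=> n; apply: (@le_trans _ _ (\sum_(0 <= i < n) (K / 2 ^+ i)%:E)%E); last first.
  by rewrite sumEFin lee_fin sum_geom_half.
apply: lee_sum => i _.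
have ok := integrable01Z (4 ^+ i) (integrable_sqnorm (dL i)).
have fn := integrable_fin_num (@measurable_I01 R) ok.
have -> : (\int[mu]_(t in I01) w i (circle t) = (4 ^+ i * energy (d i))%:E)%E.
  by rewrite /energy -(RintegralZl _ (@measurable_I01 R) (integrable_sqnorm (dL i))) /Rintegral fineK.
rewrite lee_fin; apply: (le_trans (ler_wpM2l (exprn_ge0 _ _) (uK i))) => //.
have -> : 8 ^+ i = 4 ^+ i * 2 ^+ i :> R by rewrite -exprMn; congr (_ ^+ _); ring.
rewrite le_eqVlt; apply/orP; left; apply/eqP; field.
by rewrite !expf_neq0.
Unshelve. all: by end_near. Qed.

Let good z := (G z < +oo)%E.
Let M z := Num.sqrt (fine (G z)).

Let good_step z n : good z -> cabs (d n z) <= M z / 2 ^+ n.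
Proof.
move=> gz; have Gf : G z \is a fin_num by rewrite ge0_fin_numE.
have h : 4 ^+ n * cabs (d n z) ^+ 2 <= fine (G z).
  rewrite -lee_fin fineK //.
  have := nneseries_lim_ge (u_ := fun i => w i z) (P := xpredT) (m := 0) n.+1 (fun i _ _ => w_ge0 i z).
  apply: le_trans; rewrite big_nat_recr //= leeDr // sume_ge0 // => i _; exact: w_ge0.
rewrite -(ler_pXn2r (_ : 0 < 2)%N) ?nnegrE ?cabs_ge0 ?divr_ge0 ?sqrtr_ge0 ?exprn_ge0 //.
rewrite expr_div_n sqr_sqrtr ?fine_ge0 // ler_pdivlMr ?exprn_gt0 //.
by rewrite -exprM mulnC exprM -natrX mulrC.
Qed.

Let limit_exists : exists g : C -> C, forall z,
  (good z -> forall n, cabs (g z - u n z) <= 4 * M z / 2 ^+ n) /\ (~~ good z -> g z = 0).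
Proof.
suff H z : exists l, (good z -> forall n, cabs (l - u n z) <= 4 * M z / 2 ^+ n)
  /\ (~~ good z -> l = 0) by have [g hg] := boolp.choice H; exists g.
have [gz|bz] := boolP (good z); last by exists 0; split.
have [|l hl] := geom_cauchy (a := fun n => u n z) (M := M z) (sqrtr_ge0 _).
  by move=> n; exact: good_step.
by exists l; split.
Qed.

(** The series [G] of the [4^n |u_(n+1) - u_n|^2] has finite integral, so it is
   finite almost everywhere; where it is, the successive differences are at most
   [sqrt G / 2^n]. The pointwise limit [g] thus satisfies
   [|g - u_n|^2 <= 16 G / 4^n], which gives convergence in L2. Where [G] is
   infinite, [g] is 0. *)
Lemma riesz_fischer : exists2 g, L2 g &
  energy (fun z => g z - u n z) @[n --> \oo] --> (0 : R).
Proof.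
have [g hg] := limit_exists.
pose v n z := if good z then u n z else 0.
have mgood : measurable_fun I01 (fun t : R => good (circle t)).
  apply: (measurable_fun_bool true).
  have := emeasurable_fun_infty_o (@measurable_I01 R) mG +oo%E.
  by congr (measurable _).
have mif (h : R -> R) : measurable_fun I01 h ->
    measurable_fun I01 (fun t : R => if good (circle t) then h t else 0).
  move=> mh; apply: (measurable_fun_if (@measurable_I01 R) mgood _ (measurable_cst _)).
  exact: (measurable_funS (@measurable_I01 R) (@subIsetl _ _ _) mh).
have mv n : measurable_circle (v n).
  have [m1 m2] := L2_measurable (uL n).
  have eRe : (fun t => Re (v n (circle t))) =
    (fun t => if good (circle t) then Re (u n (circle t)) else 0).
    by apply/funext => t; rewrite /v; case: ifP.
  have eIm : (fun t => Im (v n (circle t))) =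
    (fun t => if good (circle t) then Im (u n (circle t)) else 0).
    by apply/funext => t; rewrite /v; case: ifP.
  by split; [rewrite eRe; exact: mif|rewrite eIm; exact: mif].
have vL n : L2 (v n).
  apply/L2P; split=> //.
  apply: (integrable01_le (measurable_sqnorm (mv n)) _ (integrable_sqnorm (uL n))) => t _.
  rewrite ger0_norm ?sqr_ge0 // /sqnorm /v; case: ifP => // _.
  by rewrite cabs0 expr0n sqr_ge0.
have gv z n : cabs (g z - v n z) <= 4 * M z / 2 ^+ n.
  rewrite /v; case: ifP => gz; first exact: (hg z).1.
  rewrite (hg z).2 ?gz // subrr cabs0 divr_ge0 ?mulr_ge0 ?exprn_ge0 //; exact: sqrtr_ge0.
have mg : measurable_circle g.
  split.
    apply: (measurable_fun_cvg (h := fun n t => Re (v n (circle t)))).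
      by move=> n; exact: (mv n).1.
    move=> t _; apply: (cvg_le_geom (K := 4 * M (circle t))) => n.
    by rewrite -Re_oppc -Re_addc (le_trans (normRe_cabs _)) // cabsBC.
  apply: (measurable_fun_cvg (h := fun n t => Im (v n (circle t)))).
    by move=> n; exact: (mv n).2.
  move=> t _; apply: (cvg_le_geom (K := 4 * M (circle t))) => n.
  by rewrite -Im_oppc -Im_addc (le_trans (normIm_cabs _)) // cabsBC.
have iG : mu.-integrable I01 (fun t => G (circle t)).
  apply/integrableP; split => //.
  under eq_integral do rewrite gee0_abs //.
  exact: le_lt_trans intG (ltry _).
have rG : integrable01 (fun t => fine (G (circle t))).
  apply: le_integrable iG; first exact: (@measurable_I01 R).
    apply/measurable_EFinP; apply: measurableT_comp => //; exact: fine_measurable.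
  move=> t _ /=; have := G_ge0 (circle t); case: (G _) => //=.
  by rewrite normr0 leey.
have gvsq n t : sqnorm (fun z => g z - v n z) t <= 16 / 4 ^+ n * fine (G (circle t)).
  rewrite /sqnorm; set z := circle t.
  have := gv z n; rewrite -(ler_pXn2r (_ : 0 < 2)%N) ?nnegrE ?cabs_ge0 //; last first.
    by rewrite divr_ge0 ?mulr_ge0 ?exprn_ge0 //; exact: sqrtr_ge0.
  have -> : (4 * M z / 2 ^+ n) ^+ 2 = 16 / 4 ^+ n * M z ^+ 2.
    have -> : 4 ^+ n = (2 ^+ n) ^+ 2 :> R by rewrite -exprM mulnC exprM; congr (_ ^+ _); ring.
    by field; rewrite expf_neq0.
  by rewrite /M sqr_sqrtr ?fine_ge0.
have gvL n : L2 (fun z => g z - v n z).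
  have m := measurable_circleB mg (mv n); apply/L2P; split=> //.
  apply: (integrable01_le (measurable_sqnorm m) _ (integrable01Z (16 / 4 ^+ n) rG)) => t _.
  by rewrite ger0_norm ?sqr_ge0 //; exact: gvsq.
have gL : L2 g.
  by have := L2D (vL 0%N) (gvL 0%N); congr L2; apply/funext => z; rewrite addrC subrK.
exists g => //.
have Ele n : energy (fun z => g z - u n z) <= 16 * Rintegral mu I01 (fun t => fine (G (circle t))) / 2 ^+ n.
  have -> : energy (fun z => g z - u n z) = energy (fun z => g z - v n z).
    apply: ae_energy; [exact: L2_measurable (L2B gL (uL n))|exact: L2_measurable (gvL n)|].
    have := integrable_ae (@measurable_I01 R) iG; apply: ae_I_mono => t It.
    by rewrite ge0_fin_numE // /v /good => ->.
  apply: (@le_trans _ _ (16 / 4 ^+ n * Rintegral mu I01 (fun t => fine (G (circle t))))).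
    rewrite -(RintegralZl _ (@measurable_I01 R) rG); 
    by apply: (le_Rintegral (@measurable_I01 R) (integrable_sqnorm (gvL n)) (integrable01Z _ rG)) => t _; exact: gvsq.
  have I0 : 0 <= Rintegral mu I01 (fun t => fine (G (circle t))).
    by apply: Rintegral_ge0 => t _; exact: fine_ge0.
  rewrite mulrAC ler_wpM2l ?mulr_ge0 // lef_pV2 ?posrE ?exprn_gt0 //.
  by rewrite lerXn2r ?nnegrE // ler_nat.
by apply: cvg_le_geom => n; rewrite subr0 ger0_norm ?energy_ge0 //; exact: Ele.
Qed.

End RieszFischer.
End Completeness.

(** * Closed subspaces: projections and bounded multipliers *)

Section ClosedSubspaces.
Variable R : realType.
Local Notation C := R[i].
Local Notation mu := (@lebesgue_measure R).
Local Notation I01 := (`[0%R, 1%R]%classic : set R).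
Implicit Types (f g h : C -> C) (c : C) (V : set (C -> C)).

(** Elements are functions and not classes of functions: the last condition also
   makes [V] stable under equality almost everywhere, see [subsp_ae]. *)
Definition closed_subspace V := [/\ V `<=` @L2 R, V (fun=> 0),
  (forall c f g, V f -> V g -> V (fun z => c * f z + g z)) &
  (forall f, L2 f -> (forall e : R, 0 < e -> exists2 g, V g &
     energy (fun z => f z - g z) < e) -> V f)].

Section Subspace.
Variable V : set (C -> C).
Hypothesis cV : closed_subspace V.

Lemma subspL2 f : V f -> L2 f. Proof. by case: cV => h _ _ _; exact: h. Qed.

Lemma subspZ c f : V f -> V (fun z => c * f z).
Proof.
case: cV => _ V0 lin _ Vf; have := lin c f _ Vf V0.
by congr V; apply/funext => z; rewrite addr0.
Qed.

Lemma subspD f g : V f -> V g -> V (fun z => f z + g z).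
Proof.
case: cV => _ _ lin _ Vf Vg; have := lin 1 f g Vf Vg.
by congr V; apply/funext => z; rewrite mul1r.
Qed.

Lemma subspB f g : V f -> V g -> V (fun z => f z - g z).
Proof.
move=> Vf Vg; have := subspD Vf (subspZ (-1) Vg).
by congr V; apply/funext => z; rewrite mulN1r.
Qed.

Lemma subsp_closed f : L2 f -> (forall e : R, 0 < e -> exists2 g, V g &
     energy (fun z => f z - g z) < e) -> V f.
Proof. by case: cV => _ _ _; apply. Qed.

Lemma energy0 : energy (fun=> 0 : C) = 0.
Proof.
by have := energyZ 0 (@L2_0 R); rewrite cabs0 expr0n /= !mul0r.
Qed.

Lemma energy_ae0 f : L2 f -> ae_eq_circle f (fun=> 0) -> energy f = 0.
Proof.
move=> fL f0; rewrite (ae_energy (L2_measurable fL) (L2_measurable (@L2_0 R)) f0); exact: energy0.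
Qed.

Lemma subsp_ae f g : L2 f -> V g -> ae_eq_circle f g -> V f.
Proof.
move=> fL Vg fg; apply: subsp_closed => // e e0; exists g => //.
rewrite energy_ae0 //; first exact: L2B (subspL2 Vg).
by apply: circle_ae_mono fg => z _ ->; rewrite subrr.
Qed.

Lemma subsp_lim (u : nat -> C -> C) f : L2 f -> (forall n, V (u n)) ->
  energy (fun z => f z - u n z) @[n --> \oo] --> (0 : R) -> V f.
Proof.
move=> fL Vu /cvgrPdist_lt H; apply: subsp_closed => // e e0.
have [N _ HN] := H e e0; exists (u N) => //.
by have := HN N (leqnn N); rewrite /= sub0r normrN ger0_norm // energy_ge0.
Qed.

Lemma energyD_wle f g (s : R) : L2 f -> L2 g -> 0 < s ->
  energy (fun z => f z + g z) <= (1 + s) * energy f + (1 + s^-1) * energy g.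
Proof.
move=> fL gL s0; rewrite energyDdot //; have := Re_dot_le fL gL s0.
have := ler_norm (Re (dotL2 f g)); lra.
Qed.

(** A minimizing sequence for the distance from [f] to [V] is Cauchy by the
   parallelogram law, and its limit realizes the distance. *)
Lemma min_distance f : L2 f -> exists2 g, V g & forall h, V h ->
  energy (fun z => f z - g z) <= energy (fun z => f z - h z).
Proof.
move=> fL; pose D := [set energy (fun z => f z - h z) | h in V].
have D0 : lbound D 0 by move=> _ [h Vh <-]; exact: energy_ge0.
have Dne : D !=set0.
  by exists (energy (fun z => f z - 0)); exists (fun=> 0) => //; case: cV.
have Dinf : has_inf D by split => //; exists 0.
set d := inf D.
have dle h : V h -> d <= energy (fun z => f z - h z).
  by move=> Vh; apply: ge_inf; [exists 0|exists h].
have H n : exists h, V h /\ energy (fun z => f z - h z) < d + 1 / 8 ^+ n.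
  have e0 : 0 < 1 / 8 ^+ n :> R by rewrite divr_gt0 // exprn_gt0.
  by have [_ [h Vh <-] hlt] := inf_adherent e0 Dinf; exists h.
have [u Hu] := boolp.choice H.
have uV n : V (u n) by case: (Hu n).
have uL n : L2 (u n) := subspL2 (uV n).
have uK n : energy (fun z => u n.+1 z - u n z) <= 4 / 8 ^+ n.
  have [_ h1] := Hu n; have [_ h2] := Hu n.+1.
  have := parallelogram (L2B fL (uL n)) (L2B fL (uL n.+1)).
  have -> : (fun z => f z - u n z - (f z - u n.+1 z)) = (fun z => u n.+1 z - u n z).
    by apply/funext => z; ring.
  have mV : V (fun z => 2^-1 * (u n z + u n.+1 z)) by apply: subspZ; exact: subspD.
  have -> : (fun z => f z - u n z + (f z - u n.+1 z))
    = (fun z => 2 * (f z - 2^-1 * (u n z + u n.+1 z))).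
    by apply/funext => z; field.
  rewrite energyZ; last by apply: L2B => //; exact: subspL2.
  have -> : cabs 2 ^+ 2 = 4 :> R.
    have -> : (2 : C) = (2 : R)%:C by rewrite rmorph_nat.
    by rewrite cabs_real ger0_norm //; ring.
  have := dle _ mV; move: h1 h2; rewrite exprS.
  have E0 : 0 < 8 ^+ n :> R by rewrite exprn_gt0.
  have -> : 1 / (8 * 8 ^+ n) = 8^-1 * (1 / 8 ^+ n) :> R by field; rewrite gt_eqF.
  have -> : 4 / 8 ^+ n = 4 * (1 / 8 ^+ n) :> R by ring.
  have : 0 < 1 / 8 ^+ n :> R by rewrite divr_gt0.
  lra.
have [g gL gu] := riesz_fischer uL uK.
have gV : V g := subsp_lim gL uV gu.
exists g => // h Vh; apply: (le_trans _ (dle h Vh)).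
apply/ler_addgt0Pr => e e0.
have d0 : 0 <= d by apply: lb_le_inf.
(* Weights for [energyD_wle]: [s] makes [(1 + s) d <= d + e / 2], and [et] absorbs
   the error made by stopping the sequence. *)
pose s := e / (2 * (d + 1)).
have s0 : 0 < s by rewrite divr_gt0 // mulr_gt0 //; lra.
pose et := e / (2 * ((1 + s) + (1 + s^-1))).
have si0 : 0 < s^-1 by rewrite invr_gt0.
have et0 : 0 < et by rewrite divr_gt0 // mulr_gt0 //; lra.
have /cvgrPdist_lt/(_ et et0)[N1 _ HN1] := gu.
have /cvgrPdist_lt/(_ et et0)[N2 _ HN2] := cvg_geom_half (1 : R).
have h1 : energy (fun z => g z - u (maxn N1 N2) z) < et.
  have := HN1 _ (leq_maxl N1 N2).
  by rewrite /= sub0r normrN ger0_norm // energy_ge0.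
have h2 : energy (fun z => f z - u (maxn N1 N2) z) < d + et.
  have [_ hh] := Hu (maxn N1 N2); apply: (lt_trans hh); rewrite ltrD2l.
  have := HN2 _ (leq_maxr N1 N2); rewrite /= sub0r normrN ger0_norm ?divr_ge0 ?exprn_ge0 //.
  apply: le_lt_trans; rewrite ler_wpM2l // lef_pV2 ?posrE ?exprn_gt0 //.
  by rewrite lerXn2r ?nnegrE // ler_nat.
move: (u _) (uL (maxn N1 N2)) h1 h2 => v vL h1 h2.
have -> : (fun z => f z - g z) = (fun z => (f z - v z) + (v z - g z)).
  by apply/funext => z; ring.
apply: (le_trans (energyD_wle (L2B fL vL) (L2B vL gL) s0)).
rewrite (energyBC v g).
have k1 : (1 + s) * energy (fun z => f z - v z) <= (1 + s) * (d + et).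
  by rewrite ler_wpM2l ?ltW //; lra.
have k2 : (1 + s^-1) * energy (fun z => g z - v z) <= (1 + s^-1) * et.
  by rewrite ler_wpM2l ?ltW //; lra.
have k3 : s * d <= e / 2.
  rewrite /s mulrAC ler_pdivrMr; last by rewrite mulr_gt0 //; lra.
  nra.
have k4 : ((1 + s) + (1 + s^-1)) * et = e / 2.
  have q0 : 1 + s + (1 + s^-1) != 0 by rewrite gt_eqF //; lra.
  by rewrite /et; move: (1 + s + _) q0 => q q0; field.
nra.
Qed.

(** Moving the nearest point by a small multiple of [D h], where [D] is the inner
   product of the residue with [h], would come closer to [f] unless [D = 0]. *)
Theorem orthogonal_projection f : L2 f -> exists2 g, V g &
  forall h, V h -> dotL2 (fun z => f z - g z) h = 0.
Proof.
move=> fL; have [g Vg gmin] := min_distance fL; exists g => // h Vh.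
have gL := subspL2 Vg; have hL := subspL2 Vh; have wL := L2B fL gL.
set w := fun z => f z - g z in wL *; set D := dotL2 w h.
have H (t : R) : 0 < t -> 0 <= (t * energy h - 2) * cabs D ^+ 2.
  move=> t0; set c := t%:C * D.
  have := gmin _ (subspD Vg (subspZ c Vh)).
  have -> : (fun z => f z - (g z + c * h z)) = (fun z => w z + - c * h z).
    by apply/funext => z; rewrite /w; ring.
  rewrite (energyDdot wL (L2Z (- c) hL)) energyZ // (dotZr _ hL wL).
  rewrite -/D -/w.
  have -> : Re ((- c)^* * D) = - t * cabs D ^+ 2.
    have -> : (- c)^* * D = (- t * cabs D ^+ 2)%:C.
      rewrite rmorphN rmorphM /= -mulNr; have -> : (t%:C)^* = t%:C :> C by exact: conjc_real.
      by rewrite -mulrA [D^* * D]mulrC mulJc [in RHS]rmorphM rmorphN.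
    by [].
  rewrite cabsN cabsM cabs_real exprMn real_normK ?num_real // => h1.
  by rewrite -(pmulr_rge0 _ t0); move: h1; nra.
have e0 := energy_ge0 h.
have := H (energy h + 1)^-1; rewrite invr_gt0 => /(_ (ltr_wpDl e0 ltr01)).
have q : (energy h + 1)^-1 * energy h - 2 < 0.
  by rewrite subr_lt0 mulrC ltr_pdivrMr; lra.
rewrite nmulr_rge0 // => D0; apply/eqP; rewrite -cabs_eq0 -sqrf_eq0.
by rewrite eq_le D0 sqr_ge0.
Qed.

End Subspace.

Definition multiplier V (phi : C -> C) := [/\ measurable_circle phi,
  (exists M : R, forall z, cabs z = 1 -> cabs (phi z) <= M) &
  (forall f, V f -> V (fun z => phi z * f z))].

Lemma mult_cst V c : closed_subspace V -> multiplier V (fun=> c).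
Proof.
move=> cV; split; first exact: measurable_circle_cst.
  by exists (cabs c).
by move=> f; exact: subspZ.
Qed.

Lemma multD V phi psi : closed_subspace V -> multiplier V phi -> multiplier V psi ->
  multiplier V (fun z => phi z + psi z).
Proof.
move=> cV [m1 [M1 b1] h1] [m2 [M2 b2] h2]; split; first exact: measurable_circleD.
  by exists (M1 + M2) => z z1; apply: (le_trans (cabsD _ _)); rewrite lerD ?b1 ?b2.
move=> f Vf; have := subspD cV (h1 f Vf) (h2 f Vf).
by congr V; apply/funext => z; rewrite mulrDl.
Qed.

Lemma multM V phi psi : multiplier V phi -> multiplier V psi ->
  multiplier V (fun z => phi z * psi z).
Proof.
move=> [m1 [M1 b1] h1] [m2 [M2 b2] h2]; split; first exact: measurable_circleM.
  exists (M1 * M2) => z z1; rewrite cabsM; apply: ler_pM; rewrite ?cabs_ge0 ?b1 ?b2 //.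
move=> f Vf; have := h1 _ (h2 f Vf).
by congr V; apply/funext => z; rewrite mulrA.
Qed.

Lemma multX V phi n : closed_subspace V -> multiplier V phi ->
  multiplier V (fun z => phi z ^+ n).
Proof.
move=> cV m; elim: n => [|n IH]; first exact: (mult_cst 1 cV).
have := multM m IH; rewrite (_ : (fun z => phi z * phi z ^+ n) = (fun z => phi z ^+ n.+1)) //.
by apply/funext => z; rewrite exprS.
Qed.

(** By dominated convergence, multiplication by a bounded pointwise limit of
   multipliers is an L2-limit. *)
Lemma mult_bounded_cvg V (phi : nat -> C -> C) psi (M : R) : closed_subspace V ->
  (forall n, multiplier V (phi n)) ->
  (forall n z, cabs z = 1 -> cabs (phi n z) <= M) ->
  measurable_circle psi -> (forall z, cabs z = 1 -> cabs (psi z) <= M) ->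
  (forall z, cabs z = 1 -> z != 1 -> cabs (psi z - phi n z) @[n --> \oo] --> (0 : R)) ->
  multiplier V psi.
Proof.
move=> cV mphi bphi mpsi bpsi lim; split => //; first by exists M.
move=> f Vf; have fL := subspL2 cV Vf.
have mn n : measurable_circle (phi n) by case: (mphi n).
have pL n : L2 (fun z => phi n z * f z) by apply: L2_mulb (bphi n) fL.
have qL : L2 (fun z => psi z * f z) by apply: L2_mulb bpsi fL.
apply: (subsp_lim cV qL (u := fun n z => phi n z * f z)).
  by move=> n; case: (mphi n) => _ _; exact.
have dL n := L2B qL (pL n).
pose F n t : R := sqnorm (fun z => psi z * f z - phi n z * f z) t.
have FE n t : F n t = cabs (psi (circle t) - phi n (circle t)) ^+ 2 * sqnorm f t.
  by rewrite /F /sqnorm -mulrBl cabsM exprMn.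
have Fle n t : `|F n t| <= 4 * M ^+ 2 * sqnorm f t.
  rewrite ger0_norm ?sqr_ge0 // FE ler_wpM2r ?sqr_ge0 //.
  have z1 := cabs_circle t; have h1 := bphi n _ z1; have h2 := bpsi _ z1.
  have := cabsD (psi (circle t)) (- phi n (circle t)); rewrite cabsN.
  have := cabs_ge0 (phi n (circle t)); have := cabs_ge0 (psi (circle t)).
  have := cabs_ge0 (psi (circle t) - phi n (circle t)); nra.
have mF n : measurable_fun I01 (EFin \o F n).
  by apply/measurable_EFinP; apply: measurable_sqnorm; exact: L2_measurable (dL n).
have F0 : {ae mu, forall t, I01 t -> (F n t)%:E @[n --> \oo] --> 0%E}.
  have : circle_ae (fun z : C => z != 1) by apply: circle_ae_neq1 => z _.
  apply: ae_I_mono => t It z1; apply/cvg_EFin; first by near=> n.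
  have l := lim _ (cabs_circle t) z1.
  rewrite (_ : fine \o _ = F ^~ t) //.
  rewrite -(mul0r (sqnorm f t)) -(mulr0 0).
  under eq_cvg do rewrite FE expr2.
  by apply: cvgM; [exact: cvgM|exact: cvg_cst].
have dom : {ae mu, forall t n, I01 t -> (`|(F n t)%:E| <= (4 * M ^+ 2 * sqnorm f t)%:E)%E}.
  by apply: aeW => t n _; rewrite lee_fin.
have ok := integrable01Z (4 * M ^+ 2) (integrable_sqnorm fL).
have [_ _ cv] := dominated_convergence (@measurable_I01 R) mF (measurable_cst _) F0 ok dom.
rewrite integral0 in cv.
have h := @fine_cvg R nat _ _ _ 0 cv; exact: h.
Unshelve. all: by end_near. Qed.

End ClosedSubspaces.

(** * The exponentials z ^ k *)

Section Characters.
Variable R : realType.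
Local Notation C := R[i].
Local Notation mu := (@lebesgue_measure R).
Local Notation I01 := (`[0%R, 1%R]%classic : set R).
Implicit Types (f g h : C -> C) (c : C) (k m : int).

Lemma circle_neq0 z : cabs z = 1 -> z != 0 :> C.
Proof. by move=> z1; rewrite -cabs_gt0 z1. Qed.

Lemma conj_circle (z : C) : cabs z = 1 -> z^* = z^-1.
Proof.
move=> z1; apply: (@mulfI _ z); first exact: circle_neq0.
by rewrite mulJc z1 expr1n divff ?circle_neq0.
Qed.

Lemma cabsXz (z : C) k : cabs z = 1 -> cabs (z ^ k) = 1.
Proof.
by case: k => n z1; rewrite ?NegzE -?exprnP ?exprnN ?cabsV cabsX z1 expr1n ?invr1.
Qed.

Definition zpow k (z : C) : C := z ^ k.

Lemma zpowD k m z : cabs z = 1 -> zpow (k + m) z = zpow k z * zpow m z.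
Proof. by move=> /circle_neq0 z0; rewrite /zpow expfzDr. Qed.

Lemma zpowJ k z : cabs z = 1 -> (zpow k z)^* = zpow (- k) z.
Proof. by move=> z1; rewrite conj_circle ?cabsXz // /zpow invr_expz. Qed.

Lemma circleE (t : R) : circle t = cexp (0 +i* (2 * pi * t)).
Proof. by rewrite cexp_im. Qed.

Lemma zpow_circle k t : zpow k (circle t) = cexp (0 +i* (2 * pi * k%:~R * t)).
Proof.
have nat n : circle t ^+ n = cexp (0 +i* (2 * pi * n%:R * t)) :> C.
  rewrite circleE -cexpMn; congr cexp.
  have -> : (n%:R : C) = (n%:R : R)%:C by rewrite rmorph_nat.
  by apply: complex_ext; rewrite ?Re_mulc ?Im_mulc /=; ring.
case: k => n; first exact: nat.
rewrite /zpow NegzE -exprnN nat -cexpN; congr cexp.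
by apply: complex_ext; rewrite ?Re_oppc ?Im_oppc /= ?oppr0 // mulrNz; ring.
Qed.

Lemma measurable_circle_zpow k : measurable_circle (zpow k).
Proof.
case: k => n; first exact: (measurable_circleX n (@measurable_circle_id R)).
have -> : zpow (Negz n) = fun z : C => (z ^+ n.+1)^-1.
  by apply/funext => z; rewrite /zpow NegzE -exprnN.
by apply: measurable_circleV; exact: (measurable_circleX _ (@measurable_circle_id R)).
Qed.

Lemma zpow_bound k z : cabs z = 1 -> cabs (zpow k z) <= 1.
Proof. by move=> z1; rewrite cabsXz. Qed.

Lemma zpowL k : L2 (zpow k).
Proof. by apply: L2_bounded (@zpow_bound k); exact: measurable_circle_zpow. Qed.

Lemma circle_int_eq f g : (forall z, cabs z = 1 -> f z = g z) -> circle_int f = circle_int g.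
Proof.
move=> fg; rewrite /circle_int; congr (_ +i* _); apply: eq_Rintegral => t _;
  by rewrite fg ?cabs_circle.
Qed.

Lemma dot_eq f g f' g' : (forall z, cabs z = 1 -> f z * (g z)^* = f' z * (g' z)^*) ->
  dotL2 f g = dotL2 f' g'.
Proof. exact: circle_int_eq. Qed.

(** The fundamental theorem of calculus; it gives the orthogonality of the
   exponentials. *)
Lemma Rintegral_deriv_periodic (F df : R -> R) :
  (forall t : R, is_derive (t : R) (1 : R) F (df t)) -> continuous df -> F 0 = F 1 ->
  Rintegral mu I01 df = 0.
Proof.
move=> dF cdf F01; have cF : continuous F.
  by move=> t; apply/differentiable_continuous/derivable1_diffP; case: (dF t).
rewrite /Rintegral (continuous_FTC2 (F := F)) ?ltr01 //.
- by rewrite F01 subee.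
- exact: continuous_subspaceT.
- split.
  + by move=> t _; case: (dF t).
  + by apply: cvg_at_right_filter; exact: cF.
  + by apply: cvg_at_left_filter; exact: cF.
- by move=> t _; have dt := dF t; rewrite derive1E derive_val.
Qed.

Lemma circle_int_zpow k : k != 0 -> circle_int (zpow k) = 0.
Proof.
move=> k0; set w : R := 2 * pi * k%:~R.
have w0 : w != 0.
  by apply: mulf_neq0; [apply: mulf_neq0 => //; rewrite gt_eqF ?pi_gt0|rewrite intr_eq0].
have per : cos w = 1 /\ sin w = 0.
  have c1 : circle 1 = 1 :> C.
    rewrite /circle mulr1 (_ : 2 * pi = pi *+ 2) ?mulr_natl //.
    by rewrite cos2pi sin2pi.
  by have := zpow_circle k 1; rewrite mulr1 -/w cexp_im c1 /zpow exp1rz => -[].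
have [c1 s1] := per.
have cw : continuous (fun t : R => w * t).
  by move=> x; apply: cvgM; [exact: cvg_cst|exact: cvg_id].
rewrite /circle_int; apply: complex_ext => /=.
  under eq_Rintegral do rewrite zpow_circle -/w cexp_im /=.
  apply: (@Rintegral_deriv_periodic (fun t => w^-1 * sin (w * t))).
  - move=> t; apply: is_derive_eq; rewrite /GRing.scale /=; field => //.
  - move=> x; apply: (@continuous_comp R R R (fun t => w * t) cos); first exact: cw.
    exact: continuous_cos.
  - by rewrite mulr0 mulr1 sin0 s1.
under eq_Rintegral do rewrite zpow_circle -/w cexp_im /=.
apply: (@Rintegral_deriv_periodic (fun t => - (w^-1 * cos (w * t)))).
- move=> t; apply: is_derive_eq; rewrite /GRing.scale /=; field => //.
- move=> x; apply: (@continuous_comp R R R (fun t => w * t) sin); first exact: cw.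
  exact: continuous_sin.
- by rewrite mulr0 mulr1 cos0 c1.
Qed.

Lemma dot_zpow k m : k != m -> dotL2 (zpow k) (zpow m) = 0.
Proof.
move=> km; rewrite -(@circle_int_zpow (k - m)) ?subr_eq0 //.
by apply: circle_int_eq => z z1; rewrite zpowJ // zpowD.
Qed.

End Characters.

(** * Totality of the exponentials *)

Section TrigonometricCompleteness.
Variable R : realType.
Local Notation C := R[i].
Local Notation mu := (@lebesgue_measure R).
Local Notation I01 := (`[0%R, 1%R]%classic : set R).
Implicit Types (f g h : C -> C) (c : C) (k m : int).

(** In [dot_le], first take [s] so large that the term in [h] is small, then [g]
   so close to [f] that the other term is small. *)
Lemma dot_limit f h : L2 f -> L2 h -> (forall e : R, 0 < e ->
    exists g, [/\ L2 g, dotL2 g h = 0 & energy (fun z => f z - g z) < e]) ->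
  dotL2 f h = 0.
Proof.
move=> fL hL H; apply/eqP; rewrite -cabs_eq0 eq_le cabs_ge0 andbT.
apply/ler_addgt0Pr => e e0; rewrite add0r.
have E0 := energy_ge0 h.
pose s := 2 * (energy h + 1) / e.
have s0 : 0 < s by rewrite divr_gt0 // mulr_gt0 //; lra.
have [g [gL g0 gf]] := H (e / (2 * s)) (divr_gt0 e0 (mulr_gt0 (ltr0n _ 2) s0)).
have -> : dotL2 f h = dotL2 (fun z => f z - g z) h by rewrite dotBl // g0 subr0.
apply: (le_trans (dot_le (L2B fL gL) hL s0)).
have k1 : s * energy (fun z => f z - g z) <= e / 2.
  apply: (@le_trans _ _ (s * (e / (2 * s)))); first by rewrite ler_wpM2l // ltW.
  by rewrite le_eqVlt; apply/orP; left; apply/eqP; field; rewrite gt_eqF.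
have k2 : s^-1 * energy h <= e / 2.
  have -> : s^-1 = e / (2 * (energy h + 1)) by rewrite /s invfM invrK mulrC.
  rewrite mulrAC ler_pdivrMr; last by rewrite mulr_gt0 //; lra.
  nra.
lra.
Qed.

Definition orthogonal_to (T : Type) (e_ : T -> C -> C) : set (C -> C) :=
  [set f | L2 f /\ forall i, dotL2 f (e_ i) = 0].

Lemma orthogonal_closed (T : Type) (e_ : T -> C -> C) : (forall i, L2 (e_ i)) ->
  closed_subspace (orthogonal_to e_).
Proof.
move=> eL; split.
- by move=> f [].
- split; first exact: L2_0.
  by move=> i; have := dotZl 0 (@L2_0 R) (eL i); rewrite !mul0r.
- move=> c f g [fL f0] [gL g0]; split; first by apply: L2D => //; exact: L2Z.
  by move=> i; rewrite dotDl ?dotZl ?f0 ?g0 ?mulr0 ?addr0 //; exact: L2Z.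
- move=> f fL H; split=> // i; apply: dot_limit => // e e0.
  by have [g [gL g0] ge] := H e e0; exists g.
Qed.

Lemma zpow_shift_orthogonal k f : orthogonal_to (@zpow R) f ->
  orthogonal_to (@zpow R) (fun z => zpow k z * f z).
Proof.
move=> [fL f0]; split; first by apply: L2_mulb (@zpow_bound R k) fL; exact: measurable_circle_zpow.
move=> m; rewrite -(f0 (m - k)); apply: dot_eq => z z1.
rewrite !zpowJ // opprB zpowD //; ring.
Qed.

Local Notation N := (orthogonal_to (@zpow R)).

Lemma zpow_perp_closed : closed_subspace N.
Proof. by apply: orthogonal_closed; exact: zpowL. Qed.

Lemma mult_zpow k : multiplier N (zpow k).
Proof.
split; [exact: measurable_circle_zpow|by exists 1; exact: zpow_bound|].
by move=> f; exact: zpow_shift_orthogonal.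
Qed.

(** The polynomial map [s -> (3 s - s^3) / 2] of [-1, 1] into itself pushes every
   point towards its sign. *)
Definition signstep (s : R) : R := (3 * s - s ^+ 3) / 2.

Lemma signstep_itv s : -1 <= s <= 1 -> -1 <= signstep s <= 1.
Proof.
move=> /andP[s1 s2].
have h1 : 0 <= (1 - s) ^+ 2 * (2 + s) by apply: mulr_ge0; [exact: sqr_ge0|lra].
have h2 : 0 <= (1 + s) ^+ 2 * (2 - s) by apply: mulr_ge0; [exact: sqr_ge0|lra].
by rewrite /signstep; apply/andP; split; nra.
Qed.

Lemma iter_signstep_itv n s : -1 <= s <= 1 -> -1 <= iter n signstep s <= 1.
Proof. by move=> h; elim: n => //= n; exact: signstep_itv. Qed.

Lemma iter_signstepN n s : iter n signstep (- s) = - iter n signstep s.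
Proof. by elim: n => //= n ->; rewrite /signstep; ring. Qed.

(** The error is multiplied by [(2 - t - t^2) / 2 <= 1 - s / 2] at each step. *)
Lemma iter_signstep_pos n s : 0 < s <= 1 ->
  [/\ s <= iter n signstep s, iter n signstep s <= 1 &
      1 - iter n signstep s <= (1 - s / 2) ^+ n].
Proof.
move=> /andP[s0 s1]; elim: n => [|n [h1 h2 h3]]; first by rewrite /= expr0; split; lra.
rewrite /= exprS; set t := iter n signstep s in h1 h2 h3 *.
have h4 : 0 <= t * (1 - t) * (1 + t) by rewrite !mulr_ge0 //; lra.
have h5 : 0 <= (1 - t) ^+ 2 * (2 + t) by apply: mulr_ge0; [exact: sqr_ge0|lra].
rewrite /signstep; split; [nra|nra|].
have e0 : 0 <= (1 - s / 2) ^+ n by rewrite exprn_ge0 //; lra.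
have k1 : 1 - (3 * t - t ^+ 3) / 2 = (1 - t) * ((2 - t - t ^+ 2) / 2) by field.
rewrite k1 mulrC; apply: (@le_trans _ _ ((1 - s / 2) * (1 - t))).
  have t2 := sqr_ge0 t; apply: ler_wpM2r; lra.
by apply: ler_wpM2l => //; lra.
Qed.

Lemma cvg_iter_signstep s : -1 <= s <= 1 ->
  iter n signstep s @[n --> \oo] --> Num.sg s.
Proof.
have pos (t : R) : 0 < t <= 1 -> iter n signstep t @[n --> \oo] --> (1 : R).
  move=> ht; have /andP[t0 t1] := ht.
  have q : `|1 - t / 2| < 1 by rewrite ger0_norm; lra.
  apply/cvgrPdist_le => e e0.
  have /cvgrPdist_le/(_ e e0) := cvg_geometric 1 q; apply: filterS => n.
  have [h1 h2 h3] := iter_signstep_pos n ht.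
  rewrite sub0r normrN /geometric /= mul1r => h.
  rewrite ger0_norm ?subr_ge0 //; apply: (le_trans h3).
  exact: le_trans (ler_norm _) h.
move=> /andP[s1 s2]; have [s0|s0|->] := ltrgt0P s.
- by rewrite gtr0_sg //; apply: pos; rewrite s0.
- rewrite ltr0_sg //.
  have -> : (fun n => iter n signstep s) = (fun n => - iter n signstep (- s)).
    by apply/funext => n; rewrite iter_signstepN opprK.
  by apply: cvgN; apply: pos; apply/andP; split; lra.
- rewrite sgr0 (_ : (fun n => iter n signstep 0) = fun=> 0); first exact: cvg_cst.
  by apply/funext; elim=> //= n ->; rewrite /signstep; ring.
Qed.

(** On the circle, [arcpoly x] takes the value [sin (pi t) sin (pi (x - t))] at
   angle [2 pi t]: for t in ]0,1[ it has the sign of [x - t]. *)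
Definition arcpoly (x : R) (z : C) : C :=
  4^-1 * (cexp (0 +i* (- (pi * x))) * zpow 1 z + cexp (0 +i* (pi * x)) * zpow (-1) z)
  - (cos (pi * x) / 2)%:C.

Definition arcval (x t : R) : R := sin (pi * t) * sin (pi * (x - t)).

Lemma arcval_itv x t : -1 <= arcval x t <= 1.
Proof.
rewrite -ler_norml /arcval normrM.
have := sin_max (pi * t); have := sin_max (pi * (x - t)).
have := normr_ge0 (sin (pi * t)); have := normr_ge0 (sin (pi * (x - t))); nra.
Qed.

Lemma arcpoly_circle x t : arcpoly x (circle t) = (arcval x t)%:C.
Proof.
have four : (4 : C) = (4 : R)%:C by rewrite rmorph_nat.
rewrite /arcpoly !zpow_circle !cexp_im four -fmorphV /=.
set A := pi * t; set B := pi * x.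
have -> : 2 * pi * 1%:~R * t = A + A by rewrite /A; ring.
have -> : 2 * pi * (-1)%:~R * t = - (A + A) by rewrite /A mulrN1z; ring.
rewrite /arcval -/A mulrBr -/A -/B !cosN !sinN.
have hA := cos2Dsin2 A.
apply: complex_ext; rewrite ?(Re_addc, Im_addc, Re_mulc, Im_mulc, Re_oppc, Im_oppc) /=.
  rewrite cosD sinD sinB.
  have -> : sin A * (sin B * cos A - cos B * sin A) = sin A * cos A * sin B - sin A ^+ 2 * cos B by ring.
  have -> : sin A ^+ 2 = 1 - cos A ^+ 2 by rewrite -hA; ring.
  have -> : cos A * cos A - sin A * sin A = 2 * cos A ^+ 2 - 1.
    have -> : sin A * sin A = 1 - cos A ^+ 2 by rewrite -hA; ring.
    by ring.
  by field.
by ring.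
Qed.

Lemma mult_arcpoly x : multiplier N (arcpoly x).
Proof.
apply: (multD zpow_perp_closed); last exact: mult_cst zpow_perp_closed.
apply: multM; first exact: mult_cst zpow_perp_closed.
by apply: (multD zpow_perp_closed); apply: multM; try exact: mult_zpow; exact: mult_cst zpow_perp_closed.
Qed.

Fixpoint arciter (x : R) n (z : C) : C :=
  if n is m.+1 then (2^-1 * (3 * arciter x m z - arciter x m z ^+ 3)) else arcpoly x z.

Lemma arciter_circle x n t : arciter x n (circle t) = (iter n signstep (arcval x t))%:C.
Proof.
elim: n => [|n IH] /=; first exact: arcpoly_circle.
rewrite IH /signstep [in RHS]rmorphM fmorphV rmorphB rmorphM rmorphXn /= !rmorph_nat.
by rewrite mulrC.
Qed.

Lemma multN (V : set (C -> C)) (phi : C -> C) : closed_subspace V -> multiplier V phi ->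
  multiplier V (fun z => - phi z).
Proof.
move=> cV m; have := multM (mult_cst (-1) cV) m.
by congr multiplier; apply/funext => z; rewrite mulN1r.
Qed.

Lemma mult_arciter x n : multiplier N (arciter x n).
Proof.
elim: n => [|n IH]; first exact: mult_arcpoly.
apply: (multM (mult_cst _ zpow_perp_closed)); apply: (multD zpow_perp_closed).
  exact: (multM (mult_cst _ zpow_perp_closed)).
by apply: (multN zpow_perp_closed); exact: multX zpow_perp_closed IH.
Qed.

Definition arcsign (x : R) (z : C) : C := (Num.sg (Re (arcpoly x z)))%:C.

Lemma exists_circle (z : C) : cabs z = 1 -> exists t : R, z = circle t.
Proof.
move=> z1; have h : Re z ^+ 2 + Im z ^+ 2 = 1 by rewrite -sqr_cabs z1 expr1n.
have r1 : -1 <= Re z <= 1 by have := sqr_ge0 (Im z); move=> i0; apply/andP; split; nra.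
have p0 : 2 * pi != 0 :> R by rewrite mulf_neq0 // gt_eqF ?pi_gt0.
have sE : sin (acos (Re z)) = `|Im z|.
  by rewrite sin_acos // -h addrAC subrr add0r sqrtr_sqr.
have [i0|i0] := leP 0 (Im z).
  exists (acos (Re z) / (2 * pi)); rewrite /circle mulrC divfK // acosK // sE.
  by rewrite ger0_norm //; exact: complex_ext.
exists (- acos (Re z) / (2 * pi)); rewrite /circle mulrC divfK // cosN sinN acosK // sE.
by rewrite ltr0_norm // opprK; exact: complex_ext.
Qed.

(** The functions orthogonal to all exponentials are stable under multiplication
   by trigonometric polynomials, hence under multiplication by their bounded
   pointwise limits. *)
Lemma mult_arcsign x : multiplier N (arcsign x).
Proof.
have onc z : cabs z = 1 -> exists s : R, [/\ -1 <= s <= 1, arcsign x z = (Num.sg s)%:C &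
    forall n, arciter x n z = (iter n signstep s)%:C].
  move=> /exists_circle[t ->]; exists (arcval x t); split; first exact: arcval_itv.
    by rewrite /arcsign arcpoly_circle.
  by move=> n; exact: arciter_circle.
apply: (mult_bounded_cvg (phi := arciter x) (M := 1) zpow_perp_closed (mult_arciter x)).
- move=> n z /onc[s [s1 _ ->]]; rewrite cabs_real ler_norml; exact: iter_signstep_itv.
- split; last exact: measurable_cst.
  apply: (measurable_fun_cvg (h := fun n t => Re (arciter x n (circle t)))).
    by move=> n; have [[]] := mult_arciter x n.
  move=> t _; rewrite /arcsign arcpoly_circle /=.
  under eq_cvg do rewrite arciter_circle /=.
  exact/cvg_iter_signstep/arcval_itv.
- by move=> z /onc[s [s1 -> _]]; rewrite cabs_real normr_sg; case: (_ != 0).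
- move=> z /onc[s [s1 -> sn]] _.
  have -> : (fun n => cabs ((Num.sg s)%:C - arciter x n z))
    = (fun n => `|Num.sg s - iter n signstep s|).
    by apply/funext => n; rewrite sn -rmorphB /= cabs_real.
  rewrite -[X in _ --> X](normr0 R) -(subrr (Num.sg s)); apply: cvg_norm.
  by apply: cvgB; [exact: cvg_cst|exact: cvg_iter_signstep].
Qed.


Lemma sg_arcval x t : 0 < x < 1 -> 0 < t < 1 -> Num.sg (arcval x t) = Num.sg (x - t).
Proof.
move=> /andP[x0 x1] /andP[t0 t1]; have p0 := pi_gt0 R.
have pos (y : R) : 0 < y < 1 -> 0 < sin (pi * y).
  by move=> /andP[y0 y1]; apply: sin_gt0_pi; rewrite mulr_gt0 //= gtr_pMr.
rewrite /arcval sgrM gtr0_sg ?pos ?t0 // mul1r.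
have [h|h|h] := ltrgt0P (x - t).
- by rewrite !gtr0_sg //; apply: pos; rewrite h /=; lra.
- have h1 : 0 < t - x by lra.
  have h2 : 0 < sin (pi * (t - x)) by apply: pos; apply/andP; split; lra.
  rewrite (_ : x - t = - (t - x)); last by ring.
  by rewrite mulrN sinN !sgrN (gtr0_sg h1) (gtr0_sg h2).
- by rewrite h mulr0 sin0.
Qed.

(** Testing against indicators of arcs: [(1 + arcsign x) / 2] is, up to two
   points, the indicator of the arc of angles in [0, 2 pi x]. *)
Lemma integral_arc_eq0 f x : N f -> 0 < x < 1 ->
  Rintegral mu `[0, x] (fun t => Re (f (circle t))) = 0 /\
  Rintegral mu `[0, x] (fun t => Im (f (circle t))) = 0.
Proof.
move=> fN x01; have fL := subspL2 zpow_perp_closed fN; have mf := L2_measurable fL.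
pose chi (z : C) : C := 2^-1 * (1 + arcsign x z).
have mchi : multiplier N chi.
  apply: (multM (mult_cst _ zpow_perp_closed)); apply: (multD zpow_perp_closed (mult_cst _ zpow_perp_closed)); exact: mult_arcsign.
have [cchi _ hchi] := mchi.
have [gL g0] := hchi _ fN.
have I0 : circle_int (fun z => chi z * f z) = 0.
  rewrite -(g0 0); apply: circle_int_eq => z z1.
  by rewrite /zpow expr0z rmorph1 mulr1.
have chiE t : t \in `[0, 1] -> t <> 0 -> t <> 1 -> t <> x ->
    chi (circle t) = (\1_(`[0, x]%classic) t)%:C.
  rewrite in_itv /= => /andP[t0 t1] /eqP n0 /eqP n1 /eqP nx.
  have t01 : 0 < t < 1 by rewrite !lt_neqAle eq_sym n0 t0 n1 t1.
  rewrite /chi /arcsign arcpoly_circle /= sg_arcval // indicE.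
  have two : (2 : C) = (2 : R)%:C by rewrite rmorph_nat.
  have [h|h] := ltP t x.
    rewrite gtr0_sg ?subr_gt0 // mem_set /=; last by rewrite in_itv /= t0 ltW.
    by rewrite (_ : 1%:C = 1) // mulVf.
  have {}h : x < t by rewrite lt_neqAle eq_sym nx.
  rewrite ltr0_sg ?subr_lt0 // memNset /=; last by rewrite in_itv /= => /andP[_]; rewrite leNgt h.
  by rewrite rmorphN rmorph1 subrr mulr0.
have xI : `[0, x]%classic `<=` I01.
  by move=> t /=; rewrite !in_itv /= => /andP[-> h]; case/andP: x01 => _ x1 /=; apply: (le_trans h); exact: ltW.
have ext (h : R -> R) (H : R -> R) : measurable_fun I01 h -> measurable_fun I01 H ->
    (forall t, chi (circle t) = (\1_(`[0, x]%classic) t)%:C -> H t = h t * \1_(`[0, x]%classic) t) ->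
    Rintegral mu I01 H = Rintegral mu `[0, x] h.
  move=> mh mH hH.
  have -> : `[0, x]%classic = I01 `&` `[0, x]%classic by rewrite setIidr.
  have patchM : h \_ `[0, x]%classic = (fun t => h t * \1_(`[0, x]%classic) t).
    by apply/funext => t; rewrite patchE indicE; case: ifP; rewrite ?mulr1 ?mulr0.
  rewrite Rintegral_mkcondr patchM; apply: ae_eq_rint => //.
    by apply: measurable_funM => //; exact: measurable_indic.
  have := ae_neq x; have := ae_neq (1 : R); have := ae_neq (0 : R).
  apply: filterS3; first exact: (ae_filter_ringOfSetsType mu).
  by move=> t n0 n1 nx It; apply: hH; exact: chiE.
move: I0; rewrite /circle_int => -[i1 i2]; split.
  apply: (etrans _ i1); apply: esym; apply: ext; [by case: mf|by case: (L2_measurable gL)|].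
  by move=> t e; rewrite e Re_mulc /= mul0r subr0 mulrC.
apply: (etrans _ i2); apply: esym; apply: ext; [by case: mf|by case: (L2_measurable gL)|].
by move=> t e; rewrite e Im_mulc /= mul0r addr0 mulrC.
Qed.

(** Lebesgue's differentiation theorem. *)
Lemma ae_eq0_of_integrals (h : R -> R) : integrable01 h ->
  (forall x, 0 < x < 1 -> Rintegral mu `[0, x] h = 0) ->
  {ae mu, forall t, t \in `[0, 1] -> h t = 0}.
Proof.
move=> ih H; have loc := integrable_locally (@measurable_I01 R) ih.
have int y : mu.-integrable `[0, y] (EFin \o (h \_ I01)).
  have iT : mu.-integrable setT (EFin \o (h \_ I01)).
    by rewrite -restrict_EFin; exact: (integrable_mkcond _ (@measurable_I01 R)).1 ih.
  by apply: integrableS iT => //; exact: measurable_itv.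
have := FTC1 int loc; have := ae_neq (0 : R); have := ae_neq (1 : R).
apply: filterS3; first exact: (ae_filter_ringOfSetsType mu).
move=> t n1 n0 D; rewrite in_itv /= => /andP[t0 t1].
have tp : 0 < t by rewrite lt_neqAle t0 andbT eq_sym; apply/eqP.
have tl : t < 1 by rewrite lt_neqAle t1 andbT; apply/eqP.
have [] := D _; first by [].
rewrite patchE mem_set /=; last by rewrite in_itv /= t0 t1.
move=> _ <-; rewrite derive1E.
have nz : \near t, Rintegral mu `[0, t] (h \_ I01) = cst 0 t.
  near=> u.
  have u01 : 0 < u < 1 by apply/andP; split; near: u; [exact: lt_nbhsr|exact: lt_nbhsl].
  apply: (etrans _ (H u u01)); apply: eq_Rintegral => s; rewrite inE /= in_itv /= => /andP[s0 su].
  rewrite /patch mem_set //= in_itv /= s0 (le_trans su) //.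
  by case/andP: u01 => _ /ltW.
rewrite (near_eq_derive _ nz); exact: derive_cst.
Unshelve. all: by end_near. Qed.

(** The real and imaginary parts of [f] have integral 0 over every initial arc. *)
Theorem zpow_total f : N f -> ae_eq_circle f (fun=> 0).
Proof.
move=> fN; have fL := subspL2 zpow_perp_closed fN.
have oneL : L2 (fun=> 1 : C) by apply: (L2_bounded (M := 1)); [exact: measurable_circle_cst|move=> z _; rewrite cabs1].
have [i1 i2] : circle_integrable f.
  have := circle_integrable_dot fL oneL; rewrite (_ : (fun z => f z * 1^*) = f) //.
  by apply/funext => z; rewrite rmorph1 mulr1.
have h1 := ae_eq0_of_integrals i1 (fun x x01 => (integral_arc_eq0 fN x01).1).
have h2 := ae_eq0_of_integrals i2 (fun x x01 => (integral_arc_eq0 fN x01).2).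
move: h1 h2; apply: filterS2; first exact: (ae_filter_ringOfSetsType mu).
move=> t a b It; apply: complex_ext; [exact: a|exact: b].
Qed.

End TrigonometricCompleteness.

(** * The Hardy space *)

Section HardySpace.
Variable R : realType.
Local Notation C := R[i].
Implicit Types (f g h : C -> C) (c : C) (q : {poly C}) (n : nat).

Lemma H2_energy f : H2 f <-> L2 f /\ forall e : R, 0 < e -> exists q,
  energy (fun z => f z - q.[z]) < e.
Proof.
split=> [[fL H]|[fL H]]; split=> // e e0.
  have s0 : 0 < Num.sqrt e by rewrite sqrtr_gt0.
  have [q /(normL2_lt _ s0)] := H _ s0; rewrite sqr_sqrtr ?ltW // => qe.
  by exists q.
have [q qe] := H (e ^+ 2) (exprn_gt0 2 e0); exists q; exact/(normL2_lt _ e0).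
Qed.

Lemma measurable_circle_poly q : measurable_circle (fun z => q.[z]).
Proof.
elim/poly_ind: q => [|q c IH].
  by rewrite (_ : (fun z => _) = fun=> 0); [exact: measurable_circle_cst|apply/funext => z; rewrite horner0].
rewrite (_ : (fun z => _) = fun z => q.[z] * z + c); last first.
  by apply/funext => z; rewrite !hornerE.
by apply: measurable_circleD; [apply: measurable_circleM => //; exact: measurable_circle_id|exact: measurable_circle_cst].
Qed.

Lemma L2_poly q : L2 (fun z => q.[z]).
Proof.
have [M HM] : exists M : R, forall z, cabs z = 1 -> cabs q.[z] <= M.
  elim/poly_ind: q => [|q c [M HM]]; first by exists 0 => z _; rewrite horner0 cabs0.
  exists (M + cabs c) => z z1; rewrite !hornerE; apply: (le_trans (cabsD _ _)).
  by rewrite lerD2r cabsM z1 mulr1; exact: HM.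
by apply: L2_bounded HM; exact: measurable_circle_poly.
Qed.

Lemma H2_closed : closed_subspace (@H2 R).
Proof.
split.
- by move=> f [].
- apply/H2_energy; split; first exact: L2_0.
  move=> e e0; exists 0; rewrite (_ : (fun z => _) = fun=> 0) ?energy0 //.
  by apply/funext => z; rewrite horner0 subr0.
- move=> c f g /H2_energy[fL Hf] /H2_energy[gL Hg]; apply/H2_energy.
  split; first by apply: L2D => //; exact: L2Z.
  move=> e e0.
  have c0 : 0 < 4 * (cabs c ^+ 2 + 1) by rewrite mulr_gt0 // ltr_wpDl ?sqr_ge0.
  have [q1 h1] := Hf _ (divr_gt0 e0 c0).
  have e4 : 0 < e / 4 by rewrite divr_gt0.
  have [q2 h2] := Hg _ e4.
  exists (c *: q1 + q2).
  have f1L := L2B fL (L2_poly q1); have g1L := L2B gL (L2_poly q2).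
  rewrite (_ : (fun z => _) = fun z => c * (f z - q1.[z]) + (g z - q2.[z])); last first.
    by apply/funext => z; rewrite hornerD hornerZ; ring.
  apply: (le_lt_trans (energyD_le (L2Z c f1L) g1L)); rewrite energyZ //.
  have k : cabs c ^+ 2 * energy (fun z => f z - q1.[z]) <= e / 4.
    apply: (@le_trans _ _ (cabs c ^+ 2 * (e / (4 * (cabs c ^+ 2 + 1))))).
      by rewrite ler_wpM2l ?sqr_ge0 // ltW.
    rewrite mulrA ler_pdivrMr //; have := sqr_ge0 (cabs c); nra.
  lra.
- move=> f fL H; apply/H2_energy; split=> // e e0.
  have e4 : 0 < e / 4 by rewrite divr_gt0.
  have [g /H2_energy[gL Hg] fg] := H _ e4.
  have [q gq] := Hg _ e4; exists q.
  rewrite (_ : (fun z => _) = fun z => (f z - g z) + (g z - q.[z])); last first.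
    by apply/funext => z; ring.
  apply: (le_lt_trans (energyD_le (L2B fL gL) (L2B gL (L2_poly q)))); lra.
Qed.

Lemma H2_poly q : H2 (fun z => q.[z]).
Proof.
apply/H2_energy; split; first exact: L2_poly.
move=> e e0; exists q; rewrite (_ : (fun z => _) = fun=> 0) ?energy0 //.
by apply/funext => z; rewrite subrr.
Qed.

Lemma H2_zpow n : H2 (zpow n : C -> C).
Proof.
have := H2_poly 'X^n; congr H2; apply/funext => z.
by rewrite hornerXn.
Qed.

(** Polynomials are combinations of the [z ^ n], n >= 0, so it suffices to test
   orthogonality against these. *)
Lemma dot_poly0 g : L2 g -> (forall n, dotL2 (zpow n) g = 0) ->
  forall q, dotL2 (fun z => q.[z]) g = 0.
Proof.
move=> gL g0 q.
suff H n : dotL2 (fun z => z ^+ n * q.[z]) g = 0.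
  by rewrite -(H 0%N); congr dotL2; apply/funext => z; rewrite expr0 mul1r.
elim/poly_ind: q n => [|q c IH] n.
  rewrite (_ : (fun z => _) = fun z => 0 * zpow n z); last first.
    by apply/funext => z; rewrite horner0 mulr0 mul0r.
  by rewrite dotZl ?mul0r //; exact: zpowL.
have L1 : L2 (fun z => z ^+ n.+1 * q.[z]).
  by have := L2_poly ('X^(n.+1) * q); congr L2; apply/funext => z; rewrite !hornerE.
rewrite (_ : (fun z => _) = fun z => z ^+ n.+1 * q.[z] + c * zpow n z); last first.
  by apply/funext => z; rewrite !hornerE exprSr /zpow -exprnP; ring.
rewrite dotDl ?dotZl ?IH ?g0 ?mulr0 ?addr0 //; try exact: zpowL.
by apply: L2Z; exact: zpowL.
Qed.

Lemma H2_orthogonal g : L2 g -> (forall n, dotL2 (zpow n) g = 0) ->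
  forall f, H2 f -> dotL2 f g = 0.
Proof.
move=> gL g0 f /H2_energy[fL Hf]; apply: dot_limit => // e e0.
have [q fq] := Hf e e0; exists (fun z => q.[z]).
by split=> //; [exact: L2_poly|exact: dot_poly0].
Qed.

Lemma dot0C f g : L2 f -> L2 g -> dotL2 f g = 0 -> dotL2 g f = 0.
Proof. by move=> fL gL e; rewrite dotC // e rmorph0. Qed.

Lemma H2perpE g : H2perp g <-> L2 g /\ forall n, dotL2 g (zpow n) = 0.
Proof.
split=> [[gL H]|[gL H]]; split=> //; first by move=> n; apply: H; exact: H2_zpow.
move=> h hH; have hL : L2 h by case: hH.
apply: dot0C => //; apply: (H2_orthogonal gL) hH => n.
by apply: dot0C => //; exact: zpowL.
Qed.

Lemma H2perp_closed : closed_subspace (@H2perp R).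
Proof.
have := orthogonal_closed (fun n : nat => zpowL R n); congr closed_subspace.
by apply/funext => g; apply/propext; rewrite H2perpE.
Qed.

Lemma H2_dot_neg f n : H2 f -> dotL2 f (zpow (- n.+1%:Z)) = 0.
Proof. by apply: H2_orthogonal => [|m]; [exact: zpowL|apply: dot_zpow]. Qed.

Lemma H2_projection f : L2 f -> exists2 g, H2 g & H2perp (fun z => f z - g z).
Proof.
move=> fL; have [g gH g0] := orthogonal_projection H2_closed fL; exists g => //.
split=> //; apply: L2B => //; exact: (subspL2 H2_closed).
Qed.

(** If the Fourier coefficients of negative index of [f] vanish, the difference
   between [f] and its projection to H^2 is orthogonal to every exponential, so
   it is 0 by [zpow_total]. *)
Lemma H2_char f : H2 f <-> L2 f /\ forall n, dotL2 f (zpow (- n.+1%:Z)) = 0.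
Proof.
split=> [fH|[fL f0]]; first by split; [case: fH|move=> n; exact: H2_dot_neg].
have [g gH /H2perpE[dL d0]] := H2_projection fL.
have gL : L2 g by case: gH.
have e : ae_eq_circle (fun z => f z - g z) (fun=> 0).
  apply: zpow_total; split=> // -[n|n]; first exact: d0.
  by rewrite NegzE dotBl ?f0 ?H2_dot_neg ?subrr //; exact: zpowL.
by apply: (subsp_ae H2_closed fL gH); apply: circle_ae_mono e => z _ /subr0_eq.
Qed.

Lemma hardy_projP f : L2 f -> H2 (hardy_proj f) /\ H2perp (fun z => f z - hardy_proj f z).
Proof.
move=> fL; have [g gH gp] := H2_projection fL.
by rewrite /hardy_proj; case: xgetP => [h -> []//|/(_ g)[]]; split.
Qed.

(** [hardy_proj] chooses a representative, so nothing more than equality almost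
   everywhere can be said. *)
Lemma hardy_proj_id f : H2 f -> ae_eq_circle (hardy_proj f) f.
Proof.
move=> fH; have fL : L2 f by case: fH.
have [pH [dL d0]] := hardy_projP fL.
have e0 : energy (fun z => f z - hardy_proj f z) = 0.
  by apply: complexI; rewrite -dotff d0 //; apply: (subspB H2_closed).
by apply: circle_ae_mono (energy_eq0 dL e0) => z _ /subr0_eq.
Qed.

End HardySpace.

(** * The singular inner function and the Blaschke product as multipliers *)

Section InnerMultipliers.
Variable R : realType.
Local Notation C := R[i].
Implicit Types (f g h : C -> C) (c z : C) (n : nat).

(** Multiplication by [z] shifts the Fourier coefficients. *)
Lemma mult_id : multiplier (@H2 R) id.
Proof.
split; [exact: measurable_circle_id|by exists 1 => z ->|].
move=> f /H2_char[fL f0]; apply/H2_char; split.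
  by apply: (L2_mulb (M := 1)) => //; [exact: measurable_circle_id|move=> z ->].
move=> n; rewrite -(f0 n.+1); apply: dot_eq => z z1.
rewrite !zpowJ // !opprK (_ : n.+2%:Z = 1 + n.+1%:Z) // zpowD //.
by rewrite {2}/zpow expr1z; ring.
Qed.

(** The geometric series: [1 / (1 - phi)] is a bounded limit of multipliers. *)
Lemma mult_geometric (V : set (C -> C)) (phi : C -> C) (r : R) : closed_subspace V ->
  multiplier V phi -> (forall z, cabs z = 1 -> cabs (phi z) <= r) -> r < 1 ->
  multiplier V (fun z => (1 - phi z)^-1).
Proof.
move=> cV mphi phir r1; have [cphi _ _] := mphi.
have ns z : cabs z = 1 -> 1 - r <= cabs (1 - phi z).
  move=> z1; have := cabsD (1 - phi z) (phi z); rewrite subrK cabs1.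
  have := phir _ z1; lra.
have r0 : 0 <= r by apply: le_trans (phir 1 (@cabs1 R)); exact: cabs_ge0.
have geomE n z : cabs z = 1 -> \sum_(k < n) phi z ^+ k = (1 - phi z ^+ n) / (1 - phi z).
  move=> z1; have d : 1 - phi z != 0 by rewrite -cabs_gt0; have := ns _ z1; lra.
  apply: (@mulIf _ _ d); rewrite mulfVK // mulrC -[1 - phi z ^+ n]opprB subrX1.
  by rewrite -mulNr opprB.
apply: (mult_bounded_cvg (phi := fun n z => \sum_(k < n) phi z ^+ k) (M := 2 / (1 - r)) cV).
- elim=> [|n IH].
    rewrite (_ : (fun z => _) = fun=> 0); first exact: mult_cst.
    by apply/funext => z; rewrite big_ord0.
  rewrite (_ : (fun z => _) = fun z => \sum_(k < n) phi z ^+ k + phi z ^+ n); last first.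
    by apply/funext => z; rewrite big_ord_recr.
  by apply: (multD cV IH); exact: multX.
- move=> n z z1; rewrite geomE // cabsM cabsV; have h := ns _ z1.
  apply: ler_pM; rewrite ?invr_ge0 ?cabs_ge0 //.
    apply: (le_trans (cabsD _ _)); rewrite cabs1 cabsN cabsX.
    have : cabs (phi z) ^+ n <= 1 by rewrite exprn_ile1 ?cabs_ge0 // (le_trans (phir _ z1)) // ltW.
    lra.
  by rewrite lef_pV2 ?posrE //; lra.
- by apply: measurable_circleV; apply: measurable_circleB => //; exact: measurable_circle_cst.
- move=> z z1; rewrite cabsV -[leLHS]mul1r; have h := ns _ z1.
  by apply: ler_pM; rewrite ?invr_ge0 ?cabs_ge0 ?ler1n // lef_pV2 ?posrE //; lra.
- move=> z z1 _; have h := ns _ z1.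
  have q : `|r| < 1 by rewrite ger0_norm.
  have d : 1 - phi z != 0 by rewrite -cabs_gt0; lra.
  apply: (squeeze_cvgr (f := fun=> 0 : R) (h := geometric ((1 - r)^-1) r)); last 2 first.
  - exact: cvg_cst.
  - exact: cvg_geometric.
  near=> n; rewrite cabs_ge0 /= geomE //.
  have -> : (1 - phi z)^-1 - (1 - phi z ^+ n) / (1 - phi z) = phi z ^+ n / (1 - phi z) by field.
  rewrite cabsM cabsV cabsX mulrC; apply: ler_pM; rewrite ?invr_ge0 ?exprn_ge0 ?cabs_ge0 //.
    by rewrite lef_pV2 ?posrE //; lra.
  by rewrite lerXn2r ?nnegrE ?cabs_ge0 // phir.
Unshelve. all: by end_near. Qed.

Variable p : nat.
Hypothesis p_gt1 : (1 < p)%N.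
Local Notation L := (ln (p%:R : R)).
Local Notation S := (@singinner R p).
Local Notation a := ((invsqrtp R p)%:C).

(** The resolvent [1 / (1 - e w)], [w = cayley z], e > 0: since [Re w = 0] on the
   circle it is bounded by 1, and it is a Moebius map with its pole outside the
   closed disk. *)
Definition resolvent (e : R) (z : C) : C :=
  (1 - z) * (((1 + e)^-1)%:C * (1 - ((1 - e) / (1 + e))%:C * z)^-1).

Lemma mult_resolvent e : 0 < e -> multiplier (@H2 R) (resolvent e).
Proof.
move=> e0; have cV := @H2_closed R.
have d0 : 0 < 1 + e by lra.
have m1 : multiplier (@H2 R) (fun z => 1 - z).
  by apply: (multD cV (mult_cst 1 cV)); apply: multN cV mult_id.
apply: (multM m1); apply: (multM (mult_cst _ cV)).
have mq : multiplier (@H2 R) (fun z => ((1 - e) / (1 + e))%:C * z).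
  by apply: (multM (mult_cst _ cV)); exact: mult_id.
apply: (mult_geometric (r := `|(1 - e) / (1 + e)|) cV mq).
  by move=> z z1; rewrite cabsM z1 mulr1 cabs_real.
rewrite normrM normfV (gtr0_norm d0) ltr_pdivrMr // mul1r.
by rewrite ltr_norml; apply/andP; split; lra.
Qed.

Lemma resolventE e z : 0 < e -> cabs z = 1 -> z != 1 ->
  resolvent e z = (1 - e%:C * cayley z)^-1.
Proof.
move=> e0 z1 n1; have zd : z - 1 != 0 by rewrite subr_eq0.
have d0 : 1 + e != 0 by rewrite gt_eqF //; lra.
have dC : 1 + e%:C != 0 :> C.
  have <- : (1 + e)%:C = 1 + e%:C :> C by rewrite rmorphD rmorph1.
  by apply/eqP => /(@complexI R) h; rewrite h eqxx in d0.
have wd : 1 - e%:C * cayley z != 0.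
  apply/eqP => /(congr1 (@complex.Re R)).
  rewrite Re_addc Re_oppc Re_mulc (Re_cayley_circle z1) /= mulr0 mul0r subrr subr0.
  by move=> h; move: (oner_neq0 R); rewrite h eqxx.
rewrite /resolvent fmorphV rmorphM fmorphV rmorphD rmorphB rmorph1 /=.
have k : (1 - e%:C * cayley z) * (z - 1) = - (1 + e%:C) * (1 - (1 - e%:C) / (1 + e%:C) * z).
  by rewrite /cayley; field; rewrite dC zd.
have k0 : 1 - (1 - e%:C) / (1 + e%:C) * z != 0.
  by apply: contraNneq (mulf_neq0 wd zd) => h; rewrite k h mulr0.
apply: (@mulIf _ _ (mulf_neq0 wd zd)); rewrite [RHS]mulrA mulVf // mul1r k.
move: (1 - _ * z) k0 => q q0; field.
by rewrite q0 dC.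
Qed.

Lemma resolvent_bound e z : 0 < e -> cabs z = 1 -> cabs (resolvent e z) <= 1.
Proof.
move=> e0 z1; have [->|n1] := eqVneq z 1.
  by rewrite /resolvent subrr mul0r cabs0.
rewrite resolventE // cabsV invf_le1.
  apply: le_trans (normRe_cabs _).
  rewrite Re_addc Re_oppc Re_mulc (Re_cayley_circle z1) /= mulr0 mul0r subrr subr0.
  exact: ler_norm.
rewrite cabs_gt0; apply/eqP => /(congr1 (@complex.Re R)).
rewrite Re_addc Re_oppc Re_mulc (Re_cayley_circle z1) /= mulr0 mul0r subrr subr0.
by move=> h; move: (oner_neq0 R); rewrite h eqxx.
Qed.

(** The singular inner function [exp (L w)] is the limit of the powers
   [(1 - L w / m)^-m] of resolvents, all bounded by 1 on the circle. *)
Lemma mult_singinner : multiplier (@H2 R) S.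
Proof.
have cV := @H2_closed R; have l0 := lnp_gt0 R p_gt1.
have e0 n : 0 < L / n.+1%:R by rewrite divr_gt0.
apply: (mult_bounded_cvg (phi := fun n z => resolvent (L / n.+1%:R) z ^+ n.+1) (M := 1) cV).
- by move=> n; apply: multX => //; exact: mult_resolvent.
- by move=> n z z1; rewrite cabsX exprn_ile1 ?cabs_ge0 //; exact: resolvent_bound.
- exact: measurable_circle_singinner.
- by move=> z z1; rewrite cabs_singinner_circle.
move=> z z1 n1; set x := - (cayley z * L%:C).
have h := @cvg_pow_cexp R x.
have hi : ((1 + x / n.+1%:R) ^+ n.+1)^-1 @[n --> \oo] --> (S z : Cplx R).
  rewrite (_ : S z = (cexp x)^-1); last by rewrite /x cexpN invrK.
  have FF : Filter (\oo : set_system nat) by typeclasses eauto.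
  exact: (@cvgV (Cplx R) nat \oo FF (fun n => (1 + x / n.+1%:R) ^+ n.+1) (cexp x) (cexp_neq0 x) h).
have -> : (fun n => cabs (S z - resolvent (L / n.+1%:R) z ^+ n.+1))
  = (fun n => cabs (((1 + x / n.+1%:R) ^+ n.+1)^-1 - S z)).
  apply/funext => n; rewrite cabsBC; congr (cabs (_ - _)).
  rewrite resolventE // exprVn; congr (_ ^+ _)^-1.
  congr (_ + _); rewrite /x mulNr; congr (- _).
  by rewrite rmorphM fmorphV rmorph_nat /=; ring.
exact: (cvg_cabsP _ _).1 hi.
Qed.

Lemma mult_frostman : multiplier (@H2 R) (frostman p).
Proof.
have cV := @H2_closed R; have mS := mult_singinner.
have /andP[a0 a1] := invsqrtp_bound R p_gt1.
have maS := multM (mult_cst a cV) mS.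
apply: multM; first by apply: (multD cV (mult_cst a cV)); exact: multN cV mS.
apply: (mult_geometric (r := invsqrtp R p) cV maS) => // z z1.
by rewrite cabsM cabs_singinner_circle // mulr1 cabs_real gtr0_norm.
Qed.

End InnerMultipliers.

(** * The reflection of the circle and the involution J *)

Section Reflection.
Variable R : realType.
Local Notation C := R[i].
Local Notation mu := (@lebesgue_measure R).
Local Notation I01 := (`[0%R, 1%R]%classic : set R).

Definition refl01 (t : measurableTypeR R) : measurableTypeR R := (1 - t : R).

Lemma measurable_refl01 : measurable_fun setT refl01.
Proof. by apply: measurable_funB; [exact: measurable_cst|exact: measurable_id]. Qed.

HB.instance Definition _ := isMeasurableFun.Build _ _ _ _ refl01 measurable_refl01.

(** It suffices to compare the two measures on intervals. *)
Lemma lebesgue_refl01 (A : set (measurableTypeR R)) : measurable A ->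
  mu A = pushforward mu refl01 A.
Proof.
apply: lebesgue_measure_unique => _ [[a b] _ <-] /=.
rewrite /pushforward.
have -> : refl01 @^-1` `]a, b]%classic = `[1 - b, 1 - a[%classic.
  by apply/seteqP; split => t /=; rewrite !in_itv /= /refl01 => /andP[h1 h2]; apply/andP; split; lra.
rewrite !lebesgue_measure_itv /= !lte_fin ltrD2l ltrN2.
by case: ifP => // _; rewrite -!EFinD; congr (_%:E); ring.
Qed.

Lemma refl01_I : refl01 @^-1` I01 = I01.
Proof.
by apply/seteqP; split => t /=; rewrite !in_itv /= /refl01 => /andP[h1 h2]; apply/andP; split; lra.
Qed.

Lemma ge0_integral_refl (F : R -> \bar R) : measurable_fun I01 F -> (forall t, (0 <= F t)%E) ->
  (\int[mu]_(t in I01) F (1 - t)%R = \int[mu]_(t in I01) F t)%E.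
Proof.
move=> mF F0; have := ge0_integral_pushforward measurable_refl01 mu (@measurable_I01 R) mF (fun t _ => F0 t).
rewrite refl01_I => <-; apply: eq_measure_integral => A mA _.
exact/esym/lebesgue_refl01.
Qed.

Lemma measurable_refl (d : measure_display) (T : measurableType d) (h : R -> T) :
  measurable_fun I01 h -> measurable_fun I01 (fun t => h (1 - t)).
Proof.
move=> mh; apply: (measurable_comp (@measurable_I01 R) _ mh (g := refl01)).
  by move=> _ [t It <-]; move: It; rewrite -{1}refl01_I.
exact: measurable_funTS measurable_refl01.
Qed.

Lemma Rintegral_refl (h : R -> R) : measurable_fun I01 h ->
  Rintegral mu I01 (fun t => h (1 - t)) = Rintegral mu I01 h.
Proof.
move=> mh; have mE : measurable_fun I01 (EFin \o h) by exact/measurable_EFinP.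
rewrite /Rintegral [in LHS]integralE [in RHS]integralE.
have e1 := ge0_integral_refl (measurable_funepos mE) (fun t => funepos_ge0 _ _).
have e2 := ge0_integral_refl (measurable_funeneg mE) (fun t => funeneg_ge0 _ _).
congr (fine (_ - _)%E).
  by apply: etrans e1; apply: eq_integral => t _; rewrite !funeposE.
by apply: etrans e2; apply: eq_integral => t _; rewrite !funenegE.
Qed.

Lemma ae_refl (P : R -> Prop) : {ae mu, forall t, t \in `[0, 1] -> P t} ->
  {ae mu, forall t, t \in `[0, 1] -> P (1 - t)}.
Proof.
move=> [A [mA A0 sub]]; exists (refl01 @^-1` A); split.
- by rewrite -[X in measurable X]setTI; exact: measurable_refl01.
- by apply: (etrans (esym (lebesgue_refl01 mA))).
- move=> t /= nP; apply: sub => /= H; apply: nP => It; apply: H.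
  by move: It; rewrite !in_itv /= /refl01 => /andP[h1 h2]; apply/andP; split; lra.
Qed.


Implicit Types (f g h : C -> C) (c z : C).

Lemma circle_refl (t : R) : circle (1 - t) = (circle t)^-1 :> C.
Proof.
rewrite -conj_circle ?cabs_circle // !circleE -cexpJ.
have -> : 0 +i* (2 * pi * (1 - t)) = (0 +i* (2 * pi * t))^* + 0 +i* (2 * pi) :> C.
  by apply: complex_ext; rewrite ?Re_addc ?Im_addc ?Re_conjc ?Im_conjc /=; ring.
rewrite cexpD (_ : cexp (0 +i* (2 * pi)) = 1) ?mulr1 // cexp_im.
by rewrite (_ : 2 * pi = pi *+ 2) ?mulr_natl // cos2pi sin2pi.
Qed.

Lemma measurable_circle_inv f : measurable_circle f -> measurable_circle (fun z => f z^-1).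
Proof.
move=> [m1 m2]; split.
  under [X in measurable_fun _ X]eq_fun do rewrite -circle_refl.
  exact: (measurable_refl m1).
under [X in measurable_fun _ X]eq_fun do rewrite -circle_refl.
exact: (measurable_refl m2).
Qed.

Lemma circle_int_inv f : measurable_circle f -> circle_int (fun z => f z^-1) = circle_int f.
Proof.
move=> [m1 m2]; rewrite /circle_int -(Rintegral_refl m1) -(Rintegral_refl m2).
by congr (_ +i* _); apply: eq_Rintegral => t _; rewrite circle_refl.
Qed.

Lemma circle_ae_inv (P : C -> Prop) : circle_ae P -> circle_ae (fun z => P z^-1).
Proof.
by move=> /ae_refl; apply: ae_I_mono => t _; rewrite circle_refl.
Qed.

End Reflection.

Section UnitaryInvolution.
Variable R : realType.
Local Notation C := R[i].
Implicit Types (f g h : C -> C) (c z : C) (n : nat).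
Local Notation J := (@J R).

Lemma cabs_inv_circle z : cabs z = 1 -> cabs z^-1 = 1.
Proof. by move=> z1; rewrite cabsV z1 invr1. Qed.

Lemma measurable_circle_J f : measurable_circle f -> measurable_circle (J f).
Proof. by move=> mf; apply: measurable_circleM; [apply: measurable_circleV; exact: measurable_circle_id|exact: measurable_circle_inv]. Qed.

Lemma L2_J f : L2 f -> L2 (J f).
Proof.
move=> /L2P[mf fi]; have mJ := measurable_circle_J mf; apply/L2P; split=> //.
apply/(integrable01_ge0P (measurable_sqnorm mJ)); first by move=> t; exact: sqr_ge0.
have mE : measurable_fun (`[0%R, 1%R]%classic : set R) (EFin \o sqnorm f).
  by apply/measurable_EFinP; exact: measurable_sqnorm.
have e := ge0_integral_refl mE (fun t => sqr_ge0 (cabs (f (circle t)))).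
have := (integrable01_ge0P (measurable_sqnorm mf) (fun t => sqr_ge0 (cabs (f (circle t))))).1 fi.
rewrite -[X in (X < _)%E -> _]e; congr (_ < _)%E; apply: eq_integral => t _.
by rewrite /= /sqnorm circle_refl /Defs.J cabsM cabsV cabs_circle invr1 mul1r.
Qed.

Lemma J_ae f g : ae_eq_circle f g -> ae_eq_circle (J f) (J g).
Proof. by move=> /circle_ae_inv; apply: circle_ae_mono => z z1; rewrite /Defs.J => ->. Qed.

Lemma dot_J f g : measurable_circle f -> measurable_circle g -> dotL2 (J f) (J g) = dotL2 f g.
Proof.
move=> mf mg; rewrite /dotL2 -(circle_int_inv (f := fun z => f z * (g z)^*)).
  apply: circle_int_eq => z z1; rewrite /Defs.J rmorphM /= (conj_circle (cabs_inv_circle z1)) invrK.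
  by rewrite mulrACA mulVf ?circle_neq0 // mul1r.
by apply: measurable_circleM => //; exact: measurable_circleJ.
Qed.

Lemma J_involutive f : ae_eq_circle (J (J f)) f.
Proof.
apply: circle_ae_neq1 => z z1 _.
by rewrite /Defs.J invrK mulrA mulVf ?circle_neq0 // mul1r.
Qed.

Lemma J_unitary : unitary_involution J.
Proof.
split.
- exact: L2_J.
- by move=> f g _ _; exact: J_ae.
- move=> c f g _ _; apply: circle_ae_neq1 => z z1 _; rewrite /Defs.J; ring.
- by move=> f g fL gL; apply: dot_J; exact: L2_measurable.
- by move=> f _; exact: J_involutive.
Qed.

Lemma J_zpow (k : int) z : cabs z = 1 -> J (zpow k) z = zpow (- (k + 1)) z.
Proof.
move=> z1; rewrite opprD addrC zpowD // /zpow exprN1 -exprz_inv.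
by [].
Qed.

(** [J] exchanges the exponentials of index [k] and [- (k + 1)], that is those of
   index at least 0 and those of negative index. *)
Lemma H2_J f : H2 f -> H2perp (J f).
Proof.
move=> fH; have fL : L2 f by case: fH.
apply/H2perpE; split; first exact: L2_J.
move=> n; rewrite -(H2_dot_neg n fH) -(dot_J (L2_measurable fL) (measurable_circle_zpow R (- n.+1%:Z))).
apply: dot_eq => z z1; rewrite J_zpow //; congr (_ * (zpow _ _)^*); lia.
Qed.

Lemma H2perp_J f : H2perp f -> H2 (J f).
Proof.
move=> /H2perpE[fL f0]; apply/H2_char; split; first exact: L2_J.
move=> n; rewrite -(f0 n) -(dot_J (L2_measurable fL) (measurable_circle_zpow R n)).
apply: dot_eq => z z1; rewrite J_zpow //; congr (_ * (zpow _ _)^*); lia.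
Qed.


End UnitaryInvolution.

(** * Kernel and cokernel of the Hankel operator *)

Section HankelKernel.
Variables (R : realType) (p : nat).
Hypothesis p_gt1 : (1 < p)%N.
Local Notation C := R[i].
Implicit Types (f g h : C -> C) (c z : C) (n : nat).
Local Notation S := (@singinner R p).
Local Notation a := ((invsqrtp R p)%:C).
Local Notation b := (@frostman R p).
Local Notation k := (@kappa R p).
Local Notation B := (blaschke (xseq R p)).

Lemma cabs_kappa_circle z : cabs z = 1 -> cabs (k z) = 1.
Proof.
move=> z1; have := congr1 (@cabs R) (kappa_circle p_gt1 z1).
by rewrite cabsN cabsM cabs_singinner_circle // cabs_frostman_circle // mulr1.
Qed.

Lemma kappa_L2 f : L2 f -> L2 (fun z => k z * f z).
Proof.
by apply: (L2_mulb (M := 1)); [exact: measurable_circle_kappa|move=> z z1; rewrite cabs_kappa_circle].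
Qed.

Lemma frostman_L2 f : L2 f -> L2 (fun z => b z * f z).
Proof.
by apply: (L2_mulb (M := 1)); [exact: measurable_circle_frostman|move=> z z1; rewrite cabs_frostman_circle].
Qed.

Lemma boundary_blaschke_ae : ae_eq_circle (boundary B) b.
Proof. by apply: circle_ae_neq1 => z z1 n1; exact: boundary_blaschke. Qed.

Lemma H2_multiplesE f : H2_multiples B f <->
  L2 f /\ exists2 g, H2 g & ae_eq_circle f (fun z => b z * g z).
Proof.
split=> -[fL [g gH fg]]; split=> //; exists g => //.
  by apply: circle_ae_mono2 fg boundary_blaschke_ae => z _ /= -> ->.
by apply: circle_ae_mono2 fg boundary_blaschke_ae => z _ /= -> ->.
Qed.

Lemma H2_multiples_H2 f : H2_multiples B f -> H2 f.
Proof.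
move=> /H2_multiplesE[fL [g gH fg]]; have [_ _ mb] := mult_frostman R p_gt1.
exact: (subsp_ae (@H2_closed R) fL (mb _ gH) fg).
Qed.

(** Since [b] is unimodular on the circle, dividing by [b] is an isometry, which
   makes the multiples of [b] a closed subspace. *)
Lemma H2_multiples_invariant : shift_invariant_subspace (H2_multiples B).
Proof.
have cV := @H2_closed R.
split.
- exact: H2_multiples_H2.
- apply/H2_multiplesE; split; first exact: L2_0.
  exists (fun=> 0); first by case: cV.
  by apply: circle_ae_neq1 => z _ _; rewrite mulr0.
- move=> c f g /H2_multiplesE[fL [f1 f1H ff]] /H2_multiplesE[gL [g1 g1H gg]].
  apply/H2_multiplesE; split; first by apply: L2D => //; exact: L2Z.
  exists (fun z => c * f1 z + g1 z); first by case: cV => _ _ lin _; exact: lin.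
  by apply: circle_ae_mono2 ff gg => z _ -> ->; ring.
- move=> f fL Hf; apply/H2_multiplesE; split=> //.
  have bJL : L2 (fun z => (b z)^* * f z).
    apply: (L2_mulb (M := 1)) => //; first by apply: measurable_circleJ; exact: measurable_circle_frostman.
    by move=> z z1; rewrite cabsJ cabs_frostman_circle.
  exists (fun z => (b z)^* * f z); last first.
    apply: circle_ae_neq1 => z z1 _.
    by rewrite mulrA mulJc cabs_frostman_circle // expr1n mul1r.
  apply: (subsp_closed cV bJL) => e e0.
  have s0 : 0 < Num.sqrt e by rewrite sqrtr_gt0.
  have [m /H2_multiplesE[mL [g gH mg]] /(normL2_lt _ s0)] := Hf _ s0.
  rewrite sqr_sqrtr ?ltW // => fm; exists g => //.
  have gL : L2 g by case: gH.
  suff -> : energy (fun z => (b z)^* * f z - g z) = energy (fun z => f z - m z) by [].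
  have bgL := frostman_L2 gL.
  rewrite (ae_energy (L2_measurable (L2B fL mL)) (L2_measurable (L2B fL bgL))); last first.
    by apply: circle_ae_mono mg => z _ ->.
  apply: eq_Rintegral => t _; rewrite /sqnorm; set z := circle t.
  have z1 : cabs z = 1 := cabs_circle t.
  have -> : f z - b z * g z = b z * ((b z)^* * f z - g z).
    by rewrite mulrBr mulrA mulJc cabs_frostman_circle // expr1n mul1r.
  by rewrite cabsM cabs_frostman_circle // mul1r.
- move=> f /H2_multiplesE[fL [g gH fg]]; have [_ _ mz] := mult_id R.
  apply/H2_multiplesE; split.
    by apply: (L2_mulb (M := 1)) => //; [exact: measurable_circle_id|move=> z ->].
  exists (fun z => z * g z); first exact: mz.
  by apply: circle_ae_mono fg => z _ ->; ring.
Qed.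

Lemma kappa_proj f : H2 f -> ae_eq_circle (fun z => k z * hardy_proj f z) (fun z => k z * f z).
Proof. by move=> /hardy_proj_id; apply: circle_ae_mono => z _ ->. Qed.

Lemma hankelE f : hankel k f = (fun z => k z * hardy_proj f z
   - hardy_proj (fun z => k z * hardy_proj f z) z).
Proof. by []. Qed.

(** The Hankel operator vanishes on [f] exactly when [k f] is its own projection. *)
Lemma hankel_kerE f : hankel_ker k f <-> H2 f /\ H2 (fun z => k z * f z).
Proof.
have cV := @H2_closed R.
have aux : H2 f -> [/\ L2 f, L2 (hardy_proj f), L2 (fun z => k z * f z)
    & L2 (fun z => k z * hardy_proj f z)].
  move=> fH; have fL : L2 f by case: fH.
  have [[pL _] _] := hardy_projP fL.
  by split=> //; exact: kappa_L2.
split=> [[fH]|[fH kfH]].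
  have [fL pL kL kpL] := aux fH; rewrite hankelE => h0; split=> //.
  have [qH _] := hardy_projP kpL.
  apply: (subsp_ae cV kL qH); apply: circle_ae_mono2 h0 (kappa_proj fH) => z _.
  by move=> /subr0_eq h1 <-.
have [fL pL kL kpL] := aux fH; split=> //; rewrite hankelE.
have kpH : H2 (fun z => k z * hardy_proj f z) by exact: (subsp_ae cV kpL kfH (kappa_proj fH)).
by apply: circle_ae_mono (hardy_proj_id kpH) => z _ ->; rewrite subrr.
Qed.

(** If [f] and [h = k f] lie in H^2, the identity [(1 - a conj S) h = (1 - a S) f]
   expresses [conj S * h] as an element of H^2, and [f = - b (conj S * h)]. *)
Lemma hankel_ker_multiples : hankel_ker k = H2_multiples B.
Proof.
have cV := @H2_closed R; have [_ _ mS] := mult_singinner R p_gt1.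
apply/funext => f; apply/propext; rewrite hankel_kerE; split.
  move=> [fH hH]; have fL : L2 f by case: fH.
  apply/H2_multiplesE; split=> //.
  exists (fun z => (- a^-1) * (k z * f z - f z + a * (S z * f z))).
    apply: (subspZ cV); apply: (subspD cV); first exact: (subspB cV).
    by apply: (subspZ cV); exact: mS.
  apply: circle_ae_neq1 => z z1 _.
  have kb := kappa_circle p_gt1 z1.
  have s0 := singinner_neq0 p z.
  have /andP[a0 _] := invsqrtp_bound R p_gt1.
  have aC : a != 0 :> C by apply/eqP => /(@complexI R) e; rewrite e ltxx in a0.
  have b0 : b z != 0 by rewrite -cabs_eq0 cabs_frostman_circle // oner_eq0.
  have d : 1 - a / S z != 0.
    have := cabs_kappa_circle z1; rewrite kappaE => e.
    by apply: contra_eqN e => /eqP ->; rewrite invr0 mulr0 cabs0 eq_sym oner_eq0.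
  have kS : k z * (1 - a / S z) = 1 - a * S z by rewrite kappaE mulfVK.
  have k1 : k z = - S z / b z by rewrite -kb mulfK.
  have e : k z - 1 + a * S z = a * (k z / S z).
    have -> : a * S z = 1 - k z * (1 - a / S z) by rewrite kS; ring.
    by ring.
  have -> : - a^-1 * (k z * f z - f z + a * (S z * f z)) = - a^-1 * (k z - 1 + a * S z) * f z.
    by ring.
  by rewrite e k1; field; rewrite b0 s0 aC.
move=> fM; have fH := H2_multiples_H2 fM; split=> //.
have /H2_multiplesE[fL [g gH fg]] := fM.
have h : H2 (fun z => -1 * (S z * g z)) by apply: (subspZ cV); exact: mS.
apply: (subsp_ae cV (kappa_L2 fL) h); apply: circle_ae_mono fg => z z1 ->.
by rewrite mulrA kappa_circle // mulN1r mulNr.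
Qed.

Lemma kappaJ_circle z : cabs z = 1 -> k z^-1 = (k z)^*.
Proof.
move=> z1; have SJ : S z^-1 = (S z)^*.
  rewrite -conj_circle // /singinner !cpowE -cexpJ; congr cexp.
  rewrite rmorphM /=; congr (_ * _); last by apply/esym; exact: conjc_real.
  by rewrite /cayley rmorphM fmorphV rmorphD rmorphB /= rmorph1.
have aJ : a^* = a :> C by exact: conjc_real.
have JV (x y : C) : (x / y)^* = x^* / y^* by rewrite rmorphM fmorphV.
have J1 (x : C) : (1 - x)^* = 1 - x^* by rewrite rmorphB rmorph1.
by rewrite !kappaE SJ JV !J1 JV [(a * _)^*]rmorphM /= aJ.
Qed.

Lemma J_kappa f z : cabs z = 1 -> J (fun z => k z * f z) z = (k z)^* * J f z.
Proof. by move=> z1; rewrite /J /= kappaJ_circle // mulrCA. Qed.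

Lemma kappaJ_L2 f : L2 f -> L2 (fun z => (k z)^* * f z).
Proof.
apply: (L2_mulb (M := 1)); first by apply: measurable_circleJ; exact: measurable_circle_kappa.
by move=> z z1; rewrite cabsJ cabs_kappa_circle.
Qed.

Lemma dot_kappaJ f g : dotL2 (fun z => (k z)^* * g z) f = dotL2 g (fun z => k z * f z).
Proof. by apply: dot_eq => z _; rewrite [(k z * f z)^*]rmorphM /= [RHS]mulrCA mulrA. Qed.

(** For [g] orthogonal to H^2 the projection term of the Hankel operator is
   invisible, so [g] lies in the cokernel iff [conj k * g] is orthogonal to
   H^2. *)
Lemma dot_hankel f g : H2 f -> H2perp g ->
  dotL2 g (hankel k f) = dotL2 (fun z => (k z)^* * g z) f.
Proof.
move=> fH [gL g0]; have fL : L2 f by case: fH.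
have [[pL _] _] := hardy_projP fL.
have kpL := kappa_L2 pL; have [qH _] := hardy_projP kpL; have qL : L2 _ := qH.1.
rewrite hankelE.
rewrite dotDr ?dotNr // ?(g0 _ qH) ?oppr0 ?addr0; last exact: L2N.
rewrite -dot_kappaJ; apply: ae_dotr; last exact: hardy_proj_id.
- exact: L2_measurable.
- exact: L2_measurable.
- exact: L2_measurable (kappaJ_L2 gL).
Qed.

Lemma hankel_cokerE g : hankel_coker k g <-> H2perp g /\ H2perp (fun z => (k z)^* * g z).
Proof.
split=> -[gp H]; split=> //.
  split; first by apply: kappaJ_L2; case: gp.
  by move=> h hH; rewrite -dot_hankel //; exact: H.
by move=> f fH; rewrite dot_hankel //; case: H => _; apply.
Qed.

(** On the circle [J (k f) = conj k * J f], because [k] is real on the real axis.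
   As [J] exchanges H^2 and its orthogonal complement, the two conditions of
   [hankel_cokerE] on [g] are those of [hankel_kerE] on [J g]. *)
Lemma hankel_coker_image : hankel_coker k = image_ae (@J R) (hankel_ker k).
Proof.
have cV := @H2_closed R; have cP := @H2perp_closed R.
apply/funext => g; apply/propext; rewrite hankel_cokerE; split.
  move=> [gp kgp]; have gL : L2 g by case: gp.
  split=> //; exists (J g); last first.
    by apply: circle_ae_mono (J_involutive g) => z _ ->.
  apply/hankel_kerE; have JgH := H2perp_J gp; split=> //.
  apply: (subsp_ae cV (kappa_L2 JgH.1) (H2perp_J kgp)).
  apply: circle_ae_neq1 => z z1 _.
  have z1' := cabs_inv_circle z1.
  by rewrite /J -kappaJ_circle // invrK; ring.
move=> [gL [f /hankel_kerE[fH kfH] gJ]].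
split; first exact: (subsp_ae cP gL (H2_J fH) gJ).
apply: (subsp_ae cP (kappaJ_L2 gL) (H2_J kfH)).
by apply: circle_ae_mono gJ => z z1 ->; rewrite J_kappa.
Qed.

End HankelKernel.

Theorem proposition3p7 (R : realType) (p : nat) (hp : prime p) :
  let B : R[i] -> R[i] := blaschke (xseq R p) in
  let k : R[i] -> R[i] := kappa p in
  [/\ (forall n : int, unit_disk (xseq R p n)),
      inner_function (fun v : R[i] => - cpow p (cayley v)) /\
      (forall v : R[i], unit_disk v -> (forall n : int, v <> xseq R p n) ->
         k v * B v = - cpow p (cayley v)),
      shift_invariant_subspace (H2_multiples B) /\
      hankel_ker k = H2_multiples B &
      unitary_involution (@J R) /\
      hankel_coker k = image_ae (@J R) (hankel_ker k)].
Proof.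
move=> B k; have p_gt1 := prime_gt1 hp; split.
- by move=> n; apply/unit_diskP; exact: xseq_in_disk.
- split; first exact: singinner_inner.
  by move=> v /unit_diskP v1 vx; exact: kappa_blaschke.
- split; [exact: H2_multiples_invariant|exact: hankel_ker_multiples].
- split; [exact: J_unitary|exact: hankel_coker_image].
Qed.
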